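(* Let $d\ge 0$ and $n\ge 2d$. The filtration of $A_d(n)$ by the number of trivalent vertices coincides with the radical filtration of the $\mathrm{Aut}(F_n)$-module $A_d(n)$; that is, $\mathrm{Rad}(A_{d,k}(n))=A_{d,k+1}(n)$ for every $k\ge 0$.
   Context: $\mathbb K$ is a fixed field of characteristic $0$; $F_n$ is the free group on $x_1,\dots,x_n$; modules are over $\mathbb K$. For an $\mathrm{Aut}(F_n)$-module $M$, $\mathrm{Rad}(M)$ is the intersection of all maximal submodules of $M$; the radical filtration of $M$ is $M\supset\mathrm{Rad}(M)\supset\mathrm{Rad}(\mathrm{Rad}(M))\supset\cdots$. Jacobi diagrams: $X_n$ is the disjoint union of $n$ oriented arcs numbered $1,\dots,n$. A Jacobi diagram on $X_n$ is a finite uni-trivalent graph $D$ with a cyclic order on the three half-edges at each trivalent vertex, whose univalent vertices are embedded in the interior of $X_n$ (up to orientation-preserving homeomorphisms of $X_n$ preserving each component), such that each connected component of $D$ has at least one univalent vertex. Its degree is half the number of vertices of $D$. $A_d(n)$ is the $\mathbb K$-vector space spanned by Jacobi diagrams of degree $d$ on $X_n$ modulo the STU relation: if a trivalent vertex has half-edges in cyclic order $(s,b,a)$ and the edge $s$ ends at a univalent vertex on $X_n$, then the diagram equals $D'-D''$, where $D'$ (resp. $D''$) is obtained by deleting this trivalent vertex and the edge $s$ and attaching $a,b$ to $X_n$ at two adjacent points near the former endpoint of $s$, with $a$ before $b$ (resp. $b$ before $a$) along the orientation. $A_{d,k}(n)\subset A_d(n)$ is the subspace spanned by diagrams with at least $k$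 trivalent vertices; $A_d(n)=A_{d,0}(n)\supset A_{d,1}(n)\supset\cdots$ are $\mathrm{Aut}(F_n)$-submodules. Action: for a homomorphism $f:F_n\to F_m$ the map $A_d(f):A_d(m)\to A_d(n)$ is defined as follows. Write $f(x_j)=x_{i_1}^{\epsilon_1}\cdots x_{i_l}^{\epsilon_l}$, $\epsilon_p=\pm1$. For a diagram $D$ on $X_m$, the $j$-th arc of $X_n$ is formed by concatenating, along its orientation and starting with the rightmost letter, copies of the arcs $i_l,\dots,i_1$ of $X_m$, the copy for $x_{i_p}^{\epsilon_p}$ being reversed if $\epsilon_p=-1$. $A_d(f)(D)$ is the sum over all ways of placing every univalent vertex of $D$ lying on arc $i$ at the corresponding point of one of the copies of arc $i$, with sign $(-1)^{\#\{\text{vertices placed on reversed copies}\}}$. Then $u\cdot g:=A_d(g)(u)$ is a right action of $\mathrm{Aut}(F_n)$ on $A_d(n)$. *)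

(* Defs.v *)
From HB Require Import structures.
From mathcomp Require Import all_boot all_order all_algebra all_fingroup.
From mathcomp Require Import boolp classical_sets.
From mathcomp Require Import generic_quotient ring_quotient.
From mathcomp.multinomials Require Import freeg.

Set Implicit Arguments.
Unset Strict Implicit.
Unset Printing Implicit Defensive.

Import GRing.Theory.

Section FreeGroup.
Variable n : nat.

(* The letter (i, false) is x_i and (i, true) is x_i^-1. *)
Definition letter := ('I_n * bool)%type.

Implicit Types (a b : letter) (w v z : seq letter).

Definition inv_letter a : letter := (a.1, ~~ a.2).

Definition is_reduced w := sorted (fun a b => b != inv_letter a) w.

Definition push a w :=
  if w is b :: w' then if b == inv_letter a then w' else a :: w else [:: a].

Definition reduce w := foldr push [::] w.

Definition inv_word w := rev (map inv_letter w).

Lemma inv_letterK : involutive inv_letter.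
Proof. by case=> i e; rewrite /inv_letter /= negbK. Qed.

Lemma inv_letter_neq a : a != inv_letter a.
Proof. by case: a => i []; rewrite /inv_letter xpair_eqE andbF. Qed.

Lemma push_reduced a w : is_reduced w -> is_reduced (push a w).
Proof.
case: w => [|b w] //= redw; case: ifPn => [_|neq_ba]; last by rewrite /= neq_ba.
by case: w redw => //= c w /andP[].
Qed.

Lemma foldr_push_reduced w v : is_reduced v -> is_reduced (foldr push v w).
Proof. by move=> redv; elim: w => //= a w; apply: push_reduced. Qed.

Lemma pushK a w : is_reduced w -> push a (push (inv_letter a) w) = w.
Proof.
case: w => [|b w] /=; first by rewrite eqxx.
rewrite inv_letterK; case: eqP => [->|_] /=; last by rewrite eqxx.
by case: w => [|c w] //= /andP[/negPf->].
Qed.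

Lemma foldr_push_reduce w v :
  is_reduced v -> foldr push v (reduce w) = foldr push v w.
Proof.
move=> redv; elim: w => //= a w IHw; rewrite -IHw.
have := foldr_push_reduced w (isT : is_reduced [::]); rewrite -/(reduce w).
case: (reduce w) => [|b u] //= redbu; case: eqP => [->|//] /=.
by rewrite pushK // foldr_push_reduced.
Qed.

Lemma reduce_id w : is_reduced w -> reduce w = w.
Proof.
elim: w => //= a w IHw redaw; rewrite -/(reduce w) (IHw (path_sorted redaw)).
by case: w redaw {IHw} => //= b w /andP[/negPf->].
Qed.

Record free_group := FreeGroup { word :> seq letter; _ : is_reduced word }.

HB.instance Definition _ := [isSub for word].
HB.instance Definition _ := [Choice of free_group by <:].

Definition mk_free w := FreeGroup (foldr_push_reduced w (isT : is_reduced [::])).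

Lemma word_reduced (x : free_group) : is_reduced x. Proof. exact: valP x. Qed.

Definition free_one := mk_free [::].
Definition free_mul (x y : free_group) := mk_free (x ++ y).
Definition free_inv (x : free_group) := mk_free (inv_word x).

Lemma reduce_reduced w : is_reduced (reduce w).
Proof. exact: foldr_push_reduced. Qed.

Lemma reduce_cat w v : reduce (w ++ v) = foldr push (reduce v) w.
Proof. exact: foldr_cat. Qed.

Lemma free_mulA : associative free_mul.
Proof.
move=> x y z; apply: val_inj => /=; rewrite [LHS]reduce_cat [RHS]reduce_cat.
rewrite (reduce_id (reduce_reduced _)) foldr_push_reduce ?reduce_reduced //.
by rewrite reduce_cat foldr_cat.
Qed.

Lemma free_mul1 : left_id free_one free_mul.
Proof. by move=> x; apply/val_inj/reduce_id/word_reduced. Qed.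

Lemma free_mulr1 : right_id free_one free_mul.
Proof.
by move=> x; apply: val_inj; rewrite /= [LHS]reduce_cat; apply/reduce_id/word_reduced.
Qed.

Lemma reduce_cancel w v : is_reduced v ->
  foldr push v (inv_word w ++ w) = v.
Proof.
elim: w v => //= a w IHw v redv.
rewrite /inv_word /= rev_cons cat_rcons foldr_cat /=.
have := @pushK (inv_letter a) (foldr push v w); rewrite inv_letterK => -> //.
  by rewrite -foldr_cat IHw.
exact: foldr_push_reduced.
Qed.

Lemma inv_wordK : involutive inv_word.
Proof. by move=> w; rewrite /inv_word map_rev revK mapK //; apply: inv_letterK. Qed.

Lemma free_mulV : left_inverse free_one free_inv free_mul.
Proof.
move=> x; apply: val_inj; rewrite /= [LHS]reduce_cat foldr_push_reduce ?reduce_reduced //.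
by rewrite -reduce_cat /reduce reduce_cancel.
Qed.

Lemma free_mulrV : right_inverse free_one free_inv free_mul.
Proof.
move=> x; apply: val_inj; rewrite /= [LHS]reduce_cat (reduce_id (reduce_reduced _)).
by rewrite -reduce_cat /reduce -{1}[word x]inv_wordK reduce_cancel.
Qed.

HB.instance Definition _ := isGroup.Build free_group
  free_mulA free_mul1 free_mulr1 free_mulV free_mulrV.

Definition free_gen (i : 'I_n) : free_group := mk_free [:: (i, false)].

Record free_aut := FreeAut {
  free_aut_hom :> {multiplicative free_group -> free_group};
  _ : bijective free_aut_hom }.

End FreeGroup.

(* A uni-trivalent graph is given by its half-edges 'I_(nhalf D): the cycles of
   [next] are the vertices together with the cyclic order of their half-edges,
   the cycles of [mate] are the edges.  A univalent vertex is identified with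
   its only half-edge, and [legs i] lists those lying on the i-th arc of X_n
   along the orientation of the arc. *)
Record prejacobi (n : nat) := Prejacobi {
  nhalf : nat;
  next : {perm 'I_nhalf};
  mate : {perm 'I_nhalf};
  legs : {ffun 'I_n -> seq 'I_nhalf} }.

Section PrejacobiChoice.
Variable n : nat.

Definition prejacobi_data (h : nat) : choiceType :=
  ({perm 'I_h} * {perm 'I_h} * {ffun 'I_n -> seq 'I_h})%type.

Definition prejacobi_encode (D : prejacobi n) : {h : nat & prejacobi_data h} :=
  Tagged prejacobi_data (next D, mate D, legs D).

Definition prejacobi_decode (x : {h : nat & prejacobi_data h}) : prejacobi n :=
  let: existT h (s, t, l) := x in Prejacobi s t l.

Lemma prejacobi_encodeK : cancel prejacobi_encode prejacobi_decode.
Proof. by case. Qed.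

HB.instance Definition _ := Choice.copy (prejacobi n) (can_type prejacobi_encodeK).

End PrejacobiChoice.

Section Jacobi.
Variables d n : nat.

Definition is_leg (D : prejacobi n) : pred 'I_(nhalf D) :=
  fun x => next D x == x.

Definition half_edge_adj (D : prejacobi n) : rel 'I_(nhalf D) :=
  fun x y => (y == next D x) || (y == mate D x).

Definition is_jacobi (D : prejacobi n) : bool :=
  [&& [forall x, #|porbit (next D) x| \in [:: 1; 3]],
      [forall x, (mate D x != x) && (mate D (mate D x) == x)],
      perm_eq (flatten (codom (legs D))) (enum (@is_leg D)),
      [forall x, exists y, is_leg y && connect (@half_edge_adj D) x y]
    & #|porbits (next D)| == d.*2].

Record jacobi := Jacobi { jacobi_graph :> prejacobi n; _ : is_jacobi jacobi_graph }.

HB.instance Definition _ := [isSub for jacobi_graph].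
HB.instance Definition _ := [Choice of jacobi by <:].

Definition trivalent_count (D : jacobi) : nat :=
  #|[set v in porbits (next D) | #|v| == 3]|.

Definition jacobi_iso (D D' : jacobi) : Prop :=
  exists phi : 'I_(nhalf D) -> 'I_(nhalf D'),
    [/\ bijective phi,
        forall x, phi (next D x) = next D' (phi x),
        forall x, phi (mate D x) = mate D' (phi x)
      & forall i, legs D' i = map phi (legs D i)].

(* D' is D with the half-edge s, its trivalent vertex and the univalent vertex
   at the other end of its edge deleted, the two other half-edges y, z of the
   vertex becoming univalent vertices on arc i; phi maps the half-edges of D' to
   the remaining half-edges of D. *)
Definition stu_resolution (D D' : jacobi) (s y z : 'I_(nhalf D))
    (i : 'I_n) (l : seq 'I_(nhalf D)) : Prop :=
  exists phi : 'I_(nhalf D') -> 'I_(nhalf D),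
    [/\ injective phi,
        forall x, (x \in codom phi) = (x \notin [:: s; mate D s]),
        forall x, phi (next D' x) =
                    if phi x \in [:: y; z] then phi x else next D (phi x),
        forall x, phi (mate D' x) = mate D (phi x)
      & forall j, map phi (legs D' j) = if j == i then l else legs D j].

(* D = D' - D'', where the trivalent vertex has half-edges (s, b, a) in cyclic
   order and the edge of s ends at a leg on arc i. *)
Definition stu (D D' D'' : jacobi) : Prop :=
  exists (s : 'I_(nhalf D)) (i : 'I_n) (l1 l2 : seq 'I_(nhalf D)),
    let b := next D s in let a := next D b in
    [/\ b != s,
        legs D i = l1 ++ mate D s :: l2,
        stu_resolution D' s a b i (l1 ++ a :: b :: l2)
      & stu_resolution D'' s a b i (l1 ++ b :: a :: l2)].

End Jacobi.

Section Span.
Local Open Scope ring_scope.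
Local Open Scope classical_set_scope.
Variables (K : pzRingType) (V : lmodType K).

Definition linear_span (S : set V) : set V :=
  [set u | exists2 s : seq (K * V),
     (forall p, p \in s -> S p.2) & u = \sum_(p <- s) p.1 *: p.2].

Lemma linear_spanD S u v :
  linear_span S u -> linear_span S v -> linear_span S (u + v).
Proof.
move=> [s hs ->] [t ht ->]; exists (s ++ t); last by rewrite big_cat.
by move=> p; rewrite mem_cat => /orP[/hs|/ht].
Qed.

Lemma linear_spanZ S a u : linear_span S u -> linear_span S (a *: u).
Proof.
move=> [s hs ->]; exists [seq (a * p.1, p.2) | p <- s].
  by move=> _ /mapP[p /hs ? ->].
by rewrite big_map scaler_sumr; apply: eq_bigr => p _; rewrite scalerA.
Qed.

Lemma linear_span0 S : linear_span S 0.
Proof. by exists [::] => //; rewrite big_nil. Qed.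

Lemma linear_span_mem S u : S u -> linear_span S u.
Proof.
move=> Su; exists [:: (1, u)]; last by rewrite big_seq1 scale1r.
by move=> p; rewrite inE => /eqP->.
Qed.

Definition linear_span_pred (S : set V) : {pred V} := fun u => `[< linear_span S u >].

Fact linear_span_zmod_closed S : zmod_closed (linear_span_pred S).
Proof.
split=> [|u v /asboolP hu /asboolP hv]; apply/asboolP; first exact: linear_span0.
by apply: linear_spanD => //; rewrite -scaleN1r; apply: linear_spanZ.
Qed.

HB.instance Definition _ S :=
  GRing.isZmodClosed.Build V (linear_span_pred S) (linear_span_zmod_closed S).

Definition mod_span (S : set V) := @Quotient.quot V (linear_span_pred S).

HB.instance Definition _ S := GRing.Zmodule.on (mod_span S).
HB.instance Definition _ S := Quotient.on (mod_span S).

Section QuotientModule.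
Variable S : set V.
Local Open Scope quotient_scope.

Definition mod_proj : V -> mod_span S := \pi_(mod_span S).

Lemma mod_projP u v : mod_proj u = mod_proj v <-> linear_span S (u - v).
Proof.
rewrite /mod_proj; split=> [/eqP|huv].
  by rewrite -Quotient.idealrBE => /asboolP.
by apply/eqP; rewrite -Quotient.idealrBE; apply/asboolP.
Qed.

Lemma mod_projK x : mod_proj (repr x) = x.
Proof. exact: reprK. Qed.

Lemma mod_projB : {morph mod_proj : u v / u - v}.
Proof. exact: raddfB. Qed.

HB.instance Definition _ := GRing.isZmodMorphism.Build V (mod_span S) mod_proj mod_projB.

Definition mod_scale (a : K) (x : mod_span S) : mod_span S := mod_proj (a *: repr x).

Lemma mod_scale_proj a u : mod_scale a (mod_proj u) = mod_proj (a *: u).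
Proof.
apply/mod_projP; rewrite -scalerBr; apply: linear_spanZ.
by apply/mod_projP; rewrite mod_projK.
Qed.

Lemma mod_scaleA a b x : mod_scale a (mod_scale b x) = mod_scale (a * b) x.
Proof. by rewrite mod_scale_proj scalerA. Qed.

Lemma mod_scale1 : left_id 1 mod_scale.
Proof. by move=> x; rewrite /mod_scale scale1r mod_projK. Qed.

Lemma mod_scaleDr : right_distributive mod_scale +%R.
Proof.
move=> a x y; rewrite -[x]mod_projK -[y]mod_projK -raddfD !mod_scale_proj.
by rewrite scalerDr raddfD.
Qed.

Lemma mod_scaleDl x : {morph mod_scale^~ x : a b / a + b}.
Proof. by move=> a b; rewrite /mod_scale scalerDl raddfD. Qed.

HB.instance Definition _ := GRing.Zmodule_isLmodule.Build K (mod_span S)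
  mod_scaleA mod_scale1 mod_scaleDr mod_scaleDl.

Fact mod_proj_scalable : scalable mod_proj.
Proof. by move=> a u; rewrite -mod_scale_proj. Qed.

HB.instance Definition _ :=
  GRing.isScalable.Build K V (mod_span S) *:%R mod_proj mod_proj_scalable.

End QuotientModule.
End Span.

Section JacobiSpace.
Local Open Scope ring_scope.
Local Open Scope classical_set_scope.
Variables (K : fieldType) (d n : nat).

Definition jacobi_relation : set {freeg (jacobi d n) / K} :=
  [set u | (exists D D', jacobi_iso D D' /\ u = << D >> - << D' >>) \/
           (exists D D' D'', stu D D' D'' /\ u = << D >> - (<< D' >> - << D'' >>))].

Definition jacobi_space := mod_span jacobi_relation.

HB.instance Definition _ := GRing.Lmodule.on jacobi_space.
HB.instance Definition _ := Quotient.on jacobi_space.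

Definition jacobi_class (D : jacobi d n) : jacobi_space :=
  mod_proj jacobi_relation << D >>.

Definition jacobi_filtration (k : nat) : set jacobi_space :=
  linear_span [set jacobi_class D | D in [set D | (k <= trivalent_count D)%N]].

End JacobiSpace.

Section Placement.
Variables (d m n : nat) (f : {multiplicative free_group n -> free_group m}).

Definition image_word (j : 'I_n) : seq (letter m) := word (f (free_gen j)).

(* The copies of arcs of X_m making up the arcs of X_n: the pair (j, q) is the
   copy given by the q-th letter of the word for f(x_j). *)
Definition arc_copy := {j : 'I_n & 'I_(size (image_word j))}.

Definition copy_letter (c : arc_copy) : letter m :=
  tnth (in_tuple (image_word (tag c))) (tagged c).

Definition copied_arc (c : arc_copy) : 'I_m := (copy_letter c).1.
Definition reversed_copy (c : arc_copy) : bool := (copy_letter c).2.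

Variable D : jacobi d m.

Definition is_placement (p : {ffun 'I_(nhalf D) -> option arc_copy}) : bool :=
  [forall x, if p x is Some c then x \in legs D (copied_arc c) else ~~ is_leg x].

Definition placement := {p | is_placement p}.

Definition copy_legs (p : placement) (c : arc_copy) : seq 'I_(nhalf D) :=
  let l := [seq x <- legs D (copied_arc c) | val p x == Some c] in
  if reversed_copy c then rev l else l.

(* An arc starts with the copy given by the rightmost letter. *)
Definition placed_legs (p : placement) (j : 'I_n) : seq 'I_(nhalf D) :=
  flatten [seq copy_legs p (Tagged (fun j => 'I_(size (image_word j))) q)
            | q <- rev (enum 'I_(size (image_word j)))].

Definition placed_graph (p : placement) : prejacobi n :=
  Prejacobi (next D) (mate D) [ffun j => placed_legs p j].

Definition reversed_count (p : placement) : nat :=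
  #|[set x | if val p x is Some c then reversed_copy c else false]|.

Lemma count_copy_legs p c x :
  count_mem x (copy_legs p c) = (val p x == Some c).
Proof.
have [/and5P[_ _ hl _ _] hp] := (valP D, valP p).
have uniqlegs i : uniq (legs D i).
  have : uniq (flatten (codom (legs D))) by rewrite (perm_uniq hl) enum_uniq.
  have /(nthP [::])[k ltk <-] : legs D i \in codom (legs D) by apply: codom_f.
  elim: (codom _) k ltk => //= s ss IH [|k] ltk; rewrite cat_uniq => /and3P[] //.
  by move=> _ _; apply: IH.
have uniqc : uniq (copy_legs p c).
  by rewrite /copy_legs; case: ifP; rewrite ?rev_uniq filter_uniq.
rewrite count_uniq_mem //; congr nat_of_bool.
have -> : (x \in copy_legs p c) = (val p x == Some c) && (x \in legs D (copied_arc c)).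
  by rewrite /copy_legs; case: ifP; rewrite ?mem_rev mem_filter.
by case: eqP => //= px; have /forallP/(_ x) := hp; rewrite px.
Qed.

Lemma placed_graphP p : is_jacobi d (placed_graph p).
Proof.
have [/and5P[h1 h2 hl h4 h5] hp] := (valP D, valP p).
apply/and5P; split=> //.
apply/allP => x _ /=; apply/eqP.
have -> : count_mem x (enum (is_leg (D:=placed_graph p))) = is_leg (D := D) x.
  by rewrite count_uniq_mem ?enum_uniq // mem_enum.
rewrite count_flatten /image_mem -!map_comp.
rewrite sumnE big_map -enumT big_enum /=.
under eq_bigr => j _.
  rewrite /= ffunE count_flatten -map_comp sumnE big_map.
  rewrite (perm_big (enum 'I_(size (image_word j)))) ?perm_rev //= big_enum /=.
  under eq_bigr => q _ do rewrite count_copy_legs.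
  over.
rewrite (sig_big_dep (fun=> true) (fun _ _ => true)
  (fun j q => (val p x == Some (Tagged (fun j => 'I_(size (image_word j))) q) : nat))) /=.
rewrite (eq_bigr (fun c => (val p x == Some c : nat))); last by case.
have /forallP/(_ x) := hp; case: (val p x) => [c xc|nlx]; last first.
  by rewrite (negPf nlx) big1.
rewrite (bigD1 c) //= eqxx big1 ?addn0 => [|c' /negPf nc].
  apply/esym/eqP; rewrite eqb1.
  have : x \in flatten (codom (legs D)) by apply/flattenP; exists (legs D (copied_arc c)); rewrite ?codom_f.
  by rewrite (perm_mem hl) mem_enum.
by rewrite (inj_eq Some_inj) eq_sym nc.
Qed.

Definition placed (p : placement) : jacobi d n := Jacobi (placed_graphP p).

End Placement.

Section Action.
Local Open Scope ring_scope.
Variables (K : fieldType) (d m n : nat).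
Variable f : {multiplicative free_group n -> free_group m}.

Definition jacobi_pullback (D : jacobi d m) : jacobi_space K d n :=
  \sum_(p : placement f D) (-1) ^+ reversed_count p *: jacobi_class K (placed p).

(* The map A_d(f).  Since [fglift jacobi_pullback] respects the relations, the
   result does not depend on the representative chosen by [repr]. *)
Definition jacobi_map (u : jacobi_space K d m) : jacobi_space K d n :=
  fglift jacobi_pullback (repr u).

End Action.

Section Radical.
Local Open Scope ring_scope.
Local Open Scope classical_set_scope.
Variables (K : pzRingType) (M : lmodType K) (G : Type) (act : M -> G -> M).

Definition is_submodule (N : set M) : Prop :=
  [/\ N 0, forall a u v, N u -> N v -> N (a *: u + v)
    & forall u g, N u -> N (act u g)].

Definition is_maximal_submodule (P N : set M) : Prop :=
  [/\ is_submodule N, N `<=` P, N <> P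
    & forall Q, is_submodule Q -> N `<=` Q -> Q `<=` P -> Q = N \/ Q = P].

(* The intersection with P only matters if P has no maximal submodule. *)
Definition radical (P : set M) : set M :=
  P `&` \bigcap_(N in is_maximal_submodule P) N.

Definition radical_filtration (k : nat) : set M := iter k radical [set: M].

End Radical.

Section Module.
Variables (K : fieldType) (d n : nat).

Definition jacobi_act (u : jacobi_space K d n) (g : free_aut n) : jacobi_space K d n :=
  jacobi_map g u.

End Module.

(* Main.v *)
From HB Require Import structures.
From mathcomp Require Import all_boot all_order all_algebra all_fingroup qpoly.
From mathcomp Require Import generic_quotient ring_quotient.
From mathcomp.multinomials Require Import freeg.
From mathcomp Require Import zify ring.
From mathcomp Require boolp classical_sets.
Require Import Defs.

(* Write A_k for the filtration step.  Modulo A_{k+1} the order of the legs on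
   an arc is irrelevant, by STU, so a graph with m legs gives a map from the
   tensor power (K^n)^{(x) m} to A_k / A_{k+1} placing the legs on the arcs, and
   these maps intertwine Aut(F_n), acting on K^n through its abelianization.

   Rad(A_k) <= A_{k+1}: as m <= 2d <= n, subspaces of the tensor power stable
   under elementary integer matrices have GL_n-stable complements (a Maschke
   averaging over the m-multilinear part, in characteristic 0).  Hence a
   submodule of A_k containing A_{k+1} and maximal among those avoiding a given
   element outside A_{k+1} is a maximal submodule.

   A_{k+1} <= Rad(A_k): the automorphism x_i |-> x_q x_i x_q^-1 acts trivially on
   the graded pieces.  If a diagram E has a as only leg on arc i and b as only
   leg on arc q, it sends E to E plus the STU difference of the two orders of
   a and b on arc i.  All diagrams with one more trivalent vertex and legs on
   different arcs arise so, with an empty arc q left because m < n, and they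
   generate A_{k+1} modulo A_{k+2}.  So N + A_{k+1} = A_k propagates down the
   (finite) filtration to N = A_k. *)

Set Implicit Arguments.
Unset Strict Implicit.
Unset Printing Implicit Defensive.

Import GRing.Theory.

(** * Tensor representations *)

(** [Aut(F_n)] only supplies integer matrices and K is an arbitrary field of characteristic 0, so
    there is no compact or finite group to average over. The way out is that the tensor power of M
    is polynomial in the entries of M. A subspace stable under all 1 + E_ij with i <> j is therefore
    stable under the tensor power of every matrix, singular ones included, hence under the
    symmetrized matrix units, and the averaging runs over these. The bound n >= 2d provides an
    injective map from legs to arcs; such a map separates the permutations of the legs, which makes
    the average of a projection onto a stable subspace restrict to the identity there. On the
    combinatorial side, STU is read backwards, as joining two adjacent legs into a trivalent vertex.
    Half-edges then range over arbitrary finite types, so that this surgery needs no renumbering of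
    ordinals; the diagrams of the statement are reached through isomorphism. *)

Section CharZero.
Local Open Scope ring_scope.
Variable K : fieldType.
Hypothesis charK0 : [pchar K] =i pred0.

Lemma natr_inj : injective (fun k : nat => k%:R : K).
Proof.
have h := (pcharf0P K).1 charK0.
move=> i j e; wlog le : i j e / (i <= j)%N.
  by move=> W; case/orP: (leq_total i j) => l; [exact: W|apply/esym/W].
apply/eqP; rewrite eqn_leq le -subn_eq0 -h natrB //.
by move: e => /= ->; rewrite subrr.
Qed.

(** Natural roots are split off one at a time as linear factors; in characteristic 0 distinct
    naturals stay distinct in K. *)
Lemma nat_nonroot (q : {poly K}) : q != 0 ->
  exists N, forall k, (N <= k)%N -> q.[k%:R] != 0.
Proof.
elim: {q}(size q) {-2}q (leqnn (size q)) => [|s IH] q sq q0.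
  by rewrite leqn0 size_poly_eq0 (negPf q0) in sq.
have [[k0 /factor_theorem[r er]]|nr] := boolp.EM (exists k : nat, root q k%:R); last first.
  by exists 0%N => k _; apply/negP => qk; apply: nr; exists k.
have r0 : r != 0 by apply: contraNneq q0 => r0; rewrite er r0 mul0r.
have [|N hN] := IH r _ r0.
  by move: sq; rewrite er size_Mmonic ?monicXsubC // size_XsubC addn2.
exists (maxn k0.+1 N) => k; rewrite geq_max => /andP[k0k Nk].
rewrite er hornerM hornerXsubC mulf_neq0 ?hN // subr_eq0.
by apply: contraTneq k0k => /natr_inj ->; rewrite ltnn.
Qed.

End CharZero.

(** * Tensor powers of K^n and the matrices preserving a subspace of them *)

Section Tensor.
Local Open Scope ring_scope.
Variables (K : fieldType) (n : nat) (L : finType).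

(** The tensor power of K^n indexed by L, in coordinates: a map L -> 'I_n names a tensor product of
    basis vectors. *)
Definition tensor := {ffun {ffun L -> 'I_n} -> K^o}.
HB.instance Definition _ := GRing.Lmodule.on tensor.
HB.instance Definition _ := Vector.on tensor.

Implicit Types (v w : tensor) (A B M : 'M[K]_n).

(** The tensor power of M. Singular M are allowed, and the averaging depends on them. *)
Definition tens M v : tensor :=
  [ffun b : {ffun L -> 'I_n} => \sum_(c : {ffun L -> 'I_n}) (\prod_l M (b l) (c l)) * v c].

Definition delta_tensor (c : {ffun L -> 'I_n}) : tensor := [ffun b => (b == c)%:R].

Lemma tensD M : {morph tens M : v w / v + w}.
Proof.
move=> v w; apply/ffunP => b; rewrite !ffunE -big_split.
by apply: eq_bigr => c _; rewrite ffunE mulrDr.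
Qed.

Lemma tensZ M a v : tens M (a *: v) = a *: tens M v.
Proof.
apply/ffunP => b; rewrite !ffunE scaler_sumr.
by apply: eq_bigr => c _; rewrite ffunE /GRing.scale /= mulrCA.
Qed.

Lemma tensP M a v w : tens M (a *: v + w) = a *: tens M v + tens M w.
Proof. by rewrite tensD tensZ. Qed.

HB.instance Definition _ M := GRing.isLinear.Build K tensor tensor *:%R (tens M) (tensP M).

Lemma tensM A B v : tens (A *m B) v = tens A (tens B v).
Proof.
apply/ffunP => b; rewrite !ffunE.
under eq_bigr => c _.
  rewrite (eq_bigr (fun l => \sum_k A (b l) k * B k (c l))); last by move=> l _; rewrite mxE.
  rewrite bigA_distr_bigA mulr_suml; over.
rewrite exchange_big /=; apply: eq_bigr => f _.
rewrite ffunE mulr_sumr; apply: eq_bigr => c _.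
by rewrite big_split mulrA.
Qed.

Lemma prod_eqf (b c : {ffun L -> 'I_n}) : \prod_l ((b l == c l)%:R : K) = (b == c)%:R.
Proof.
have [->|ne] := eqVneq b c; first by rewrite big1 // => l _; rewrite eqxx.
have [l nl] : exists l, b l != c l.
  apply/existsP; apply: contraNT ne; rewrite negb_exists => /forallP h.
  by apply/eqP/ffunP => l; apply/eqP; have := h l; rewrite negbK.
by rewrite (bigD1 l) //= (negPf nl) mul0r.
Qed.

Lemma sum_delta (T : finType) (F : T -> K) b : \sum_c (b == c)%:R * F c = F b.
Proof.
rewrite (bigD1 b) //= eqxx mul1r big1 ?addr0 // => c.
by rewrite eq_sym => /negPf ->; rewrite mul0r.
Qed.

Lemma tens_scalar a v : tens a%:M v = a ^+ #|L| *: v.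
Proof.
apply/ffunP => b; rewrite !ffunE -[RHS]/(a ^+ #|L| * v b) -(sum_delta (fun c => a ^+ #|L| * v c)).
apply: eq_bigr => c _; rewrite -prod_eqf mulrA; congr (_ * _).
rewrite -prodr_const -big_split; apply: eq_bigr => l _.
by rewrite mxE /= mulr_natl.
Qed.

Variable U : tensor -> Prop.
Hypotheses (U0 : U 0) (UP : forall a v w, U v -> U w -> U (a *: v + w)).

Lemma subspaceZ a v : U v -> U (a *: v).
Proof. by move=> hv; rewrite -[_ *: _]addr0; apply: UP. Qed.

Lemma subspace_sum (I : Type) (r : seq I) (P : pred I) (F : I -> tensor) :
  (forall i, P i -> U (F i)) -> U (\sum_(i <- r | P i) F i).
Proof.
by move=> h; apply: big_ind => // v w hv hw; rewrite -[v]scale1r; apply: UP.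
Qed.

Definition stab M := forall v, U v -> U (tens M v).

Lemma stab_mul A B : stab A -> stab B -> stab (A *m B).
Proof. by move=> hA hB v hv; rewrite tensM; apply/hA/hB. Qed.

Lemma stab_scalar a : stab a%:M.
Proof. by move=> v hv; rewrite tens_scalar; apply: subspaceZ. Qed.

Lemma stab_scale a A : stab A -> stab (a *: A).
Proof. by move=> hA; rewrite -mul_scalar_mx; apply: stab_mul hA; apply: stab_scalar. Qed.

(* [tens (A + t B) v] is polynomial of degree #|L| in t, hence a combination of
   its values at #|L| + 1 points. *)
Lemma stab_line A B (s : nat -> K) : injective s ->
  (forall i, stab (A + s i *: B)) -> forall t, stab (A + t *: B).
Proof.
move=> s_inj h t v hv.
pose N := #|L|.+1.
pose F (b c : {ffun L -> 'I_n}) : {poly K} :=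
  \prod_l ((A (b l) (c l))%:P + (B (b l) (c l)) *: 'X).
have FE b c u : (F b c).[u] = \prod_l (A + u *: B) (b l) (c l).
  rewrite horner_prod; apply: eq_bigr => l _.
  by rewrite !hornerE !mxE mulrC.
have szF b c : (size (F b c) <= N)%N.
  apply: leq_trans (size_prod_leq _ _) _; rewrite leq_subLR addnS ltnS.
  have -> : (#|L| + #|L| = \sum_(l : L) 2)%N by rewrite sum_nat_const muln2 addnn.
  apply: leq_sum => l _.
  apply: leq_trans (size_polyD _ _) _; rewrite geq_max.
  rewrite (leq_trans (size_polyC_leq1 _)) //=.
  by apply: leq_trans (size_scale_leq _ _) _; rewrite size_polyX.
have -> : tens (A + t *: B) v =
    \sum_(i < N) (tnth (lagrange N s) i : {poly K}).[t] *: tens (A + s i *: B) v.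
  apply/ffunP => b; rewrite sum_ffunE ffunE.
  under [RHS]eq_bigr => i _ do rewrite !ffunE scaler_sumr.
  rewrite exchange_big /=; apply: eq_bigr => c _.
  rewrite -FE (lagrange_gen (n := N) _ s_inj (szF b c)) // horner_sum mulr_suml.
  apply: eq_bigr => i _; rewrite hornerM hornerC FE.
  by rewrite /GRing.scale /= mulrA [X in X * v c]mulrC.
by apply: subspace_sum => i _; apply/subspaceZ/h.
Qed.

End Tensor.

Section Torus.
Local Open Scope ring_scope.

(** Whitehead's factorization of diag(t, 1/t). With x(t) = 1 + t e, y(t) = 1 + t f and w(t) = x(t)
    y(-1/t) x(t), it is w(t) w(-1), the two middle factors x(t) x(-1) being merged into x(t - 1). *)
Lemma torus_elementary (K : fieldType) n (t : K) (e f p q : 'M[K]_n) : t != 0 ->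
  e *m e = 0 -> f *m f = 0 -> e *m f = p -> f *m e = q -> p *m e = e -> p *m f = 0 ->
  q *m f = f -> q *m e = 0 ->
  (1%:M + t *: e) *m (1%:M + - t^-1 *: f) *m (1%:M + (t - 1) *: e) *m
    (1%:M + 1 *: f) *m (1%:M + - 1 *: e) = 1%:M + (t - 1) *: p + (t^-1 - 1) *: q.
Proof.
move=> t0 ee ff ef fe pe pf qf qe.
have -> : (1%:M + t *: e) *m (1%:M + - t^-1 *: f) = 1%:M + t *: e - t^-1 *: f - p.
  rewrite mulmxDr mulmx1 -scalemxAr mulmxDl mul1mx -scalemxAl ef.
  by apply/matrixP => x y; rewrite !mxE; field.
have -> : (1%:M + t *: e - t^-1 *: f - p) *m (1%:M + (t - 1) *: e) =
    1%:M + t *: e - t^-1 *: f - p - (1 - t^-1) *: q.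
  rewrite mulmxDr mulmx1 -scalemxAr !(mulmxDl, mulNmx) mul1mx -!scalemxAl ee fe pe.
  by apply/matrixP => x y; rewrite !mxE; field.
have -> : (1%:M + t *: e - t^-1 *: f - p - (1 - t^-1) *: q) *m (1%:M + 1 *: f) =
    1%:M + t *: e + (t - 1) *: p - (1 - t^-1) *: q.
  rewrite mulmxDr mulmx1 -scalemxAr !(mulmxDl, mulNmx) mul1mx -!scalemxAl ef ff pf qf.
  by apply/matrixP => x y; rewrite !mxE; field.
rewrite mulmxDr mulmx1 -scalemxAr !(mulmxDl, mulNmx) mul1mx -!scalemxAl ee pe qe.
by apply/matrixP => x y; rewrite !mxE; field.
Qed.

End Torus.

(** * From elementary integer matrices to all matrices *)

Section StabAll.
Local Open Scope ring_scope.
Variables (K : fieldType) (n : nat) (L : finType).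
Hypothesis charK0 : [pchar K] =i pred0.
Variable U : tensor K n L -> Prop.
Hypotheses (U0 : U 0) (UP : forall a v w, U v -> U w -> U (a *: v + w)).
Hypothesis stab1 : forall i j, i != j -> stab U (1%:M + delta_mx i j).

Let stabM := stab_mul (U := U).
Let natK_inj := natr_inj charK0.

(** Natural t come from the powers of 1 + E_ij, and interpolation gives every other t. *)
Let stab_off i j t : i != j -> stab U (1%:M + t *: delta_mx i j).
Proof.
move=> nij; apply: (stab_line U0 UP natK_inj) => k {t}.
elim: k => [|k IH]; first by rewrite scale0r addr0; apply: (stab_scalar U0 UP).
have -> : 1%:M + k.+1%:R *: delta_mx i j =
    (1%:M + delta_mx i j) *m (1%:M + k%:R *: delta_mx i j) :> 'M[K]_n.
  rewrite mulmxDl mul1mx mulmxDr mulmx1 -scalemxAr mul_delta_mx_0 ?scaler0; last by rewrite eq_sym.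
  by rewrite addr0 -addrA (addrC (k%:R *: _)) mulrS scalerDl scale1r.
by apply: stabM => //; exact: stab1.
Qed.

(** A diagonal of determinant 1 when r is duplicate-free and avoids i, hence a product of matrices
    diag(t, 1/t). *)
Let torus (t : K) (i : 'I_n) (r : seq 'I_n) : 'rV[K]_n :=
  \row_k if k == i then t ^+ size r else if k \in r then t^-1 else 1.

Let stab_torus t i r : t != 0 -> uniq r -> i \notin r -> stab U (diag_mx (torus t i r)).
Proof.
move=> t0; elim: r => [|j r IH] /=.
  move=> _ _; have -> : diag_mx (torus t i [::]) = 1%:M; last exact: (stab_scalar U0 UP).
  by apply/matrixP => x y; rewrite !mxE /= expr0 if_same.
rewrite inE negb_or => /andP[jr ur] /andP[ij ir].
have nji : j == i = false by rewrite eq_sym (negPf ij).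
have -> : diag_mx (torus t i (j :: r)) = (1%:M + (t - 1) *: delta_mx i i + (t^-1 - 1) *: delta_mx j j)
    *m diag_mx (torus t i r).
  rewrite mul_mx_diag; apply/matrixP => x y; rewrite !mxE.
  case: (eqVneq x y) => [<-|xy]; last first.
    have nxy k : (x == k) && (y == k) = false.
      by apply: contraNF xy => /andP[/eqP -> /eqP ->].
    by rewrite !mulr0n !nxy !mulr0 !addr0 mul0r.
  rewrite !andbb inE; case: (eqVneq x i) => [->|xi].
    by rewrite (negPf ij) /= mulr1n !mulr0 addr0 mulr1 subrKC exprS.
  case: (eqVneq x j) => [->|xj] /=.
    by rewrite (negPf jr) mulr0 !mulr1 addr0 subrKC mulr1n.
  by rewrite !mulr0 !addr0 mul1r.
apply: stabM; last exact: IH.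
rewrite -(torus_elementary (e := delta_mx i j) (f := delta_mx j i)) //;
  rewrite ?mul_delta_mx ?mul_delta_mx_0 ?nji //.
by do ![apply: stabM]; apply: stab_off; rewrite ?nji // eq_sym nji.
Qed.

(** Let r consist of all indices but i. Then t times the matrix of [torus t i r] has t^n at i and 1
    elsewhere, and scalar matrices act as homotheties. The values t^n - 1 for t = 1, 2, ... are the
    interpolation points. *)
Let stab_diag i t : stab U (1%:M + t *: delta_mx i i).
Proof.
have n0 : (0 < n)%N by apply: leq_ltn_trans (ltn_ord i).
pose s (k : nat) : K := k.+1%:R ^+ n - 1.
apply: (stab_line U0 UP (s := s)) => [k l /addIr|k].
  rewrite -!natrX => /natK_inj /eqP; rewrite eqn_exp2r // => /eqP[].
  by [].
have k0 : k.+1%:R != 0 :> K by rewrite ((pcharf0P K).1 charK0).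
have -> : 1%:M + s k *: delta_mx i i = k.+1%:R *: diag_mx (torus k.+1%:R i (rem i (enum 'I_n))).
  apply/matrixP => x y; rewrite !mxE size_rem ?mem_enum // size_enum_ord.
  rewrite mem_rem_uniq ?enum_uniq // inE mem_enum andbT.
  case: (eqVneq x y) => [<-|xy]; last first.
    have -> : (x == i) && (y == i) = false by apply: contraNF xy => /andP[/eqP -> /eqP ->].
    by rewrite !mulr0n !mulr0 addr0.
  rewrite andbb; case: (eqVneq x i) => _; rewrite !mulr1n.
    by rewrite -exprS prednK // mulr1 /s subrKC.
  by rewrite mulr0 addr0 mulfV.
apply: (stab_scale U0 UP); apply: stab_torus => //.
  by rewrite rem_uniq // enum_uniq.
by rewrite mem_rem_uniq ?enum_uniq // !inE eqxx.
Qed.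

Let stab_elem i j t : stab U (1%:M + t *: delta_mx i j).
Proof. by have [<-|] := eqVneq i j; [exact: stab_diag|exact: stab_off]. Qed.

(** Since E_kj E_lj = 0 for l <> j, the product of the factors 1 + u_k E_kj just adds up their
    terms. *)
Let stab_col_off j (u : 'I_n -> K) r : j \notin r ->
  stab U (1%:M + \sum_(k <- r) u k *: delta_mx k j).
Proof.
elim: r => [|k r IH] /=.
  by move=> _; rewrite big_nil addr0; apply: (stab_scalar U0 UP).
rewrite inE negb_or big_cons => /andP[njk jr].
have -> : 1%:M + (u k *: delta_mx k j + \sum_(k <- r) u k *: delta_mx k j) =
  (1%:M + u k *: delta_mx k j) *m (1%:M + \sum_(k <- r) u k *: delta_mx k j).
  rewrite mulmxDl mul1mx mulmxDr mulmx1 mulmx_sumr.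
  rewrite [X in _ = _ + (_ + X)]big1_seq ?addr0 => [|l /= lr]; first by rewrite addrA addrAC.
  rewrite -scalemxAl -scalemxAr mul_delta_mx_0 ?scaler0 //.
  by apply: contraNneq jr => ->.
by apply: stabM; [exact: stab_elem|exact: IH].
Qed.

Let stab_col j (u : 'I_n -> K) : stab U (1%:M + \sum_k u k *: delta_mx k j).
Proof.
have -> : 1%:M + \sum_k u k *: delta_mx k j = (1%:M + u j *: delta_mx j j) *m
    (1%:M + \sum_(k <- [seq k <- enum 'I_n | k != j]) u k *: delta_mx k j).
  rewrite mulmxDl mul1mx mulmxDr mulmx1 mulmx_sumr.
  rewrite [X in _ = _ + (_ + X)]big1_seq ?addr0 => [|l /=]; last first.
    rewrite mem_filter => /andP[lj _].
    by rewrite -scalemxAl -scalemxAr mul_delta_mx_0 ?scaler0 // eq_sym.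
  by rewrite big_filter big_enum_cond /= (bigD1 j) //= addrA addrAC.
apply: stabM; first exact: stab_elem.
by apply: stab_col_off; rewrite mem_filter eqxx.
Qed.

(** Factoring out X leaves 1 + t X^-1 E_ij, which differs from the identity in column j only. *)
Let stab_add (X : 'M[K]_n) i j t : X \in unitmx -> stab U X -> stab U (X + t *: delta_mx i j).
Proof.
move=> uX hX.
have -> : X + t *: delta_mx i j = X *m (1%:M + \sum_k (t * invmx X k i) *: delta_mx k j).
  rewrite mulmxDr mulmx1; congr (_ + _).
  have -> : \sum_k (t * invmx X k i) *: delta_mx k j = t *: (invmx X *m delta_mx i j).
    rewrite [in RHS](matrix_sum_delta (invmx X)) mulmx_suml scaler_sumr.
    apply: eq_bigr => k _; rewrite mulmx_suml (bigD1 i) //= big1 ?addr0 => [|l li].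
      by rewrite -scalemxAl mul_delta_mx scalerA.
    by rewrite -scalemxAl mul_delta_mx_0 ?scaler0.
  by rewrite -scalemxAr mulmxA mulmxV // mul1mx.
by apply: stabM => //; exact: stab_col.
Qed.

(* Adding the entries of M one at a time to t times the identity, the partial
   sums are invertible for all but finitely many t. *)
Lemma stab_all M : stab U M.
Proof.
pose part (r : seq ('I_n * 'I_n)) := \sum_(x <- r) M x.1 x.2 *: delta_mx x.1 x.2 : 'M[K]_n.
have H r : exists2 q : {poly K}, q != 0 & forall t, q.[t] != 0 -> stab U (part r + t%:M).
  elim: r => [|x r [q q0 hq]].
    exists 1 => [|t _]; first exact: oner_neq0.
    by rewrite /part big_nil add0r; apply: (stab_scalar U0 UP).
  exists (q * char_poly (- part r)) => [|t].
    by rewrite mulf_neq0 // monic_neq0 ?char_poly_monic.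
  rewrite hornerM mulf_eq0 negb_or => /andP[/hq h1 h2].
  rewrite /part big_cons -/(part r) -addrA addrC; apply: stab_add => //.
  have := h2; rewrite -[_ == 0]/(root _ _) -eigenvalue_root_char /eigenvalue negbK.
  rewrite kermx_eq0 row_free_unit -opprD unitmxE -scaleN1r detZ unitrM => /andP[_].
  by rewrite unitmxE.
have [q q0 hq] := H (enum {: 'I_n * 'I_n}).
have {hq} hq t : q.[t] != 0 -> stab U (M + t *: 1%:M).
  move=> /hq; congr (stab U (_ + _)); last by rewrite scalemx1.
  by rewrite [RHS]matrix_sum_delta pair_bigA /= /part big_enum.
(* M is the value at t = 0 of the line M + t, which is known to be stable at all large natural t. *)
have [N hN] := nat_nonroot charK0 q0.
rewrite -[M]addr0 -(scale0r 1%:M).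
apply: (stab_line U0 UP (s := fun k => (N + k)%:R)).
  by move=> k l /natK_inj /addnI.
by move=> k; apply: hq; apply: hN; apply: leq_addr.
Qed.

End StabAll.

Section Subspace.
Local Open Scope ring_scope.

(** Turns a subspace given by a predicate into a [{vspace V}], on which [projv] is available. W
    grows inside U one vector at a time, and k bounds the codimension left. *)
Lemma subspace_vspace (K : fieldType) (V : vectType K) (U : V -> Prop) :
  U 0 -> (forall a v w, U v -> U w -> U (a *: v + w)) ->
  exists W : {vspace V}, forall v, U v <-> v \in W.
Proof.
move=> U0 UP.
suff H k (W : {vspace V}) : (\dim {:V} <= \dim W + k)%N -> (forall v, v \in W -> U v) ->
    exists W : {vspace V}, forall v, U v <-> v \in W.
  apply: (H (\dim {:V}) 0%VS); first by rewrite dimv0.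
  by move=> v; rewrite memv0 => /eqP ->.
elim: k W => [|k IH] W hk hW.
  exists W => v; split=> [_|]; last exact: hW.
  have -> : W = fullv; last exact: memvf.
  by apply/eqP; rewrite eqEdim subvf -(addn0 (\dim W)).
have [[v [Uv vW]]|nv] := boolp.EM (exists v, U v /\ v \notin W); last first.
  exists W => v; split=> [Uv|]; last exact: hW.
  by case: (boolP (v \in W)) => // vW; case: nv; exists v.
apply: (IH (W + <[v]>)%VS).
  apply: leq_trans hk _; rewrite -addSnnS leq_add2r.
  rewrite ltnNge; apply: contra vW => hd.
  have /eqP -> : W == (W + <[v]>)%VS by rewrite eqEdim addvSl.
  by rewrite memvE addvSr.
move=> w /memv_addP[w1 /hW h1 [w2 /vlineP[a ->] ->]].
by rewrite addrC; apply: UP.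
Qed.

End Subspace.

(** * Equivariant projections onto stable subspaces *)

Section Complement.
Local Open Scope ring_scope.
Variables (K : fieldType) (n : nat) (L : finType).
Local Notation coloring := {ffun L -> 'I_n}.
Local Notation tensor := (tensor K n L).
Implicit Types (v w : tensor) (x y b c : coloring).

Definition reindex_coloring x (s : {perm L}) : coloring := [ffun l => x (s l)].

(** A symmetrized matrix unit: the sum over s of the operators sending the basis tensor y o s to x o
    s. These operators commute with the permutations of the factors and span the Schur algebra. *)
Definition transfer x y v : tensor :=
  [ffun b => \sum_s (b == reindex_coloring x s)%:R * v (reindex_coloring y s)].

Lemma transferP x y a v w : transfer x y (a *: v + w) = a *: transfer x y v + transfer x y w.
Proof.
apply/ffunP => b; rewrite !ffunE scaler_sumr -big_split; apply: eq_bigr => s _ /=.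
by rewrite !ffunE mulrDr /GRing.scale /= mulrCA.
Qed.

HB.instance Definition _ x y :=
  GRing.isLinear.Build K tensor tensor *:%R (transfer x y) (transferP x y).

(** A sum of matrix units over A, whose tensor power expands over the maps from L to A. *)
Definition coloring_mx (A : {set L}) x y : 'M[K]_n :=
  \matrix_(i, j) \sum_(l in A) (i == x l)%:R * (j == y l)%:R.

(* Inclusion-exclusion over the subsets of L isolates the bijections among all maps L -> L. *)
Lemma transfer_tens x y v : transfer x y v =
  \sum_(A : {set L}) (-1) ^+ #|~: A| *: tens (coloring_mx A x y) v.
Proof.
apply/ffunP => b; rewrite sum_ffunE ffunE.
pose g (t : {ffun L -> L}) : K := \sum_(c : coloring) (\prod_l ((b l == x (t l))%:R * (c l == y (t l))%:R)) * v c.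
have gE t : g t = (b == [ffun l => x (t l)])%:R * v [ffun l => y (t l)].
  rewrite /g -(sum_delta (fun c => (b == [ffun l => x (t l)])%:R * v c)).
  apply: eq_bigr => c _; rewrite big_split mulrA; congr (_ * _); rewrite mulrC.
  congr (_ * _); rewrite -prod_eqf; apply: eq_bigr => l _; rewrite ffunE //.
  by rewrite eq_sym.
transitivity (\sum_(A : {set L}) \sum_(t : {ffun L -> L})
    (-1) ^+ #|~: A| * (\prod_l (t l \in A)%:R) * g t); last first.
  apply: eq_bigr => A _; rewrite !ffunE scaler_sumr.
  under [RHS]eq_bigr => c _.
    under eq_bigr => l _ do rewrite mxE big_mkcond /=.
    rewrite bigA_distr_bigA mulr_suml scaler_sumr; over.
  rewrite exchange_big /=; apply: eq_bigr => t _.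
  rewrite /g mulr_sumr; apply: eq_bigr => c _.
  rewrite -mulrA [X in _ * X]mulrA -big_split; congr (_ * (_ * _)).
  apply: eq_bigr => l _ /=; case: (t l \in A); rewrite ?mul1r ?mul0r //.
rewrite exchange_big /=.
have -> : \sum_(t : {ffun L -> L}) \sum_(A : {set L}) (-1) ^+ #|~: A| * (\prod_l (t l \in A)%:R) * g t
    = \sum_(t : {ffun L -> L}) (injectiveb t)%:R * g t.
  apply: eq_bigr => t _; rewrite -mulr_suml; congr (_ * _).
  (* The signed count of the sets A containing the image of t vanishes unless t is onto, which for a
     map from the finite type L to itself means injective. *)
  transitivity (\prod_l (1 - (l \notin codom t)%:R : K)).
    rewrite bigA_distr; apply: eq_bigr => A _.
    rewrite -prodr_const [X in X * _]big_mkcond /=.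
    have -> : \prod_l (t l \in A)%:R = \prod_(l in ~: A) (l \notin codom t)%:R :> K.
      have [sub|nsub] := boolP [forall l, t l \in A].
        rewrite big1 => [|l _]; last by rewrite (forallP sub).
        rewrite big1 // => l; rewrite inE => lA; rewrite (_ : _ \notin _) //.
        by apply: contra lA => /codomP[k ->]; rewrite (forallP sub).
      move: nsub; rewrite negb_forall => /existsP[l lA].
      rewrite (bigD1 l) //= (negPf lA) mul0r (bigD1 (t l)) ?inE //=.
      by rewrite codom_f mul0r.
    rewrite [X in _ * X]big_mkcond -big_split; apply: eq_bigr => l _ /=.
    by rewrite inE; case: (l \in A); rewrite ?mul1r ?mulN1r.
  have [inj|ninj] := boolP (injectiveb t).
    rewrite big1 // => l _; rewrite (_ : _ \in _ = true) ?subr0 //.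
    by move/injectiveP: inj => inj; apply: (inj_card_onto inj).
  have [l nl] : exists l, l \notin codom t.
    apply/existsP; apply: contraNT ninj; rewrite negb_exists => /forallP h.
    apply/injectiveP/injectiveP/(leq_size_uniq (enum_uniq L)).
      by move=> l _; have := h l; rewrite negbK.
    by rewrite size_codom cardE.
  by rewrite (bigD1 l) //= nl subrr mul0r.
rewrite (bigID (fun t : {ffun L -> L} => injectiveb t)) /= [X in _ = _ + X]big1 ?addr0 => [|t /negPf ->]; last exact: mul0r.
rewrite [RHS](reindex (fun s : {perm L} => val s)) /=.
  apply: eq_big => [s|s _]; first by rewrite (valP s).
  rewrite (valP s) mul1r gE; congr ((_ == _)%:R * v _); apply/ffunP => l; by rewrite !ffunE pvalE.
exists (insubd (1%g : {perm L})) => s /= hs; first by rewrite valKd.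
by rewrite insubdK.
Qed.

Section Stable.
Hypothesis charK0 : [pchar K] =i pred0.
Hypothesis Ln : (#|L| <= n)%N.
Variable U : tensor -> Prop.
Hypotheses (U0 : U 0) (UP : forall a v w, U v -> U w -> U (a *: v + w)).
Hypothesis stab1 : forall i j, i != j -> stab U (1%:M + delta_mx i j).

Lemma transfer_stable x y v : U v -> U (transfer x y v).
Proof.
move=> hv; rewrite transfer_tens; apply: (subspace_sum U0 UP) => A _.
by apply: (subspaceZ U0 UP); apply: (stab_all charK0 U0 UP).
Qed.

(** Here M acts on the second index, in [tens_transfer] on the first. The coefficients are the same
    up to exchanging the summed and the fixed coloring, so summing over the shared coloring y in
    [stable_complement] gives an operator commuting with [tens M]. *)
Lemma transfer_tensr x y M v :
  transfer x y (tens M v) = \sum_(b : coloring) (\prod_l M (y l) (b l)) *: transfer x b v.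
Proof.
apply/ffunP => c; rewrite sum_ffunE ffunE.
under [RHS]eq_bigr => b _ do rewrite !ffunE scaler_sumr.
rewrite exchange_big /=; apply: eq_bigr => s _.
rewrite ffunE mulr_sumr (reindex (fun b => reindex_coloring b s)) /=.
  apply: eq_bigr => b _; rewrite /GRing.scale /= mulrCA; congr (_ * (_ * _)).
  rewrite [RHS](reindex_inj (@perm_inj _ s)); apply: eq_bigr => l _; by rewrite !ffunE.
exists (fun b => reindex_coloring b s^-1) => b _; apply/ffunP => l; rewrite !ffunE.
  by rewrite permK || rewrite permKV.
by rewrite permKV || rewrite permK.
Qed.

Lemma tens_transfer x y M v :
  tens M (transfer x y v) = \sum_(b : coloring) (\prod_l M (b l) (x l)) *: transfer b y v.
Proof.
apply/ffunP => c; rewrite sum_ffunE ffunE.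
under eq_bigr => b _ do rewrite ffunE mulr_sumr.
under [RHS]eq_bigr => b _ do rewrite !ffunE scaler_sumr.
rewrite exchange_big [RHS]exchange_big /=; apply: eq_bigr => s _.
transitivity ((\prod_l M (c l) (reindex_coloring x s l)) * v (reindex_coloring y s)).
  rewrite (bigD1 (reindex_coloring x s)) //= eqxx mul1r [X in _ + X]big1 ?addr0 // => b /negPf ->.
  by rewrite mul0r mulr0.
pose c' := reindex_coloring c s^-1.
have cc' : c = reindex_coloring c' s by apply/ffunP => l; rewrite !ffunE permK.
rewrite (bigD1 c') //= -cc' eqxx mul1r [X in _ + X]big1 ?addr0 => [|b bc].
  rewrite /GRing.scale /=; congr (_ * _).
  rewrite [RHS](reindex_inj (@perm_inj _ s)); apply: eq_bigr => l _.
  by rewrite !ffunE permK.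
have -> : (c == reindex_coloring b s) = false.
  apply: contraNF bc => /eqP cb; apply/eqP/ffunP => l.
  by rewrite /c' cb !ffunE permKV.
by rewrite mul0r scaler0.
Qed.

(** Injectivity of x makes the colorings x o s distinct, so only equal permutations survive in the
    composite. Each s then contributes the sum over y of the diagonal matrix units at y o s, that is
    the identity. *)
Lemma sum_transfer (x : coloring) v : injective x ->
  \sum_(y : coloring) transfer y x (transfer x y v) = #|{perm L}|%:R *: v.
Proof.
move=> xI; apply/ffunP => b; rewrite sum_ffunE ffunE.
under eq_bigr => y _.
  rewrite ffunE (eq_bigr (fun s => (b == reindex_coloring y s)%:R * v b)) => [|s _].
    over.
  case: eqP => [e|_]; rewrite ?mul0r // !mul1r ffunE (bigD1 s) //= eqxx mul1r.
  rewrite big1 ?addr0 -?e // => s' ns.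
  have -> : (reindex_coloring x s == reindex_coloring x s') = false.
    apply: contraNF ns => /eqP/ffunP h; apply/eqP/permP => l.
    by have := h l; rewrite !ffunE => /xI ->.
  by rewrite mul0r.
rewrite exchange_big /= (eq_bigr (fun=> v b)) => [|s _].
  by rewrite sumr_const /GRing.scale /= mulr_natl.
pose c' := reindex_coloring b s^-1.
have cc' : b = reindex_coloring c' s by apply/ffunP => l; rewrite !ffunE permK.
rewrite (bigD1 c') //= -cc' eqxx mul1r [X in _ + X]big1 ?addr0 // => y yc.
have -> : (b == reindex_coloring y s) = false.
  apply: contraNF yc => /eqP cb; apply/eqP/ffunP => l.
  by rewrite /c' cb !ffunE permKV.
by rewrite mul0r.
Qed.

(* Maschke: averaging any linear projection onto U through the maps [transfer]
   gives an equivariant one. *)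
Lemma stable_complement : exists C : tensor -> Prop,
  [/\ C 0 /\ forall a v w, C v -> C w -> C (a *: v + w),
      forall M, stab C M,
      forall v, U v -> C v -> v = 0 &
      forall v, exists2 u, U u & C (v - u)].
Proof.
have [x xI] : exists x : coloring, injective x.
  pose f (l : L) : 'I_n := widen_ord Ln (enum_rank l).
  exists [ffun l => f l] => l k; rewrite !ffunE => /(congr1 val) /= e.
  by apply/enum_rank_inj/val_inj.
have [W hW] := subspace_vspace U0 UP.
pose c : K := #|{perm L}|%:R.
have c0 : c != 0.
  rewrite ((pcharf0P K).1 charK0) -lt0n; apply/card_gt0P; by exists 1%g.
pose Phi v := c^-1 *: \sum_(y : coloring) transfer y x (projv W (transfer x y v)).
have PhiP a v w : Phi (a *: v + w) = a *: Phi v + Phi w.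
  rewrite /Phi; under eq_bigr => y _ do rewrite transferP linearP transferP.
  by rewrite big_split -scaler_sumr scalerDr scalerA mulrC -scalerA.
have PhiM M v : Phi (tens M v) = tens M (Phi v).
  rewrite /Phi [RHS]tensZ; congr (_ *: _); rewrite [RHS]linear_sum.
  under [RHS]eq_bigr => y _ do rewrite /= tens_transfer.
  rewrite exchange_big /=; apply: eq_bigr => b _.
  rewrite transfer_tensr !linear_sum; apply: eq_bigr => y _ /=.
  by rewrite !linearZ.
have PhiU v : U (Phi v).
  apply/(subspaceZ U0 UP)/(subspace_sum U0 UP) => y _; apply: transfer_stable.
  by apply/hW/memv_proj.
have PhiK v : U v -> Phi v = v.
  move=> hv; rewrite /Phi (eq_bigr (fun y => transfer y x (transfer x y v))) => [|y _].
    by rewrite sum_transfer // scalerA mulVf // scale1r.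
  by rewrite projv_id //; apply/hW; apply: transfer_stable.
exists (fun v => Phi v = 0); split.
- split=> [|a v w hv hw]; last by rewrite PhiP hv hw scaler0 addr0.
  by apply: PhiK.
- by move=> M v hv; rewrite PhiM hv -(scale0r 0) tensZ !scale0r.
- by move=> v /PhiK ->.
- move=> v; exists (Phi v); first exact: PhiU.
  by rewrite -[v - _]addrC -scaleN1r PhiP PhiK ?PhiU // scaleN1r addNr.
Qed.

(** As c is injective, a single matrix maps the basis vector of c l to that of b l for all l at
    once. *)
Lemma stable_full (c : coloring) : injective c -> U (delta_tensor K c) -> forall v, U v.
Proof.
move=> cI Uc v.
have -> : v = \sum_(b : coloring) v b *: delta_tensor K b.
  apply/ffunP => b; rewrite sum_ffunE -(sum_delta v); apply: eq_bigr => y _.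
  by rewrite !ffunE /GRing.scale /= mulrC.
apply: (subspace_sum U0 UP) => b _; apply: (subspaceZ U0 UP).
have -> : delta_tensor K b = tens (coloring_mx [set: L] b c) (delta_tensor K c).
  apply/ffunP => y; rewrite !ffunE.
  transitivity (\prod_l coloring_mx [set: L] b c (y l) (c l)).
    rewrite -prod_eqf; apply: eq_bigr => l _; rewrite mxE (bigD1 l) //= eqxx mulr1 big1 ?addr0 //.
    by move=> k /andP[_ /negPf kl]; rewrite (inj_eq cI) [l == k]eq_sym kl mulr0.
  rewrite -[LHS](sum_delta (fun z : coloring => \prod_l coloring_mx [set: L] b c (y l) (z l))).
  by apply: eq_bigr => z _; rewrite ffunE mulrC eq_sym.
by apply: (stab_all charK0 U0 UP).
Qed.

End Stable.
End Complement.

(** * Automorphisms of free groups *)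

Section FreeHom.
Local Open Scope group_scope.
Variables (n m : nat) (u : 'I_n -> free_group m).

Definition letter_value (a : letter n) : free_group m := if a.2 then (u a.1)^-1 else u a.1.

Definition word_value (w : seq (letter n)) : free_group m :=
  foldr (fun a x => letter_value a * x) 1 w.

Lemma letter_value_inv a : letter_value (inv_letter a) = (letter_value a)^-1.
Proof. by case: a => i []; rewrite /letter_value //= invgK. Qed.

Lemma word_value_cat w v : word_value (w ++ v) = word_value w * word_value v.
Proof. by elim: w => [|a w IH] /=; rewrite ?mul1g // IH mulgA. Qed.

Lemma word_value_push a w : word_value (push a w) = letter_value a * word_value w.
Proof.
case: w => [|b w] //=; case: eqP => [->|//].
by rewrite letter_value_inv mulgA mulgV mul1g.
Qed.

Lemma word_value_reduce w : word_value (reduce w) = word_value w.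
Proof. by elim: w => //= a w IH; rewrite word_value_push IH. Qed.

Definition free_hom (x : free_group n) : free_group m := word_value x.

Lemma free_homM : {morph free_hom : x y / x * y}.
Proof. by move=> x y; rewrite /free_hom -word_value_cat; exact: word_value_reduce. Qed.

HB.instance Definition _ := isMultiplicative.Build (free_group n) (free_group m) free_hom free_homM.

Lemma free_hom_gen i : free_hom (free_gen i) = u i.
Proof. by rewrite /free_hom /= /letter_value /= mulg1. Qed.

End FreeHom.

Section MultiplicativeGroup.
Local Open Scope group_scope.
Variables (G H : groupType) (f : {multiplicative G -> H}).

Lemma multiplicative1 : f 1 = 1.
Proof. by rewrite -[LHS]mulg1 -[X in _ * X](mulgV (f 1)) mulgA -gmulfM mulg1 mulgV. Qed.

Lemma multiplicativeV x : f x^-1 = (f x)^-1.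
Proof. by rewrite -[LHS]mulg1 -[X in _ * X](mulgV (f x)) mulgA -gmulfM mulVg multiplicative1 mul1g. Qed.

End MultiplicativeGroup.

Section FreeAut.
Local Open Scope group_scope.
Variable n : nat.

Lemma free_group_ind (P : free_group n -> Prop) : P 1 ->
  (forall i x, P x -> P (free_gen i * x)) -> (forall i x, P x -> P ((free_gen i)^-1 * x)) ->
  forall x, P x.
Proof.
move=> P1 Pg Pv [w]; elim: w => [|[i e] w IH] red.
  by have -> : FreeGroup red = 1 by exact: val_inj.
have redw := path_sorted red.
have -> : FreeGroup red = (if e then (free_gen i)^-1 else free_gen i) * FreeGroup redw.
  apply: val_inj; case: e red => red /=; rewrite -[LHS](reduce_id red) /=.
    by rewrite -/(reduce w).
  by rewrite -/(reduce w).
by case: e {red}; [apply: Pv|apply: Pg]; apply: IH.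
Qed.

Lemma free_hom_cancel (f g : {multiplicative free_group n -> free_group n}) :
  (forall i, g (f (free_gen i)) = free_gen i) -> cancel f g.
Proof.
move=> h x; elim/free_group_ind: x => [|i x IH|i x IH].
- by rewrite !multiplicative1.
- by rewrite !gmulfM h IH.
- by rewrite !gmulfM !multiplicativeV h IH.
Qed.

(** Kept transparent, so that its values on generators convert to those of [free_hom u]. *)
Definition free_aut_of (u v : 'I_n -> free_group n)
  (uv : forall i, free_hom v (u i) = free_gen i)
  (vu : forall i, free_hom u (v i) = free_gen i) : free_aut n.
Proof.
apply: (@FreeAut n (free_hom u)); exists (free_hom v); apply: free_hom_cancel => i /=.
  by rewrite free_hom_gen uv.
by rewrite free_hom_gen vu.
Defined.

Variables (i q : 'I_n).
Hypothesis niq : i != q.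

Lemma transvection_aut : exists g : free_aut n, forall j,
  word (g (free_gen j)) = if j == i then [:: (i, false); (q, false)] else [:: (j, false)].
Proof.
(* [u false] is the automorphism and [u true] its inverse; [H] then checks both composites at
   once. *)
pose u (e : bool) j := if j == i then free_gen i * (if e then (free_gen q)^-1 else free_gen q) else free_gen j.
have H e j : free_hom (u (~~ e)) (u e j) = free_gen j.
  rewrite {2}/u; case: (eqVneq j i) => [->|ji]; last by rewrite free_hom_gen /u (negPf ji).
  rewrite gmulfM /= free_hom_gen {1}/u eqxx -mulgA.
  have hq : free_hom (u (~~ e)) (free_gen q) = free_gen q.
    by rewrite free_hom_gen /u eq_sym (negPf niq).
  by case: e hq => /= hq; rewrite ?multiplicativeV /= hq ?mulgV ?mulVg mulg1.
exists (free_aut_of (H false) (H true)) => j.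
have -> : free_aut_of (H false) (H true) (free_gen j) = u false j by exact: free_hom_gen.
rewrite /u; case: eqP => // _.
by rewrite /= /reduce /= /inv_letter /= xpair_eqE andbF.
Qed.

Lemma conjugation_aut : exists g : free_aut n, forall j,
  word (g (free_gen j)) =
    if j == i then [:: (q, false); (i, false); (q, true)] else [:: (j, false)].
Proof.
pose u (e : bool) j := if j == i then
  (if e then (free_gen q)^-1 * free_gen i * free_gen q else free_gen q * free_gen i * (free_gen q)^-1)
  else free_gen j.
have H e j : free_hom (u (~~ e)) (u e j) = free_gen j.
  rewrite {2}/u; case: (eqVneq j i) => [->|ji]; last by rewrite free_hom_gen /u (negPf ji).
  have hq : free_hom (u (~~ e)) (free_gen q) = free_gen q.
    by rewrite free_hom_gen /u eq_sym (negPf niq).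
  case: e hq => /= hq; rewrite !gmulfM multiplicativeV /= hq free_hom_gen /u eqxx.
    by rewrite !mulgA mulVg mul1g -mulgA mulVg mulg1.
  by rewrite !mulgA mulgV mul1g -mulgA mulgV mulg1.
exists (free_aut_of (H false) (H true)) => j.
have -> : free_aut_of (H false) (H true) (free_gen j) = u false j by exact: free_hom_gen.
rewrite /u; case: eqP => // _.
rewrite /= /reduce /= /inv_letter /= !xpair_eqE ?andbF /=.
by rewrite /inv_letter xpair_eqE eq_sym (negPf niq) /= /inv_letter xpair_eqE andbF.
Qed.

End FreeAut.

(** * Jacobi diagrams over arbitrary finite types *)

(* A Jacobi diagram over an arbitrary finite type of half-edges: [nx], [mt] and
   [lg] are the [next], [mate] and [legs] of [prejacobi]. *)
Record diagram (n : nat) := Diagram {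
  half : finType;
  nx : half -> half;
  mt : half -> half;
  lg : 'I_n -> seq half }.
Arguments Diagram {n} half nx mt lg.

Lemma porbit3 (T : finType) (s : {perm T}) x :
  (#|porbit s x| \in [:: 1; 3]) = (s (s (s x)) == x).
Proof.
apply/idP/eqP => [|h].
  rewrite !inE => /orP[] /eqP h; have := iter_porbit s x; rewrite h /=.
    by move=> h1; rewrite !h1.
  by [].
have pos : (0 < #|porbit s x|)%N by apply/card_gt0P; exists x; exact: porbit_id.
have := iter_porbit s x; have := uniq_traject_porbit s x.
case: #|porbit s x| pos => [|[|[|[|c]]]] //= _.
  by move=> h1 h2; move: h1 h; rewrite h2 inE => /andP[/eqP h1 _] h3; rewrite h3 in h1.
by rewrite h !inE eqxx !orbT.
Qed.

Lemma porbit1 (T : finType) (s : {perm T}) x : (#|porbit s x| == 1) = (s x == x).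
Proof.
apply/eqP/eqP => h; first by have := iter_porbit s x; rewrite h.
have := uniq_traject_porbit s x.
have pos : (0 < #|porbit s x|)%N by apply/card_gt0P; exists x; exact: porbit_id.
case: #|porbit s x| pos => [|[|c]] //= _.
by rewrite h !inE eqxx.
Qed.

Lemma sum_porbit (T : finType) (s : {perm T}) (F : {set T} -> nat) :
  \sum_x F (porbit s x) = \sum_(o in porbits s) #|o| * F o.
Proof.
rewrite (partition_big (porbit s) (mem (porbits s))) /=; last first.
  by move=> x _; apply: imset_f.
apply: eq_bigr => _ /imsetP[x _ ->].
rewrite (eq_bigr (fun=> F (porbit s x))) => [|y /eqP-> //].
rewrite sum_nat_const; congr (_ * _); apply: eq_card => y.
exact: (eq_porbit_mem s y x).
Qed.

Section Diagram.
Variables (d n : nat).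
Implicit Types X Y : diagram n.

Definition leg X : pred (half X) := fun x => nx x == x.

(* [valid_conn] says that every half-edge reaches a leg, and [valid_deg], given
   [valid_nx], that there are 2d vertices. *)
Record valid X : Prop := Valid {
  valid_nx : forall x : half X, nx (nx (nx x)) = x;
  valid_mt_neq : forall x : half X, mt x != x;
  valid_mt : forall x : half X, mt (mt x) = x;
  valid_lg : forall x : half X, \sum_i count_mem x (lg X i) = leg x;
  valid_conn : forall P : half X -> Prop, (forall x, leg x -> P x) ->
    (forall x, P (nx x) -> P x) -> (forall x, P (mt x) -> P x) -> forall x, P x;
  valid_deg : #|half X| + #|leg (X := X)|.*2 = 6 * d }.

Definition diagram_of (D : prejacobi n) : diagram n :=
  Diagram 'I_(nhalf D) (next D) (mate D) (legs D).

Section PorbitCount.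
Variable D : prejacobi n.
Hypothesis D3 : forall x, next D (next D (next D x)) = x.

Let o13 o : o \in porbits (next D) -> #|o| \in [:: 1; 3].
Proof. by move=> /imsetP[x _ ->]; rewrite porbit3 D3. Qed.

Let leg_sum : #|leg (X := diagram_of D)| = \sum_(o in porbits (next D)) (#|o| == 1).
Proof.
transitivity (\sum_x ((#|porbit (next D) x| == 1) : nat)).
  rewrite -sum1_card big_mkcond; apply: eq_bigr => x _.
  by rewrite porbit1 /= /in_mem /= /leg /=; case: eqP.
rewrite (sum_porbit _ (fun o => (#|o| == 1) : nat)).
by apply: eq_bigr => o; case: eqP => [->|_ _]; rewrite ?muln0.
Qed.

(** A trivalent vertex has 3 half-edges, a leg has 1 and is counted twice more, so each vertex
    contributes 3. With 2d vertices this is the 6d of [valid_deg]. *)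
Lemma porbits_card :
  #|'I_(nhalf D)| + #|leg (X := diagram_of D)|.*2 = 3 * #|porbits (next D)|.
Proof.
have -> : #|'I_(nhalf D)| = \sum_(o in porbits (next D)) #|o|.
  rewrite -sum1_card (sum_porbit (next D) (fun=> 1)).
  by apply: eq_bigr => o _; rewrite muln1.
rewrite leg_sum -mul2n big_distrr -big_split -sum1_card big_distrr /=.
by apply: eq_bigr => o /o13; rewrite !inE => /orP[] /eqP ->.
Qed.

Lemma porbits_card_leg :
  #|[set v in porbits (next D) | #|v| == 3]| + #|leg (X := diagram_of D)| = #|porbits (next D)|.
Proof.
rewrite leg_sum -!sum1_card.
under eq_bigl => o do rewrite inE.
rewrite big_mkcondr -big_split /=; apply: eq_bigr => o /o13.
by rewrite !inE => /orP[] /eqP ->.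
Qed.
End PorbitCount.

Lemma perm_eq_legs (T : finType) (l : 'I_n -> seq T) (P : pred T) :
  (forall x, \sum_i count_mem x (l i) = P x) <-> perm_eq (flatten (codom l)) (enum P).
Proof.
have e x : count_mem x (flatten (codom l)) = \sum_i count_mem x (l i).
  by rewrite count_flatten /image_mem -map_comp sumnE big_map big_enum.
split=> [h|/seq.permP h x].
  apply/allP => x _ /=; rewrite e h count_uniq_mem ?enum_uniq // mem_enum.
  exact: eqxx.
by rewrite -e h count_uniq_mem ?enum_uniq // mem_enum.
Qed.

Lemma valid_diagram_of (D : prejacobi n) : is_jacobi d D <-> valid (diagram_of D).
Proof.
split.
  move=> /and5P[/forallP h1 /forallP h2 h3 /forallP h4 /eqP h5].
  have h3' x : next D (next D (next D x)) = x by apply/eqP; rewrite -porbit3.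
  split=> //= [x|x|x||].
  - by have /andP[] := h2 x.
  - by have /andP[_ /eqP] := h2 x.
  - move: x; apply/perm_eq_legs; rewrite (perm_trans _ h3) //.
  - move=> P P1 P2 P3 x; have /existsP[y /andP[ly /connectP[p pth ey]]] := h4 x.
    elim: p x pth ey => [x _ /= e|z p IH x /= /andP[/orP[] /eqP e pth] ey].
      by rewrite -e; exact: P1.
      by apply: P2; rewrite -e; apply: IH.
    by apply: P3; rewrite -e; apply: IH.
  by rewrite porbits_card // h5 -mul2n mulnA.
move=> [h1 h2 h3 h4 h5 h6]; apply/and5P; split.
- by apply/forallP => x; rewrite porbit3; apply/eqP/h1.
- by apply/forallP => x; apply/andP; split; [exact: h2|apply/eqP/h3].
- exact/perm_eq_legs.
- apply/forallP => x; apply/existsP.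
  elim/h5: x => [x lx|x [y /andP[ly c]]|x [y /andP[ly c]]].
  + by exists x; apply/andP; split; [exact: lx|exact: connect0].
  + exists y; apply/andP; split; first exact: ly.
    apply: connect_trans c; apply: connect1.
    by rewrite /half_edge_adj eqxx.
  + exists y; apply/andP; split; first exact: ly.
    apply: connect_trans c; apply: connect1.
    by rewrite /half_edge_adj eqxx orbT.
- by move: h6; rewrite porbits_card // => h; apply/eqP; lia.
Qed.

(** From here on the filtration is expressed by legs: at least k trivalent vertices means k plus the
    number of legs is at most 2d. *)
Lemma trivalent_count_leg (D : jacobi d n) :
  trivalent_count D + #|leg (X := diagram_of D)| = d.*2.
Proof.
have /valid_diagram_of v := valP D.
rewrite porbits_card_leg; last exact: valid_nx v.
by have /and5P[_ _ _ _ /eqP] := valP D.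
Qed.

Definition iso X Y : Prop :=
  exists phi : half X -> half Y,
    [/\ bijective phi,
        forall x, phi (nx x) = nx (phi x),
        forall x, phi (mt x) = mt (phi x)
      & forall i, lg Y i = map phi (lg X i)].

Lemma iso_sym X Y : iso X Y -> iso Y X.
Proof.
move=> [f [[g fK gK] h1 h2 h3]]; exists g; split; first by exists f.
- by move=> x; rewrite -{1}[x]gK -h1 fK.
- by move=> x; rewrite -{1}[x]gK -h2 fK.
- by move=> i; rewrite h3 -map_comp map_id_in // => x _ /=; rewrite fK.
Qed.

Lemma iso_trans X Y Z : iso X Y -> iso Y Z -> iso X Z.
Proof.
move=> [f [bf f1 f2 f3]] [g [bg g1 g2 g3]]; exists (g \o f); split.
- exact: bij_comp.
- by move=> x /=; rewrite f1 g1.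
- by move=> x /=; rewrite f2 g2.
- by move=> i; rewrite g3 f3 map_comp.
Qed.

Lemma iso_leg X Y : iso X Y -> #|leg (X := X)| = #|leg (X := Y)|.
Proof.
move=> [f [bf f1 _ _]]; rewrite -(card_imset _ (bij_inj bf)); apply: eq_card => y.
have [g fK gK] := bf.
apply/imsetP/idP => [[x lx ->]|ly].
  by move: lx; rewrite !unfold_in /leg -f1 (inj_eq (bij_inj bf)).
exists (g y); rewrite ?gK //; move: ly; rewrite !unfold_in /leg.
by rewrite -(inj_eq (bij_inj bf)) f1 gK.
Qed.

Lemma iso_valid X Y : iso X Y -> valid X -> valid Y.
Proof.
move=> isoXY [h1 h2 h3 h4 h5 h6]; have eL := iso_leg isoXY.
move: isoXY => [f [bf f1 f2 f3]]; have [g fK gK] := bf; have fI := bij_inj bf.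
split.
- by move=> x; rewrite -[x]gK -!f1 h1.
- by move=> x; rewrite -[x]gK -!f2 (inj_eq fI).
- by move=> x; rewrite -[x]gK -!f2 h3.
- move=> x; rewrite -[x]gK /leg -f1 (inj_eq fI) -[_ == _]/(leg (g x)) -h4.
  apply: eq_bigr => i _; rewrite f3 count_map; apply: eq_count => y /=.
  by rewrite (inj_eq fI).
- move=> P P1 P2 P3 x; rewrite -[x]gK.
  elim/h5: (g x) => [y ly|y Py|y Py].
  + by apply: P1; rewrite /leg -f1 (inj_eq fI).
  + by apply: P2; rewrite -f1.
  + by apply: P3; rewrite -f2.
- by rewrite -h6 eL (bij_eq_card bf).
Qed.

(** The default of [insubd], the identity, is met only when f is not injective; it makes [graph_of]
    total on all diagrams, valid or not. *)
Definition fun_perm (T : finType) (f : T -> T) : {perm 'I_#|T|} :=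
  insubd (1%g : {perm 'I_#|T|}) [ffun i => enum_rank (f (enum_val i))].

Lemma fun_permE (T : finType) (f : T -> T) i : injective f ->
  fun_perm f i = enum_rank (f (enum_val i)).
Proof.
move=> fI; rewrite /fun_perm -pvalE val_insubd.
case: ifP => [_|/negP[]]; first by rewrite ffunE.
apply/injectiveP => j k; rewrite !ffunE => /enum_rank_inj/fI; exact: enum_val_inj.
Qed.

Definition graph_of X : prejacobi n :=
  Prejacobi (fun_perm (nx (d := X))) (fun_perm (mt (d := X)))
    [ffun i => map enum_rank (lg X i)].

Lemma graph_of_iso X : valid X -> iso (diagram_of (graph_of X)) X.
Proof.
move=> v.
have nI : injective (nx (d := X)).
  by move=> x y h; rewrite -(valid_nx v x) h (valid_nx v).
have mI : injective (mt (d := X)) by exact: (can_inj (valid_mt v)).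
exists enum_val; split=> /=.
- exact: enum_val_bij.
- by move=> x; rewrite fun_permE // enum_rankK.
- by move=> x; rewrite fun_permE // enum_rankK.
- move=> i; rewrite ffunE -map_comp map_id_in // => x _ /=; exact: enum_rankK.
Qed.

Lemma graph_of_jacobi X : valid X -> is_jacobi d (graph_of X).
Proof.
by move=> v; apply/valid_diagram_of/(iso_valid _ v)/iso_sym/graph_of_iso.
Qed.

End Diagram.
Arguments iso {n}.

(** * Joining two adjacent legs into a trivalent vertex *)

Section Glue.
Variables (d n : nat).
Implicit Types X Y : diagram n.

(** X often serves as a mere frame: what it lists on arc i is discarded, and validity is asked of
    [set_lg X i l] rather than of X. *)
Definition set_lg X (i : 'I_n) (l : seq (half X)) : diagram n :=
  Diagram (half X) (nx (d := X)) (mt (d := X)) (fun j => if j == i then l else lg X j).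

Arguments set_lg : clear implicits.

Definition some2 (T : Type) (x : T) : option (option T) := Some (Some x).

Definition glue_nx (X : diagram n) (a b : half X) (z : option (option (half X))) :=
  match z with
  | None => None
  | Some None => some2 b
  | Some (Some x) => if x == b then some2 a else if x == a then Some None else some2 (nx x)
  end.

Definition glue_mt (X : diagram n) (z : option (option (half X))) :=
  match z with
  | None => Some None
  | Some None => None
  | Some (Some x) => some2 (mt x)
  end.

(* The legs a, b are joined into a trivalent vertex with half-edges (s, b, a),
   where s = Some None is matched with the new leg None on arc i. *)
Definition glue X (a b : half X) (i : 'I_n) (l1 l2 : seq (half X)) : diagram n :=
  Diagram (option (option (half X))) (glue_nx a b) (glue_mt (X := X))
    (fun j => if j == i then map (@some2 _) l1 ++ None :: map (@some2 _) l2
              else map (@some2 _) (lg X j)).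

Arguments glue : clear implicits.

Lemma some2_inj (T : Type) : injective (@some2 T).
Proof. by move=> x y []. Qed.

Lemma valid_perm m X (l : 'I_m -> seq (half X)) :
  (forall x, \sum_i count_mem x (l i) = \sum_i count_mem x (lg X i)) ->
  valid d X -> valid d (Diagram (half X) (nx (d := X)) (mt (d := X)) l).
Proof. by move=> h [h1 h2 h3 h4 h5 h6]; split=> //= x; rewrite h; exact: h4. Qed.

Lemma count_set_lg X i l l' x : count_mem x l = count_mem x l' ->
  \sum_j count_mem x (lg (set_lg X i l) j) = \sum_j count_mem x (lg (set_lg X i l') j).
Proof. by move=> h; apply: eq_bigr => j _ /=; case: eqP. Qed.

Lemma valid_set_lg X i l l' : perm_eq l l' -> valid d (set_lg X i l) ->
  valid d (set_lg X i l').
Proof.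
move=> /seq.permP h; apply: (valid_perm (X := set_lg X i l)) => x.
by apply/esym/(count_set_lg (X := X)).
Qed.

Lemma count_pair (T : eqType) (a b x : T) l1 l2 : count_mem x (l1 ++ a :: b :: l2)
  = count_mem x l1 + count_mem x l2 + (a == x) + (b == x).
Proof. by rewrite count_cat /=; lia. Qed.

Section GlueLegs.
Variables (X : diagram n) (a b : half X) (i : 'I_n) (l1 l2 : seq (half X)).
Let Xab := set_lg X i (l1 ++ a :: b :: l2).
Hypotheses (neq : a != b) (la : nx a = a) (lb : nx b = b).

Lemma glue_leg x : leg (X := glue X a b i l1 l2) (some2 x) = [&& leg x, x != a & x != b].
Proof.
rewrite /leg /=; case: (eqVneq x b) => [->|xb] /=.
  by rewrite (inj_eq (@some2_inj _)) (negPf neq) !andbF.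
by case: (eqVneq x a) => [->|xa] /=; rewrite ?andbF // andbT (inj_eq (@some2_inj _)).
Qed.

Lemma glue_card_leg : (#|leg (X := glue X a b i l1 l2)|.+1 = #|leg (X := X)|)%N.
Proof.
have -> : #|leg (X := X)| = (#|[pred x | [&& leg x, x != a & x != b]]|.+2)%N.
  rewrite (cardD1 a) (cardD1 b) /in_mem /= /leg la lb !eqxx eq_sym neq /=.
  congr (_.+2); apply: eq_card => x; rewrite /in_mem /=.
  by case: (x == a); case: (x == b); rewrite ?andbF //= ?andbT.
congr (_.+1).
rewrite (cardD1 None) /in_mem /= /leg /= ?eqxx add1n; congr (_.+1).
transitivity #|image (@some2 _) [pred x : half X | [&& leg x, x != a & x != b]]|; last first.
  exact: (card_image (@some2_inj _)).
apply: eq_card => -[[x|]|].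
- rewrite (mem_image (@some2_inj _)) /in_mem /=.
  exact: (glue_leg x).
- by rewrite /in_mem /=; apply/esym/negP => /imageP[].
- by rewrite /in_mem /=; apply/esym/negP => /imageP[].
Qed.

Lemma count_some2 (T : eqType) (x : T) l : count_mem (some2 x) (map (@some2 _) l) = count_mem x l :> nat.
Proof. by rewrite count_map; apply: eq_count => y /=; rewrite (inj_eq (@some2_inj _)). Qed.

Lemma glue_count x : \sum_j count_mem x (lg Xab j) =
  \sum_j count_mem (some2 x) (lg (glue X a b i l1 l2) j) + (a == x) + (b == x).
Proof.
rewrite (bigD1 i) //= [in RHS](bigD1 i) //= eqxx count_pair count_cat /= !count_some2.
rewrite add0n -!addnA; congr (_ + (_ + _)).
rewrite addnA addnC; congr (_ + _); apply: eq_bigr => j /negPf ->.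
by rewrite count_some2.
Qed.

(** Gluing adds two half-edges and loses one leg, so the count in [valid_deg] is unchanged. Every
    half-edge still reaches a leg: before gluing a and b are legs themselves, after gluing the whole
    new vertex is connected to the new leg. *)
Lemma valid_glueE : valid d (glue X a b i l1 l2) <-> valid d Xab.
Proof.
split=> v.
  have nxE x : x != a -> x != b -> [&& some2 (nx x) == glue_nx a b (some2 x), nx x != a & nx x != b].
    move=> xa xb; rewrite /= (negPf xa) (negPf xb) eqxx /=.
    have nI : injective (glue_nx a b).
      by move=> y z h; have := valid_nx v y; rewrite /= h; have /= -> := valid_nx v z.
    apply/andP; split.
      apply/eqP => e; case/eqP: (xb); apply/some2_inj/nI.
      by rewrite /= (negPf xa) (negPf xb) eqxx e.
    apply/eqP => e; have : some2 x = Some None; last by [].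
    by apply: nI; rewrite /= (negPf xa) (negPf xb) e.
  split.
  - move=> x /=; case: (eqVneq x a) => [->|xa]; first by rewrite !la.
    case: (eqVneq x b) => [->|xb]; first by rewrite !lb.
    have /and3P[_ h1 h2] := nxE _ xa xb; have /and3P[_ h3 h4] := nxE _ h1 h2.
    have := valid_nx v (some2 x); rewrite /= (negPf xa) (negPf xb) /= (negPf h1) (negPf h2) /=.
    by rewrite (negPf h3) (negPf h4) => -[].
  - by move=> x; have := valid_mt_neq v (some2 x); rewrite /= (inj_eq (@some2_inj _)).
  - by move=> x; have /= [] := valid_mt v (some2 x).
  - move=> x; rewrite glue_count (valid_lg v) glue_leg /leg /= !(eq_sym _ x).
    case: (eqVneq x a) => [->|xa] /=; first by rewrite la eqxx (negPf neq) /=.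
    by case: (eqVneq x b) => [->|xb] /=; rewrite ?lb ?eqxx ?andbT ?addn0.
  - move=> P P1 P2 P3 x.
    (* P is extended by [True] to the two half-edges that gluing added. *)
    pose P' (z : half (glue X a b i l1 l2)) := if z is Some (Some y) then P y else True.
    apply: (valid_conn v (P := P') _ _ _ (some2 x)) => -[[y|]|] //.
    + by rewrite glue_leg => /and3P[ly _ _]; apply: P1.
    + rewrite /=; case: (eqVneq y b) => [->|yb]; first by move=> _; apply: P1; rewrite /leg /= lb.
      case: (eqVneq y a) => [->|ya]; first by move=> _; apply: P1; rewrite /leg /= la.
      exact: P2.
    + exact: P3.
  - have := valid_deg v; rewrite /= !card_option -glue_card_leg doubleS !addnS.
    by [].
have nxI : injective (nx (d := X)).
  by move=> x y h; rewrite -(valid_nx v x) /= h (valid_nx v).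
have nab x : x != a -> x != b -> (nx x != a) && (nx x != b).
  by rewrite -{2}la -{2}lb !(inj_eq nxI) => -> ->.
split.
- case=> [[x|]|] //=; last by rewrite eqxx /= (negPf neq) eqxx.
  case: (eqVneq x b) => [->|xb] /=; first by rewrite (negPf neq) eqxx.
  case: (eqVneq x a) => [->|xa] /=; first by rewrite eqxx.
  have /andP[h1 h2] := nab _ xa xb; rewrite (negPf h1) (negPf h2) /=.
  have /andP[h3 h4] := nab _ h1 h2; rewrite (negPf h3) (negPf h4).
  by have /= -> := valid_nx v x.
- case=> [[x|]|] //=; rewrite (inj_eq (@some2_inj _)); exact: (valid_mt_neq v x).
- case=> [[x|]|] //=; by have /= -> := valid_mt v x.
- case=> [[x|]|].
  + have := valid_lg v x; rewrite glue_count glue_leg /leg /=.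
    rewrite !(eq_sym _ x); case: (eqVneq x a) => [->|xa] /=.
      by rewrite la eqxx (negPf neq) addn0 addn1 andbF => -[].
    case: (eqVneq x b) => [->|xb] /=; last by rewrite !addn0 !andbT.
    by rewrite lb eqxx addn0 addn1 => -[].
  + rewrite big1 // => j _ /=; case: eqP => _; rewrite ?count_cat /= ?count_map !(eq_count (a2 := pred0)) ?count_pred0 //.
  + rewrite (bigD1 i) //= eqxx count_cat /= !count_map !(eq_count (a2 := pred0)) ?count_pred0 // big1 //.
    by move=> j /negPf ->; rewrite count_map (eq_count (a2 := pred0)) // count_pred0.
- move=> P P1 P2 P3.
  have Pu : P None by apply: P1; rewrite /leg.
  have Ps : P (Some None) by exact: P3.
  have Pa : P (some2 a) by apply: P2; rewrite /= (negPf neq) eqxx.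
  have Pb : P (some2 b) by apply: P2; rewrite /= eqxx.
  case=> [[x|]|] //; elim/(valid_conn v): x => x /=.
  + move=> lx; case: (eqVneq x a) => [->//|xa]; case: (eqVneq x b) => [->//|xb].
    by apply: P1; rewrite glue_leg xa xb !andbT; exact: lx.
  + move=> Px; case: (eqVneq x a) => [->//|xa]; case: (eqVneq x b) => [->//|xb].
    by apply: P2; rewrite /= (negPf xa) (negPf xb).
  + by move=> Px; apply: P3.
- have h : #|half X| + #|leg (X := X)|.*2 = 6 * d by exact: valid_deg v.
  by rewrite /= !card_option -h -glue_card_leg doubleS !addnS.
Qed.

End GlueLegs.

Section LegPair.
Variables (X : diagram n) (a b : half X) (i : 'I_n) (l1 l2 : seq (half X)).
Let Xab := set_lg X i (l1 ++ a :: b :: l2).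
Hypothesis v : valid d Xab.

(** Validity lists each leg exactly once, which excludes a = b. *)
Lemma pair_neq : a != b.
Proof.
have := valid_lg v a; rewrite (bigD1 i) //= eqxx count_pair eqxx.
by rewrite eq_sym; case: (leg _); case: eqP => //= _; rewrite !addn1 !addSn.
Qed.

Let leg_in x : (0 < count_mem x (l1 ++ a :: b :: l2))%N -> nx x = x.
Proof.
move=> h; have := valid_lg v x; rewrite (bigD1 i) //= eqxx.
by rewrite /leg; case: eqP => //= _ /eqP; rewrite addn_eq0 -leqn0 leqNgt h.
Qed.

Lemma pair_leg1 : nx a = a. Proof. by apply: leg_in; rewrite count_pair eqxx addn1 addSn. Qed.
Lemma pair_leg2 : nx b = b. Proof. by apply: leg_in; rewrite count_pair eqxx addn1. Qed.

Lemma leg_glue x : leg (X := glue X a b i l1 l2) (some2 x) = [&& leg x, x != a & x != b].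
Proof. exact/glue_leg/pair_neq. Qed.

Lemma card_leg_glue : (#|leg (X := glue X a b i l1 l2)|.+1 = #|leg (X := X)|)%N.
Proof. exact: glue_card_leg pair_neq pair_leg1 pair_leg2. Qed.

Lemma valid_glue : valid d (glue X a b i l1 l2).
Proof. exact/(valid_glueE i l1 l2 pair_neq pair_leg1 pair_leg2). Qed.

End LegPair.

End Glue.
Arguments set_lg {n}.
Arguments glue {n}.

Lemma map_eq_cat (T U : Type) (f : T -> U) l s1 s2 : map f l = s1 ++ s2 ->
  exists l1 l2, [/\ l = l1 ++ l2, map f l1 = s1 & map f l2 = s2].
Proof.
move=> h; exists (take (size s1) l), (drop (size s1) l).
by rewrite cat_take_drop map_take map_drop h take_size_cat // drop_size_cat.
Qed.

Lemma map_eq_cons (T U : Type) (f : T -> U) l y s : map f l = y :: s ->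
  exists x l', [/\ l = x :: l', f x = y & map f l' = s].
Proof. by case: l => //= x l [<- <-]; exists x, l. Qed.

Lemma inj_surj_bij (A : choiceType) (B : eqType) (f : A -> B) :
  injective f -> (forall y, exists x, f x == y) -> bijective f.
Proof.
move=> fI fS; exists (fun y => xchoose (fS y)) => [x|y].
  by apply: fI; apply/eqP/(xchooseP (fS (f x))).
exact/eqP/(xchooseP (fS y)).
Qed.

(** * The relation [stu] as gluing, up to isomorphism *)

Section Stu.
Variables (d n : nat).

Lemma glue_stu (X : diagram n) a b i l1 l2 (D D' D'' : jacobi d n) :
  valid d (set_lg X i (l1 ++ a :: b :: l2)) ->
  iso (diagram_of D) (glue X a b i l1 l2) ->
  iso (diagram_of D') (set_lg X i (l1 ++ a :: b :: l2)) ->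
  iso (diagram_of D'') (set_lg X i (l1 ++ b :: a :: l2)) -> stu D D' D''.
Proof.
move=> v /iso_sym[g [[f gK fK] g1 g2 g3]] [f1 [bf1 f11 f12 f13]] [f2 [bf2 f21 f22 f23]].
have gI := can_inj gK; have neq := pair_neq v.
have la := pair_leg1 v; have lb := pair_leg2 v.
have g1' z : next D (g z) = g (glue_nx a b z) by have /esym := g1 z.
have g2' z : mate D (g z) = g (glue_mt z) by have /esym := g2 z.
have eb : next D (g (Some None)) = g (some2 b) by exact: (esym (g1 (Some None))).
have ea : next D (g (some2 b)) = g (some2 a) by have /= := g1 (some2 b); rewrite eqxx.
have es : mate D (g (Some None)) = g None by exact: (esym (g2 (Some None))).
(* Both resolutions are instances of this, with l the list on arc i in either order of a and b. *)
have res (D0 : jacobi d n) l h (bh : bijective h)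
    (h1 : forall x, h (next D0 x) = nx (d := X) (h x))
    (h2 : forall x, h (mate D0 x) = mt (d := X) (h x)) 
    (h3 : forall j, (if j == i then l else lg X j) = map h (legs D0 j)) :
  stu_resolution D0 (g (Some None)) (g (some2 a)) (g (some2 b)) i (map (g \o some2 (T := half X)) l).
  exists (g \o some2 (T := half X) \o h); split.
  - by move=> x y /= /gI [] /(bij_inj bh).
  - have [k hK kK] := bh; move=> x; rewrite es; apply/idP/idP.
      by case/codomP=> y ->; rewrite !inE !(inj_eq gI).
    rewrite !inE.
    rewrite negb_or -{1 2}(fK x) !(inj_eq gI) -[in X in _ -> X](fK x).
    by case: (f x) => [[y|]|] // _; apply/codomP; exists (k y); rewrite /= kK.
  - move=> x; rewrite /= h1 !inE !(inj_eq gI) !(inj_eq (@some2_inj _)) g1' /=.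
    case: (eqVneq (h x) a) => [->|xa] /=; first by rewrite la.
    case: (eqVneq (h x) b) => [->|xb] /=; first by rewrite lb.
    by [].
  - by move=> x; rewrite /= h2 g2'.
  - move=> j; rewrite [LHS]map_comp -h3 [legs D j]g3 /=.
    by case: eqP => // _; rewrite map_comp.
exists (g (Some None)), i, (map (g \o some2 (T := half X)) l1), (map (g \o some2 (T := half X)) l2).
rewrite /= eb ea es; split.
- by rewrite (inj_eq gI).
- by rewrite [legs D i]g3 /= eqxx map_cat /= -!map_comp.
- have := res D' (l1 ++ a :: b :: l2) _ bf1 f11 f12 f13; by rewrite map_cat.
- have := res D'' (l1 ++ b :: a :: l2) _ bf2 f21 f22 f23; by rewrite map_cat.
Qed.

Lemma stu_glue (D D' D'' : jacobi d n) : stu D D' D'' ->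
  exists (X : diagram n) a b i l1 l2,
  [/\ valid d (set_lg X i (l1 ++ a :: b :: l2)),
      iso (diagram_of D) (glue X a b i l1 l2),
      iso (diagram_of D') (set_lg X i (l1 ++ a :: b :: l2)) &
      iso (diagram_of D'') (set_lg X i (l1 ++ b :: a :: l2))].
Proof.
move=> [s [i [l1 [l2 /= [nbs ls [f1 [I1 c1 n1 m1 g1]] [f2 [I2 c2 n2 m2 g2]]]]]]].
set b := next D s in nbs n1 n2 g1 g2; set a := next D b in n1 n2 g1 g2.
have /valid_diagram_of vD := valP D; have /valid_diagram_of vD' := valP D'.
(* D' itself serves as the unglued diagram; [f1] identifies its half-edges with those of D other
   than s and its mate. *)
pose X := diagram_of D'.
have gi := g1 i; rewrite eqxx in gi.
have [l1' [t [et el1 gi1]]] := map_eq_cat gi.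
have [a' [t' [et' ea gi2]]] := map_eq_cons gi1.
have [b' [l2' [et'' eb el2]]] := map_eq_cons gi2.
have {gi gi1 gi2} et3 : legs D' i = l1' ++ a' :: b' :: l2' by rewrite et et' et''.
exists X, a', b', i, l1', l2'.
have iX : iso (diagram_of D') (set_lg X i (l1' ++ a' :: b' :: l2')).
  exists id; split=> //; first by exists id.
  by move=> j; rewrite map_id /=; case: eqP => // ->; rewrite et3.
have v := iso_valid iX vD'.
have na : next D a = s by have := valid_nx vD s.
have ms : mate D (mate D s) = s by have := valid_mt vD s.
have lms : next D (mate D s) = mate D s.
  have := valid_lg vD (mate D s); rewrite (bigD1 i) // [lg _ i]ls count_cat /= eqxx addnCA.
  by rewrite /leg /=; case: eqP.
split=> //.
- apply: iso_sym.
  pose h (z : half (glue X a' b' i l1' l2')) : 'I_(nhalf D) := match z with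
    | None => mate D s | Some None => s | Some (Some x) => f1 x end.
  have ns x : (f1 x != s) && (f1 x != mate D s).
    by have := c1 (f1 x); rewrite codom_f !inE negb_or => <-.
  have ms' : s != mate D s by rewrite eq_sym; exact: (valid_mt_neq vD).
  exists h; split.
  + apply: inj_surj_bij.
      case=> [[x|]|] [[y|]|] //= e; do ?[by rewrite (I1 _ _ e)];
      do ?[by have := ns x; rewrite e eqxx ?andbF];
      do ?[by have := ns y; rewrite -e eqxx ?andbF];
      by case/eqP: ms'; first [exact: e | exact: (esym e)].
    move=> y; have := c1 y; rewrite !inE; case: (eqVneq y s) => [->|_].
      by exists (Some None).
    case: (eqVneq y (mate D s)) => [->|_ /= /codomP[x ->]]; first by exists None.
    by exists (Some (Some x)).
  + case=> [[x|]|] /=; [|by rewrite eb|by rewrite lms].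
    case: (eqVneq x b') => [->|xb] /=; first by rewrite ea eb.
    case: (eqVneq x a') => [->|xa] /=; first by rewrite ea.
    by rewrite n1 !inE -ea -eb !(inj_eq I1) (negPf xa) (negPf xb).
  + by case=> [[x|]|] //=; rewrite m1.
  + move=> j; case: (eqVneq j i) => [->|/negPf nj].
      by rewrite [LHS]ls /= eqxx map_cat /= -!map_comp -el1 -el2.
    by have := g1 j; rewrite /= nj -map_comp => <-.
(* D' and D'' differ by the inverse of [f1] after [f2]: both maps have as image all half-edges of D
   except s and its mate. *)
- have c x : f2 x \in codom f1 by rewrite c1 -c2 codom_f.
  pose h x := iinv (c x); have hE x : f1 (h x) = f2 x by rewrite f_iinv.
  exists h; split.
  + apply: inj_surj_bij => [x y e|y]; first by apply: I2; rewrite -!hE e.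
    have : f1 y \in codom f2 by rewrite c2 -c1 codom_f.
    by case/codomP => x e; exists x; rewrite -(inj_eq I1) hE e.
  + by move=> x; apply: I1; rewrite hE /= n1 n2 hE.
  + by move=> x; apply: I1; rewrite hE /= m1 m2 hE.
  + move=> j; apply: (inj_map I1); rewrite -map_comp (eq_map (g := f2)); last by move=> x; exact: hE.
    rewrite g2 /=; case: (eqVneq j i) => [_|/negPf nj]; last by rewrite g1 nj.
    by rewrite map_cat /= ea eb el1 el2.
Qed.

End Stu.

(** * Classes of diagrams in the quotient by the relations *)

Section Class.
Local Open Scope ring_scope.
Variables (K : fieldType) (d n : nat).
Implicit Types X Y : diagram n.

Lemma class_iso (D D' : jacobi d n) :
  iso (diagram_of D) (diagram_of D') -> jacobi_class K D = jacobi_class K D'.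
Proof.
move=> h; apply/mod_projP; apply: linear_span_mem; left.
by exists D, D'; split=> //; case: h => f []; exists f.
Qed.

(** The value 0 is reserved for invalid diagrams, so that sums of classes need no validity proofs
    inside their terms. *)
Definition cls X : jacobi_space K d n :=
  if insub (graph_of X) is Some D then jacobi_class K D else 0.

Lemma cls_jacobi X : valid d X ->
  exists2 D : jacobi d n, iso (diagram_of D) X & cls X = jacobi_class K D.
Proof.
move=> v; exists (Jacobi (graph_of_jacobi v)); first exact: graph_of_iso v.
by rewrite /cls (insubT _ (graph_of_jacobi v)).
Qed.

Lemma cls_iso X Y : valid d X -> iso X Y -> cls X = cls Y.
Proof.
move=> v h; have [D1 i1 ->] := cls_jacobi v.
have [D2 i2 ->] := cls_jacobi (iso_valid h v).
by apply/class_iso/(iso_trans i1)/(iso_trans h)/iso_sym.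
Qed.

Lemma cls_diagram_of (D : jacobi d n) : cls (diagram_of D) = jacobi_class K D.
Proof.
have /valid_diagram_of v := valP D; have [D' i ->] := cls_jacobi v.
exact: class_iso.
Qed.

Lemma cls_glue X a b i l1 l2 : valid d (set_lg X i (l1 ++ a :: b :: l2)) ->
  cls (glue X a b i l1 l2) =
  cls (set_lg X i (l1 ++ a :: b :: l2)) - cls (set_lg X i (l1 ++ b :: a :: l2)).
Proof.
move=> v; have v' : valid d (set_lg X i (l1 ++ b :: a :: l2)).
  apply: valid_set_lg v; rewrite perm_cat2l -(cat1s a) -(cat1s b).
  by rewrite -[X in perm_eq _ X](cat1s b) perm_catCA.
have [D iD ->] := cls_jacobi (valid_glue v).
have [D' iD' ->] := cls_jacobi v; have [D'' iD'' ->] := cls_jacobi v'.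
have := glue_stu v iD iD' iD'' => s.
rewrite /jacobi_class -raddfB; apply/mod_projP; apply: linear_span_mem; right.
by exists D, D', D''.
Qed.

End Class.

(** * The action on Jacobi diagrams *)

(* The arcs of X_n as concatenations of copies of arcs of X_m; the copies
   making up arc j are listed by [copies_on j], and [letter_of c] is the letter c stands for. *)
Record copies (m n : nat) := Copies {
  copy : finType;
  arc : copy -> 'I_n;
  copies_on : 'I_n -> seq copy;
  letter_of : copy -> letter m;
  copies_onP : forall j c, count_mem c (copies_on j) = (arc c == j) }.
Arguments Copies {m n} copy arc copies_on letter_of.

Section Copies.
Variables (m n : nat) (S : copies m n).

Lemma mem_copies_on j c : (c \in copies_on S j) = (arc c == j).
Proof. by rewrite -has_pred1 has_count copies_onP; case: (_ == _). Qed.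

Lemma copies_on_uniq j : uniq (copies_on S j).
Proof. by apply/count_mem_uniq => c; rewrite copies_onP mem_copies_on. Qed.

Lemma sum_copies_on (F : copy S -> nat) : \sum_j \sum_(c <- copies_on S j) F c = \sum_c F c.
Proof.
rewrite (partition_big (@arc _ _ S) predT) //=; apply: eq_bigr => j _.
by rewrite big_uniq ?copies_on_uniq //; apply: eq_bigl => c; rewrite mem_copies_on.
Qed.

Lemma copies_on_split c : exists s1 s2, [/\ copies_on S (arc c) = s1 ++ c :: s2,
  c \notin s1 & c \notin s2].
Proof.
have : c \in copies_on S (arc c) by rewrite mem_copies_on.
have := copies_on_uniq (arc c) => u /splitPr e; case: e u => s1 s2 u; exists s1, s2; split=> //.
  by move: u; rewrite -cat_rcons cat_uniq rcons_uniq => /andP[/andP[]].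
by move: u; rewrite cat_uniq /= => /and4P[].
Qed.

(** Isolates the block contributed by the copy c, for comparing two placements that differ on that
    copy alone. *)
Lemma flatten_copies_on (T : Type) (F R : copy S -> seq T) c s1 s2 :
  copies_on S (arc c) = s1 ++ c :: s2 -> c \notin s1 -> c \notin s2 ->
  (forall c', c' != c -> F c' = R c') ->
  forall j, flatten (map F (copies_on S j)) = if j == arc c
    then flatten (map R s1) ++ F c ++ flatten (map R s2) else flatten (map R (copies_on S j)).
Proof.
move=> e n1 n2 h j.
have E s : c \notin s -> map F s = map R s.
  by move=> ns; apply/eq_in_map => c' c's; apply: h; apply: contraNneq ns => <-.
case: (eqVneq j (arc c)) => [->|nj]; last by rewrite E // mem_copies_on eq_sym.
by rewrite e map_cat flatten_cat /= !E.
Qed.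

Definition oriented (T : Type) (c : copy S) (l : seq T) := if (letter_of c).2 then rev l else l.

Lemma oriented_map (T U : Type) (f : T -> U) c l : map f (oriented c l) = oriented c (map f l).
Proof. by rewrite /oriented; case: ifP; rewrite ?map_rev. Qed.

Lemma count_oriented (T : Type) (p : pred T) c l : count p (oriented c l) = count p l.
Proof. by rewrite /oriented; case: ifP; rewrite ?count_rev. Qed.

Lemma oriented_cat3 (T : Type) c (l1 l2 l3 : seq T) : oriented c (l1 ++ l2 ++ l3) =
  (if (letter_of c).2 then rev l3 else l1) ++ oriented c l2 ++ (if (letter_of c).2 then rev l1 else l3).
Proof. by rewrite /oriented; case: ifP; rewrite // !rev_cat catA. Qed.

Section Placed.
Variable X : diagram m.

Definition places (p : {ffun half X -> option (copy S)}) : bool :=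
  [forall x, if p x is Some c then x \in lg X (letter_of c).1 else ~~ leg x].

Definition copied_legs (p : {ffun half X -> option (copy S)}) (c : copy S) : seq (half X) :=
  oriented c [seq x <- lg X (letter_of c).1 | p x == Some c].

Definition place (p : {ffun half X -> option (copy S)}) : diagram n :=
  Diagram (half X) (nx (d := X)) (mt (d := X))
    (fun j => flatten (map (copied_legs p) (copies_on S j))).

Variable d : nat.
Hypothesis v : valid d X.

Lemma count_lg x i : count_mem x (lg X i) = (x \in lg X i).
Proof.
apply/count_uniq_mem/count_mem_uniq => y.
have := valid_lg v y; rewrite (bigD1 i) //= -has_pred1 has_count.
by case: (leg _) => /eqP; case: count => [|[|k]] //=; rewrite addSn.
Qed.

Lemma mem_lg x i : x \in lg X i -> leg x.
Proof.
move=> h; have := valid_lg v x; rewrite (bigD1 i) //= count_lg h.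
by case: (leg _).
Qed.

Lemma leg_arc x : leg x -> exists i, x \in lg X i.
Proof.
move=> lx; have := valid_lg v x; rewrite lx.
have [/existsP[i xi] _|] := boolP [exists i, x \in lg X i]; first by exists i.
rewrite negb_exists => /forallP h; rewrite big1 // => i _.
by rewrite count_lg (negPf (h i)).
Qed.

Lemma lg_arc_uniq x i j : x \in lg X i -> x \in lg X j -> i = j.
Proof.
move=> xi xj; apply/eqP; apply: contraT => nij.
have := valid_lg v x; rewrite (bigD1 i) // (bigD1 j) /=; last by rewrite eq_sym.
by rewrite !count_lg xi xj; case: (leg _); rewrite /= !addnA !add1n.
Qed.

Lemma placed_valid p : places p -> valid d (place p).
Proof.
move=> /forallP pp; rewrite /place; apply: (valid_perm _ v) => x; rewrite (valid_lg v).
under eq_bigr => j _ do rewrite count_flatten sumnE !big_map.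
rewrite (sum_copies_on (fun c => count_mem x (copied_legs p c))).
under eq_bigr => c _ do rewrite count_oriented count_filter.
have := pp x; case E: (p x) => [c|] h.
  rewrite (bigD1 c) //= big1 ?addn0 => [|c' nc']; last first.
    apply/eqP; rewrite -leqn0 leqNgt -has_count; apply/negP => /hasP[y _ /= /andP[/eqP ->]].
    by rewrite E => /eqP[e]; rewrite e eqxx in nc'.
  rewrite (eq_count (a2 := pred1 x)) ?count_lg ?h ?(mem_lg h) // => y /=.
  by case: eqP => // ->; rewrite E eqxx.
rewrite big1 ?(negPf h) // => c _.
apply/eqP; rewrite -leqn0 leqNgt -has_count; apply/negP => /hasP[y _ /= /andP[/eqP ->]].
by rewrite E.
Qed.

End Placed.
End Copies.

Lemma prod_option (R : comNzRingType) (T : finType) (F : option T -> R) :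
  (\prod_o F o = F None * \prod_x F (Some x))%R.
Proof.
rewrite (bigD1 None) //= (reindex_omap Some id) /=; last by case.
by congr (_ * _)%R; apply: eq_bigl => x; rewrite eqxx.
Qed.

(** * Pulling a diagram back along copies of arcs respects isomorphism and STU *)

Section Pull.
Local Open Scope ring_scope.
Variables (K : fieldType) (d m n : nat) (S : copies m n).
Implicit Types X Y : diagram m.

Definition weight (o : option (copy S)) : K := if o is Some c then (-1) ^+ (letter_of c).2 else 1.

Lemma weight_sqr o : weight o * weight o = 1.
Proof. by case: o => [c|] /=; rewrite ?mul1r // -expr2 sqrr_sign. Qed.

(** A product over half-edges rather than a power of -1, so that the factors of a and b can be split
    off. *)
Definition place_sign X (p : {ffun half X -> option (copy S)}) : K := \prod_x weight (p x).

Definition pull X : jacobi_space K d n :=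
  \sum_(p | places p) place_sign p *: cls K d (place (X := X) p).

Lemma pull_iso X Y : valid d X -> iso X Y -> pull X = pull Y.
Proof.
move=> v [f [bf f1 f2 f3]]; have [g fK gK] := bf; have fI := bij_inj bf.
pose h (p : {ffun half Y -> option (copy S)}) := [ffun x => p (f x)].
rewrite /pull (reindex h) /=; last first.
  exists (fun q : {ffun half X -> option (copy S)} => [ffun y => q (g y)]) => p _;
    by apply/ffunP => x; rewrite !ffunE ?gK ?fK.
have eP p : places (X := X) (h p) = places (X := Y) p.
  apply/forallP/forallP => H x.
    have := H (g x); rewrite ffunE gK; case: (p x) => [c|].
      by rewrite f3 -{2}[x]gK mem_map.
    by rewrite /leg -(inj_eq fI) f1 gK.
  have := H (f x); rewrite ffunE; case: (p (f x)) => [c|]; first by rewrite f3 mem_map.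
  by rewrite /leg -f1 (inj_eq fI).
apply: eq_big => // p; rewrite eP => Pp; congr (_ *: _).
  rewrite /place_sign (reindex g) /=; last by exists f => x _.
  by apply: eq_bigr => x _; rewrite ffunE gK.
apply: cls_iso; first by apply: placed_valid => //; rewrite eP.
exists f; split=> //= j; rewrite map_flatten -map_comp; congr flatten.
apply: eq_map => c /=; rewrite /copied_legs oriented_map f3 filter_map; congr oriented.
by congr map; apply: eq_filter => x /=; rewrite ffunE.
Qed.

Lemma diagram_eq (k : nat) (T : finType) (f g : T -> T) (l l' : 'I_k -> seq T) :
  (forall j, l j = l' j) -> Diagram T f g l = Diagram T f g l'.
Proof. by move=> /boolp.funext ->. Qed.

Section PullGlue.
Variables (X : diagram m) (a b : half X) (i : 'I_m) (l1 l2 : seq (half X)).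
Let Xab := set_lg X i (l1 ++ a :: b :: l2).
Let Xba := set_lg X i (l1 ++ b :: a :: l2).
Hypothesis v : valid d Xab.
Let G := glue X a b i l1 l2.
Let neq := pair_neq v.

Let vba : valid d Xba.
Proof.
apply: valid_set_lg v; rewrite perm_cat2l -(cat1s a) -(cat1s b).
by rewrite -[X in perm_eq _ X](cat1s b) perm_catCA.
Qed.

Let pl := {ffun half X -> option (copy S)}.

Lemma places_swap (p : pl) : places (X := Xab) p = places (X := Xba) p.
Proof.
apply: eq_forallb => x; case: (p x) => //= c; case: eqP => // _.
by rewrite !mem_cat !inE; congr (_ || _); exact: orbCA.
Qed.

Lemma place_neq (p : pl) : p a != p b ->
  cls K d (place (X := Xab) p) = cls K d (place (X := Xba) p).
Proof.
move=> npab; congr cls; apply: diagram_eq => j.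
congr flatten; apply: eq_map => c; rewrite /copied_legs /=; congr oriented.
case: ifP => // _; rewrite !filter_cat /=; congr cat.
case: (eqVneq (p a) (Some c)) => [ea|_]; case: (eqVneq (p b) (Some c)) => [eb|_] //.
by rewrite ea eb eqxx in npab.
Qed.

(** Placements of the glued diagram correspond to placements with a and b on one copy, namely that
    of the new leg [None]; [reglue] goes back. *)
Definition unglue (q : {ffun half G -> option (copy S)}) : pl :=
  [ffun x => if (x == a) || (x == b) then q None else q (some2 x)].

Definition reglue (p : pl) : {ffun half G -> option (copy S)} :=
  [ffun z => match z with
    | None => p a
    | Some None => None
    | Some (Some x) => if (x == a) || (x == b) then None else p x
    end].

Lemma unglueK (p : pl) : p a == p b -> unglue (reglue p) = p.
Proof.
move=> /eqP e; apply/ffunP => x; rewrite !ffunE.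
by rewrite /=; case: ifP => [/orP[] /eqP ->|xab]; rewrite ?xab.
Qed.

Let ab_lg j : (a \in lg Xab j) = (j == i).
Proof.
have ai : a \in lg Xab i by rewrite /= eqxx mem_cat !inE eqxx orbT.
apply/idP/eqP => [aj|->//]; exact: (lg_arc_uniq v aj ai).
Qed.

Let bb_lg j : (b \in lg Xab j) = (j == i).
Proof.
have bi : b \in lg Xab i by rewrite /= eqxx mem_cat !inE eqxx !orbT.
apply/idP/eqP => [bj|->//]; exact: (lg_arc_uniq v bj bi).
Qed.

Let some2_lg x j : x != a -> x != b -> (some2 x \in lg G j) = (x \in lg Xab j).
Proof.
move=> /negPf xa /negPf xb; rewrite /=; case: eqP => _.
  by rewrite !mem_cat !inE !(mem_map (@some2_inj _)) xa xb.
by rewrite (mem_map (@some2_inj _)).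
Qed.

Let none_lg j : (None \in lg G j) = (j == i).
Proof.
rewrite /=; case: eqP => _; first by rewrite mem_cat inE eqxx orbT.
by apply/negP => /mapP[].
Qed.

Let nones_lg j : (Some None \in lg G j) = false.
Proof.
apply/negP; rewrite /=; case: eqP => _; last by case/mapP.
by rewrite mem_cat inE => /orP[] /mapP[].
Qed.

Lemma places_unglue q : places (X := G) q =
  (places (X := Xab) (unglue q) && (unglue q a == unglue q b)) && (reglue (unglue q) == q).
Proof.
have la : leg (X := Xab) a by apply: (mem_lg v (i := i)); rewrite ab_lg.
have lb : leg (X := Xab) b by apply: (mem_lg v (i := i)); rewrite bb_lg.
apply/idP/idP => [/forallP H|/andP[/andP[/forallP H _] /eqP E]].
  rewrite andbAC; apply/andP; split; last by rewrite !ffunE !eqxx orbT.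
  apply/andP; split.
    apply/forallP => x; rewrite ffunE.
    case: (eqVneq x a) => [->|xa] /=.
      have := H None; case: (q None) => [c|]; last by rewrite /leg eqxx.
      by rewrite none_lg -[if _ then _ else _]/(lg Xab _) ab_lg.
    case: (eqVneq x b) => [->|xb] /=.
      have := H None; case: (q None) => [c|]; last by rewrite /leg eqxx.
      by rewrite none_lg -[if _ then _ else _]/(lg Xab _) bb_lg.
    have := H (some2 x); case: (q (some2 x)) => [c|].
      by rewrite some2_lg.
    by rewrite (leg_glue v) xa xb !andbT.
  apply/eqP/ffunP => -[[x|]|]; rewrite !ffunE.
  - have := H (some2 x); rewrite (leg_glue v).
    case: (eqVneq x a) => [->|xa] /=.
      case: (q _) => // c; move/(mem_lg (valid_glue v)).
      by rewrite (leg_glue v) eqxx andbF.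
    case: (eqVneq x b) => [->|xb] //=.
    case: (q _) => // c; move/(mem_lg (valid_glue v)).
    by rewrite (leg_glue v) eqxx !andbF.
  - by have := H (Some None); case: (q _) => // c; rewrite nones_lg.
  - by rewrite eqxx.
apply/forallP => -[[x|]|].
- have Ex : q (some2 x) = if (x == a) || (x == b) then None else unglue q x.
    by rewrite -{1}E ffunE.
  have := H x; rewrite -/(some2 x) Ex.
  case: (eqVneq x a) => [->|xa] /=; first by rewrite (leg_glue v) eqxx andbF.
  case: (eqVneq x b) => [->|xb] /=; first by rewrite (leg_glue v) eqxx !andbF.
  case: (unglue q x) => [c|]; first by rewrite some2_lg.
  by rewrite (leg_glue v) xa xb !andbT.
- by rewrite -E ffunE /leg /=.
- have := H a; rewrite ffunE eqxx /=; case: (q None) => [c|].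
    by rewrite none_lg -[if _ then _ else _]/(lg Xab _) ab_lg.
  by rewrite la.
Qed.

Let mid_neq x j : x \in (if j == i then l1 ++ l2 else lg X j) -> (x != a) && (x != b).
Proof.
case: (eqVneq j i) => [_|nj] xj.
  have := count_lg v x i; rewrite /= eqxx count_cat /= => h.
  have : (0 < count_mem x (l1 ++ l2))%N by rewrite -has_count has_pred1.
  rewrite count_cat !(eq_sym x); move: h; move: (count _ l1) (count _ l2) => c1 c2.
  by case: (_ \in _) => /=; case: (a == x); case: (b == x) => //=; lia.
have aj := ab_lg j; have bj := bb_lg j; rewrite /= (negPf nj) in aj bj.
by apply/andP; split; apply: contraTneq xj => ->; rewrite ?aj ?bj.
Qed.

Section Local.
Variables (q : {ffun half G -> option (copy S)}) (c : copy S) (s1 s2 : seq (copy S)).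
Hypotheses (Pq : places (X := G) q) (qc : q None = Some c).
Hypotheses (cs_c : copies_on S (arc c) = s1 ++ c :: s2) (n1 : c \notin s1) (n2 : c \notin s2).
Let p := unglue q.

Let ci : (letter_of c).1 = i.
Proof. by apply/eqP; have /forallP/(_ None) := Pq; rewrite qc none_lg. Qed.

Let pa : p a = Some c. Proof. by rewrite ffunE eqxx. Qed.
Let pb : p b = Some c. Proof. by rewrite ffunE eqxx orbT. Qed.

(** What each copy carries once a and b are removed. In Z below, a and b are to be reinserted
    between [L1] and [L2] on the arc of c. *)
Let rest (c' : copy S) : seq (half X) := oriented c'
  [seq x <- if (letter_of c').1 == i then l1 ++ l2 else lg X (letter_of c').1 | p x == Some c'].

Let f (l : seq (half X)) := [seq x <- l | p x == Some c].
Let before := if (letter_of c).2 then rev (f l2) else f l1.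
Let after := if (letter_of c).2 then rev (f l1) else f l2.
Let L1 := flatten (map rest s1) ++ before.
Let L2 := after ++ flatten (map rest s2).
Let Z := Diagram (half X) (nx (d := X)) (mt (d := X)) (fun j => flatten (map rest (copies_on S j))).

Let place_mid mid : (forall x, x \in mid -> p x = Some c) ->
  place (X := set_lg X i (l1 ++ mid ++ l2)) p = set_lg Z (arc c) (L1 ++ oriented c mid ++ L2).
Proof.
move=> hmid; apply: diagram_eq => j.
have h c' : c' != c -> copied_legs (X := set_lg X i (l1 ++ mid ++ l2)) p c' = rest c'.
  move=> nc; rewrite /copied_legs /rest /=; congr oriented; case: eqP => // _.
  rewrite !filter_cat (_ : [seq x <- mid | p x == Some c'] = [::]) //.
  rewrite -(filter_pred0 mid); apply: eq_in_filter => x /hmid ->.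
  by rewrite (inj_eq Some_inj) eq_sym (negPf nc).
rewrite (flatten_copies_on cs_c n1 n2 h) /=; case: eqP => // _.
rewrite {1}/copied_legs /= ci eqxx !filter_cat oriented_cat3 /L1 /L2 -!catA.
congr (_ ++ (_ ++ (oriented c _ ++ _))).
by apply/all_filterP/allP => x /hmid ->.
Qed.

Let place_glue : place (X := G) q = glue Z a b (arc c) L1 L2.
Proof.
apply: diagram_eq => j.
have hq j' c' : [seq z <- map (@some2 _) (if j' == i then l1 ++ l2 else lg X j') | q z == Some c']
    = map (@some2 _) [seq x <- if j' == i then l1 ++ l2 else lg X j' | p x == Some c'].
  rewrite filter_map; congr map; apply: eq_in_filter => x /mid_neq/andP[/negPf xa /negPf xb].
  by rewrite /= ffunE xa xb.
have h c' : c' != c -> copied_legs (X := G) q c' = map (@some2 _) (rest c').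
  move=> nc; rewrite /copied_legs /rest oriented_map -hq /=; congr oriented; case: eqP => // _.
  by rewrite map_cat !filter_cat /= qc (inj_eq Some_inj) eq_sym (negPf nc).
rewrite (flatten_copies_on cs_c n1 n2 h) /=; case: eqP => _; last by rewrite map_flatten -map_comp.
rewrite !map_cat !map_flatten -!map_comp -!catA; congr cat; rewrite -cat_cons catA; congr cat.
rewrite /copied_legs /= ci eqxx filter_cat /= qc eqxx -cat1s oriented_cat3.
have := hq i c; rewrite eqxx map_cat !filter_cat map_cat => hq'.
have sz : size [seq z <- map (@some2 _) l1 | q z == Some c] = size (map (@some2 _) (f l1)).
  rewrite filter_map !size_map; congr size; apply: eq_in_filter => x xl.
  have /andP[/negPf xa /negPf xb] : (x != a) && (x != b).
    by apply: (mid_neq (j := i)); rewrite eqxx mem_cat xl.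
  by rewrite /= ffunE xa xb.
move/eqP: hq'; rewrite eqseq_cat // => /andP[/eqP -> /eqP ->].
by rewrite /before /after /f; case: ifP; rewrite /oriented ?map_rev // => ->.
Qed.

(** The two legs a and b on the same copy c contribute the square of a sign, hence 1, while the
    single leg [None] contributes the sign of c. On a reversed copy this sign is -1, which matches
    the exchange of a and b there. *)
Lemma pull_glue_term : place_sign (X := G) q *: cls K d (place (X := G) q) =
  place_sign (X := Xab) p *:
    (cls K d (place (X := Xab) p) - cls K d (place (X := Xba) p)).
Proof.
have mid x : x \in [:: a; b] -> p x = Some c by rewrite !inE => /orP[] /eqP ->.
have mid' x : x \in [:: b; a] -> p x = Some c by rewrite !inE => /orP[] /eqP ->.
have := Pq; rewrite places_unglue -/p => /andP[/andP[Pp _] _].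
have vp := placed_valid v Pp; have vp' : valid d (place (X := Xba) p).
  by apply: (placed_valid vba); rewrite -(places_swap p).
rewrite (place_mid mid) in vp *; rewrite (place_mid mid') in vp' *; rewrite place_glue.
have -> : place_sign (X := Xab) p = \prod_(x | (x != a) && (x != b)) weight (q (some2 x)).
  rewrite /place_sign (bigD1 a) //= (bigD1 b) 1?eq_sym //= pa pb mulrA weight_sqr mul1r.
  by apply: eq_bigr => x /andP[/negPf xa /negPf xb]; rewrite ffunE xa xb.
have -> : place_sign (X := G) q =
    weight (Some c) * \prod_(x | (x != a) && (x != b)) weight (q (some2 x)).
  rewrite /place_sign prod_option qc; congr (_ * _); rewrite prod_option.
  have /forallP H := Pq; have := H (Some None).
  case: (q (Some None)) => [c'|_]; first by rewrite nones_lg.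
  rewrite mul1r [RHS]big_mkcond /=; apply: eq_bigr => x _.
  case: eqP => [->|_] /=.
    have := H (some2 a); case: (q _) => [c'|//] /(mem_lg (valid_glue v)).
    by rewrite (leg_glue v) eqxx andbF.
  case: eqP => [->|//] /=.
  have := H (some2 b); case: (q _) => [c'|//] /(mem_lg (valid_glue v)).
  by rewrite (leg_glue v) eqxx !andbF.
rewrite /oriented in vp vp' *; case: ifP vp vp' => e vp vp' /=.
  by rewrite cls_glue // e expr1 mulN1r scaleNr -scalerN opprB.
by rewrite cls_glue // e expr0 mul1r.
Qed.

End Local.

(** Placements with a and b on different copies give the same diagram for both orders of a and b and
    cancel. The others correspond to the placements of the glued diagram, term by term. *)
Lemma pull_glue : pull G = pull Xab - pull Xba.
Proof.
rewrite /pull [X in _ - X](eq_bigl (fun p : pl => places (X := Xab) p)); last first.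
  by move=> p; rewrite places_swap.
rewrite -sumrB (bigID (fun p : pl => p a == p b)) /= [X in _ = _ + X]big1 ?addr0; last first.
  by move=> p /andP[_ /place_neq ->]; rewrite subrr.
rewrite [RHS](reindex_onto unglue reglue) /=; last by move=> p /andP[_]; apply: unglueK.
apply: eq_big => q; first exact: places_unglue.
move=> Pq; have := Pq => /forallP/(_ None); case qc: (q None) => [c|]; last by rewrite /leg eqxx.
have [s1 [s2 [e n1 n2]]] := copies_on_split c => _.
by rewrite (pull_glue_term Pq qc e n1 n2) -scalerBr.
Qed.

End PullGlue.
End Pull.

Section FgLift.
Local Open Scope ring_scope.
Variables (R : nzRingType) (T : choiceType) (M : lmodType R) (f : T -> M).

Lemma fgliftB : {morph fglift f : u v / u - v}. Proof. exact: lift_is_additive. Qed.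

HB.instance Definition _ := GRing.isZmodMorphism.Build {freeg T / R} M (fglift f) fgliftB.

Lemma fgliftZ a u : fglift f (a *: u) = a *: fglift f u.
Proof.
rewrite -[u in RHS]freeg_sumE -[a *: u]/(fgscale a u) /fgscale.
rewrite [LHS]raddf_sum [X in _ = _ *: X]raddf_sum scaler_sumr.
by apply: eq_bigr => x _; rewrite /= !liftU scalerA.
Qed.

End FgLift.

(** * The map A_d(f) computed on arbitrary representatives *)

Section Map.
Local Open Scope ring_scope.
Variables (K : fieldType) (d m n : nat) (f : {multiplicative free_group n -> free_group m}).

Definition arc_copies j : seq (arc_copy f) :=
  [seq Tagged (fun j => 'I_(size (image_word f j))) q | q <- rev (enum 'I_(size (image_word f j)))].

Lemma arc_copiesP j c : count_mem c (arc_copies j) = (tag c == j).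
Proof.
case: c => i q /=; rewrite /arc_copies count_map count_rev.
case: (eqVneq i j) => [e|ne] /=; last first.
  apply/eqP; rewrite -leqn0 leqNgt -has_count; apply/hasPn => r _ /=.
  by apply: contraNneq ne => e; have := congr1 tag e => /= ->.
case: j / e; rewrite (eq_count (a2 := pred1 q)) => [|r].
  by rewrite count_uniq_mem ?enum_uniq // mem_enum.
by rewrite /= eq_Tagged.
Qed.

Definition hom_copies : copies m n :=
  Copies (arc_copy f : finType) (@tag _ _) arc_copies (@copy_letter m n f) arc_copiesP.

Lemma lt_arc_copies j : map (@letter_of _ _ hom_copies) (arc_copies j) = rev (image_word f j).
Proof.
rewrite -map_comp map_rev; congr rev.
rewrite (eq_map (g := tnth (in_tuple (image_word f j)))) ?map_tnth_enum //.
Qed.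

Lemma jacobi_pullbackE (D : jacobi d m) :
  jacobi_pullback K f D = pull K d hom_copies (diagram_of D).
Proof.
rewrite /jacobi_pullback /pull.
rewrite [RHS](eq_bigl (fun p => p \in is_placement (D := D) (f := f))) //.
rewrite [RHS]big_sub; apply: eq_bigr => p _; congr (_ *: _).
  rewrite /place_sign /reversed_count -prodr_const big_mkcond /=.
  apply: eq_bigr => x _; rewrite inE; case: (val p x) => [c|] //=.
  by rewrite /reversed_copy; case: (copy_letter c).2.
rewrite -cls_diagram_of; congr cls.
rewrite /place /diagram_of /=; congr Diagram; apply: boolp.funext => j.
by rewrite ffunE /placed_legs /arc_copies -map_comp.
Qed.

(** This makes A_d(f) well defined: [pull_iso] handles the isomorphism relations and [pull_glue] the
    STU relations. The choice made by [repr] in [jacobi_map] then becomes irrelevant. *)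
Lemma fglift_relation v : linear_span (@jacobi_relation K d m) v ->
  fglift (jacobi_pullback K f) v = 0.
Proof.
move=> [s hs ->]; rewrite raddf_sum big_seq big1 // => p /hs H; rewrite /= fgliftZ.
suff -> : fglift (jacobi_pullback K f) p.2 = 0 by rewrite scaler0.
have vD (D0 : jacobi d m) : valid d (diagram_of D0) by apply/valid_diagram_of/(valP D0).
case: H => [[D [D' [iD ->]]]|[D [D' [D'' [/stu_glue H ->]]]]].
  rewrite fgliftB !liftU !scale1r !jacobi_pullbackE.
  by rewrite (@pull_iso K d _ _ _ _ (diagram_of D')) ?subrr.
rewrite !fgliftB !liftU !scale1r !jacobi_pullbackE.
have [X [a [b [i [l1 [l2 [v0 i1 i2 i3]]]]]]] := H.
by rewrite (pull_iso _ _ (vD D) i1) (pull_iso _ _ (vD D') i2) (pull_iso _ _ (vD D'') i3)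
  pull_glue // subrr.
Qed.

Lemma jacobi_map_proj v :
  jacobi_map f (mod_proj (@jacobi_relation K d m) v) = fglift (jacobi_pullback K f) v.
Proof.
apply/eqP; rewrite -subr_eq0 /jacobi_map -fgliftB; apply/eqP/fglift_relation.
by apply/mod_projP; rewrite mod_projK.
Qed.

Lemma jacobi_map_cls X : valid d X ->
  jacobi_map f (cls K d X) = pull K d hom_copies X.
Proof.
move=> v; have [D i ->] := cls_jacobi K v.
rewrite jacobi_map_proj liftU scale1r jacobi_pullbackE; apply: pull_iso i.
exact/valid_diagram_of/valP.
Qed.

Lemma jacobi_map_linear a (u v : jacobi_space K d m) :
  jacobi_map f (a *: u + v) = a *: jacobi_map f u + jacobi_map f v.
Proof.
rewrite -[u]mod_projK -[v]mod_projK -linearZ -raddfD !jacobi_map_proj.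
by rewrite raddfD /= fgliftZ.
Qed.

End Map.

(** * The graded pieces of the filtration *)

Lemma perm_eq_swap_ind (T : eqType) (R : seq T -> seq T -> Prop) :
  (forall l, R l l) -> (forall l1 l2 l3, R l1 l2 -> R l2 l3 -> R l1 l3) ->
  (forall l1 a b l2, R (l1 ++ a :: b :: l2) (l1 ++ b :: a :: l2)) ->
  forall l l', perm_eq l l' -> R l l'.
Proof.
move=> Rr Rt Rs l l'.
(* R is not assumed compatible with concatenation, so the prefix already treated is carried along;
   adjacent swaps are allowed at any position. *)
suff H : forall pre, perm_eq l l' -> R (pre ++ l) (pre ++ l') by exact: (H [::]).
elim: l l' => [|x l IH] l' pre pll'.
  by move: pll'; rewrite perm_sym => /perm_nilP ->.
have xl' : x \in l' by rewrite -(perm_mem pll') mem_head.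
case/splitPr: xl' pll' => l1 l2 pll'.
have pl : perm_eq l (l1 ++ l2) by rewrite -(perm_cons x) (perm_trans pll') // perm_catC /= perm_cons perm_catC.
apply: (Rt _ (pre ++ x :: l1 ++ l2)).
  by rewrite -!(cat_rcons x pre); apply: IH.
elim: l1 pre {pll' pl} => [|y l1 IH1] pre //=.
apply: (Rt _ _ _ (Rs _ _ _ _)); rewrite -!(cat_rcons y); exact: IH1.
Qed.

Section Filtration.
Local Open Scope ring_scope.
Variables (K : fieldType) (d n : nat).
Implicit Types X : diagram n.
Local Notation Fil := (@jacobi_filtration K d n).
Local Notation cls := (cls K d).

Lemma filtrationD k u v : Fil k u -> Fil k v -> Fil k (u + v).
Proof. exact: linear_spanD. Qed.
Lemma filtrationZ k a u : Fil k u -> Fil k (a *: u).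
Proof. exact: linear_spanZ. Qed.
Lemma filtration0 k : Fil k 0. Proof. exact: linear_span0. Qed.
Lemma filtrationN k u : Fil k u -> Fil k (- u).
Proof. by rewrite -scaleN1r; apply: filtrationZ. Qed.
Lemma filtrationB k u v : Fil k u -> Fil k v -> Fil k (u - v).
Proof. by move=> hu hv; apply/filtrationD/filtrationN. Qed.
Lemma filtration_sum k (I : Type) (r : seq I) (P : pred I) (F : I -> jacobi_space K d n) :
  (forall i, P i -> Fil k (F i)) -> Fil k (\sum_(i <- r | P i) F i).
Proof. by move=> h; apply: big_ind => //; [exact: filtration0|exact: filtrationD]. Qed.

Lemma filtration_cls k X : valid d X -> (k + #|leg (X := X)| <= d.*2)%N -> Fil k (cls X).
Proof.
move=> v h; have [D iD ->] := cls_jacobi K v.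
apply: linear_span_mem; exists D => //=.
by move: h; rewrite -(iso_leg iD) -(trivalent_count_leg D) leq_add2r.
Qed.

Lemma filtration_ind k (P : jacobi_space K d n -> Prop) : P 0 ->
  (forall a u v, P u -> P v -> P (a *: u + v)) ->
  (forall X, valid d X -> (k + #|leg (X := X)| <= d.*2)%N -> P (cls X)) ->
  forall u, Fil k u -> P u.
Proof.
move=> P0 PD Pc u [s hs ->]; elim: s hs => [|[a w] s IH] hs; first by rewrite big_nil.
rewrite big_cons; apply: PD => /=; last by apply: IH => p ps; apply: hs; rewrite inE ps orbT.
have /= [D hD <-] := hs _ (mem_head _ _); rewrite -cls_diagram_of; apply: Pc.
  exact/valid_diagram_of/valP.
by rewrite -(trivalent_count_leg D) leq_add2r.
Qed.

Lemma filtration_mono k u : Fil k.+1 u -> Fil k u.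
Proof.
apply: filtration_ind u => [|a u w|X v h]; [exact: filtration0|by move=> hu hw; apply/filtrationD/hw/filtrationZ|].
by apply: filtration_cls => //; apply: leq_trans h; rewrite leq_add2r.
Qed.

Lemma filtration_top u : Fil 0 u.
Proof.
rewrite -[u]mod_projK -[repr u]freeg_sumE raddf_sum; apply: filtration_sum => D _.
have -> : << coeff D (repr u) *g D >> = coeff D (repr u) *: << D >>.
  by apply/eqP/freeg_eqP => E; rewrite coeffZ !coeffU mul1r.
rewrite /= linearZ; apply: filtrationZ; apply: linear_span_mem; exists D => //.
Qed.

Lemma filtration_bot k u : (d.*2 < k)%N -> Fil k u -> u = 0.
Proof.
move=> dk; apply: (filtration_ind (P := fun u => u = 0)) => // [a u' w -> ->|X v]; first by rewrite scaler0 addr0.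
by rewrite leqNgt (leq_trans dk) // leq_addr.
Qed.

Lemma filtration_swap k X a b i l1 l2 : (k + #|leg (X := X)| = d.*2)%N ->
  valid d (set_lg X i (l1 ++ a :: b :: l2)) ->
  Fil k.+1 (cls (set_lg X i (l1 ++ a :: b :: l2)) - cls (set_lg X i (l1 ++ b :: a :: l2))).
Proof.
move=> hk v; rewrite -cls_glue //; apply: filtration_cls; first exact: valid_glue v.
by rewrite addSnnS (card_leg_glue v) hk.
Qed.

Lemma filtration_perm_arc k X i l l' : (k + #|leg (X := X)| = d.*2)%N -> perm_eq l l' ->
  valid d (set_lg X i l) -> Fil k.+1 (cls (set_lg X i l) - cls (set_lg X i l')).
Proof.
move=> hk pll'.
pose R l l' := perm_eq l l' /\ (valid d (set_lg X i l) ->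
  Fil k.+1 (cls (set_lg X i l) - cls (set_lg X i l'))).
suff: R l l' by case.
apply: (perm_eq_swap_ind _ _ _ pll') => {l l' pll'} [l|l1 l2 l3 [p1 h1] [p2 h2]|l1 a b l2].
- by split=> // _; rewrite subrr; exact: filtration0.
- split=> [|v]; first exact: perm_trans p1 p2.
  rewrite -(subrKA (cls (set_lg X i l2))); apply: filtrationD; first exact: h1.
  by apply: h2; apply: valid_set_lg p1 v.
- split=> [|v]; last exact: filtration_swap.
  rewrite perm_cat2l -(cat1s a) -(cat1s b).
  by rewrite -[X in perm_eq _ X](cat1s b) perm_catCA.
Qed.

Lemma filtration_perm k X (l : 'I_n -> seq (half X)) : (k + #|leg (X := X)| = d.*2)%N ->
  valid d X -> (forall j, perm_eq (lg X j) (l j)) ->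
  Fil k.+1 (cls X - cls (Diagram (half X) (nx (d := X)) (mt (d := X)) l)).
Proof.
case: X l => T f g l0 l hk v hl; pose X := Diagram T f g l0.
(* The arcs are reordered one at a time: [Y r] has the new order on the arcs of index below r. *)
pose Y r := Diagram (half X) (nx (d := X)) (mt (d := X))
  (fun j => if (j < r)%N then l j else lg X j).
have vY r : valid d (Y r).
  apply: (valid_perm _ v) => x; apply: eq_bigr => j _; case: ifP => // _.
  by apply/esym/seq.permP.
suff H r : (r <= n)%N -> Fil k.+1 (cls (Y 0) - cls (Y r)).
  have := H n (leqnn n); congr (Fil _ (_ - _)); congr cls.
  by apply: diagram_eq => j /=; rewrite ltn_ord.
elim: r => [|r IH] rn; first by rewrite subrr; exact: filtration0.
rewrite -(subrKA (cls (Y r))); apply: filtrationD; first by apply: IH; apply: ltnW.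
pose i := Ordinal rn.
have e1 : Y r = set_lg (Y r) i (lg X i).
  by apply: diagram_eq => j /=; case: (eqVneq j i) => [->|//]; rewrite /= ltnn.
have e2 : Y r.+1 = set_lg (Y r) i (l i).
  apply: diagram_eq => j /=; rewrite ltnS leq_eqVlt -val_eqE /=.
  by case: eqP => [jr|//]; congr l; apply: val_inj.
have := @filtration_perm_arc k (Y r) i _ _ hk (hl i).
by rewrite -[lg _ i]/(lg X i) -e1 -e2; apply.
Qed.

End Filtration.

Lemma lg_uniq (d n : nat) (X : diagram n) i : valid d X -> uniq (lg X i).
Proof. by move=> v; apply/count_mem_uniq => x; rewrite (count_lg v). Qed.

(** * Redistributing the legs of a graph over the arcs *)

Section Recolor.
Variables (d m n : nat).

Definition legs_of (X : diagram m) : finType := {x : half X | leg x}.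

(** Only the graph of X is kept. The legs on an arc follow the enumeration of [legs_of X], an
    arbitrary order whose choice is invisible one step further down the filtration. *)
Definition recolor (X : diagram m) (c : {ffun legs_of X -> 'I_n}) : diagram n :=
  Diagram (half X) (nx (d := X)) (mt (d := X))
    (fun j => [seq val l | l <- enum {: legs_of X} & c l == j]).

Lemma mem_recolor X c j (x : half X) :
  (x \in lg (@recolor X c) j) = (if insub x is Some l then c l == j else false).
Proof.
apply/mapP/idP => [[l]|].
  by rewrite mem_filter => /andP[cl _] ->; rewrite valK.
case: insubP => // l lx <- cl; exists l => //.
by rewrite mem_filter cl mem_enum.
Qed.

Lemma recolor_uniq X c j : uniq (lg (@recolor X c) j).
Proof.
rewrite map_inj_uniq => [|x y /val_inj //]; apply: filter_uniq; exact: enum_uniq.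
Qed.

Lemma recolor_valid X c : valid d X -> valid d (@recolor X c).
Proof.
move=> v; apply: (valid_perm _ v) => x; rewrite (valid_lg v).
under eq_bigr => j _.
  rewrite (count_uniq_mem _ (recolor_uniq c j)) mem_recolor; over.
case: insubP => [l lx _|/negPf lx]; last by rewrite big1 // [leg x]lx.
rewrite -/(leg x) lx (bigD1 (c l)) //= eqxx big1 // => j.
by rewrite eq_sym => /negPf ->.
Qed.

End Recolor.

Lemma legs_of_card (m : nat) (X : diagram m) : #|{: legs_of X}| = #|leg (X := X)|.
Proof. by rewrite card_sig; apply: eq_card. Qed.

Section Graded.
Local Open Scope ring_scope.
Variables (K : fieldType) (d m n : nat).
Local Notation Fil := (@jacobi_filtration K d n).
Local Notation cls := (cls K d).

Lemma filtration_perm_mem k (X : diagram n) l : (k + #|leg (X := X)| = d.*2)%N ->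
  valid d X -> (forall j, uniq (l j)) -> (forall j, lg X j =i l j) ->
  Fil k.+1 (cls X - cls (Diagram (half X) (nx (d := X)) (mt (d := X)) l)).
Proof.
move=> hk v lu hl; apply: filtration_perm => // j.
by apply: uniq_perm => //; exact: lg_uniq v.
Qed.

Lemma filtration_recolor k (X : diagram n) : (k + #|leg (X := X)| = d.*2)%N -> valid d X ->
  exists c, Fil k.+1 (cls X - cls (@recolor n n X c)).
Proof.
move=> hk v.
have /fin_all_exists[c hc] : forall l : legs_of X, exists i, val l \in lg X i.
  by move=> l; apply: (leg_arc v); exact: (valP l).
exists [ffun l => c l]; apply: filtration_perm_mem => // [j|j x]; first exact: recolor_uniq.
rewrite mem_recolor; case: insubP => [l lx <-|lx].
  rewrite ffunE; apply/idP/eqP => [h|<-//]; exact: (lg_arc_uniq v (hc l) h).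
by apply: contraNF lx => /(mem_lg v).
Qed.

Variable S : copies m n.

(** For the copies coming from a homomorphism f, the entry at (j, i) is the exponent sum of x_i in
    f(x_j). *)
Definition linearization : 'M[K]_(n, m) :=
  \matrix_(j, i) \sum_(c | (arc c == j) && ((letter_of c).1 == i)) weight K (Some c : option (copy S)).

Lemma linearizationE j i :
  linearization j i = \sum_(a <- map (@letter_of _ _ S) (copies_on S j) | a.1 == i) (-1) ^+ a.2.
Proof.
rewrite mxE big_map -big_filter (big_uniq _ (filter_uniq _ (copies_on_uniq S j))).
by apply: eq_bigl => c; rewrite mem_filter mem_copies_on andbC.
Qed.

Section Extend.
Variable X : diagram m.
Let T := {ffun legs_of X -> copy S}.

Definition extend (q : T) : {ffun half X -> option (copy S)} :=
  [ffun x => omap q (insub x)].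

Lemma extend_val q (l : legs_of X) : extend q (val l) = Some (q l).
Proof. by rewrite ffunE valK. Qed.

Lemma extend_inj : injective extend.
Proof.
move=> q r e; apply/ffunP => l; apply: Some_inj.
by rewrite -!extend_val e.
Qed.

Lemma places_extend (c : {ffun legs_of X -> 'I_m}) q :
  places (X := recolor c) (extend q) = [forall l, (letter_of (q l)).1 == c l].
Proof.
apply/forallP/forallP => h x.
  by have := h (val x); rewrite extend_val mem_recolor valK eq_sym.
rewrite ffunE; case E: (insub x) => [l|] /=; first by rewrite mem_recolor E eq_sym.
by move: E; case: insubP => // lx.
Qed.

Lemma sum_places (V : zmodType) (c : {ffun legs_of X -> 'I_m}) F :
  \sum_(p | places (X := recolor c) p) F p =
  \sum_(q : T | [forall l, (letter_of (q l)).1 == c l]) F (extend q) :> V.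
Proof.
pose h' p := [pick q | extend q == p].
rewrite (reindex_omap extend h') /= => [|p /forallP hp].
  apply: eq_bigl => q; rewrite places_extend; case: forallP => //= _.
  rewrite /h'; case: pickP => [r /eqP /extend_inj -> |/(_ q)]; by rewrite eqxx.
rewrite /h'; case: pickP => [q /eqP <- //|h].
have /fin_all_exists[q hq] : forall l : legs_of X, exists a, p (val l) = Some a.
  move=> l; have := hp (val l); case: (p (val l)) => [a _|]; first by exists a.
  by rewrite [leg _](valP l).
have /eqP := h [ffun l => q l]; case; apply/ffunP => x; rewrite ffunE.
case: insubP => [l lx <-|lx] /=; first by rewrite ffunE hq.
by have := hp x; case: (p x) => // a; rewrite mem_recolor insubF //; apply: negPf.
Qed.

(** A placement is a choice of copy for each leg. Modulo the next step only the arcs of the chosen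
    copies matter, and summing the signs with these arcs fixed gives a product of entries of
    [linearization], one for each leg. *)
Lemma pull_recolor k (c : {ffun legs_of X -> 'I_m}) :
  (k + #|leg (X := X)| = d.*2)%N -> valid d X ->
  Fil k.+1 (pull K d S (recolor c) -
    \sum_(b : {ffun legs_of X -> 'I_n}) (\prod_l linearization (b l) (c l)) *: cls (recolor b)).
Proof.
move=> hk v; rewrite /pull sum_places.
pose arcs (q : T) := [ffun l => arc (q l)].
pose w (q : T) := \prod_l weight K (Some (q l)).
(* Expanding the product of sums over copies turns the right-hand side into a sum over placements,
   grouped by the arcs reached. *)
have -> : \sum_(b : {ffun legs_of X -> 'I_n}) (\prod_l linearization (b l) (c l)) *: cls (recolor b)
  = \sum_(q : T | [forall l, (letter_of (q l)).1 == c l]) w q *: cls (recolor (arcs q)).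
  rewrite [RHS](partition_big arcs predT) //=; apply: eq_bigr => b _.
  under eq_bigr => l _ do rewrite mxE.
  rewrite bigA_distr_big_dep scaler_suml; apply: eq_big => [q|q]; last first.
    move=> /familyP hq; congr (_ *: cls (recolor _)); apply/ffunP => l; rewrite ffunE.
    by have /andP[/eqP ->] := hq l.
  apply/familyP/andP => [hq|[/forallP h1 /eqP <-] l]; last first.
    by rewrite /= unfold_in h1 ffunE eqxx.
  split; first by apply/forallP => l; have /andP[] := hq l.
  by apply/eqP/ffunP => l; rewrite ffunE; have /andP[/eqP ->] := hq l.
rewrite -sumrB; apply: filtration_sum => q hq.
have -> : place_sign K (X := recolor c) (extend q) = w q.
  rewrite /place_sign (bigID (leg (X := X))) /= [X in _ * X]big1 ?mulr1; last first.
    by move=> x nx; rewrite ffunE insubF //; apply: negPf.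
  rewrite -[in LHS]/(\prod_(x in leg (X := X)) _) big_sub; apply: eq_bigr => l _.
  by rewrite extend_val.
rewrite -scalerBr; apply: filtrationZ; apply: (filtration_perm_mem (X := place (X := recolor c) (extend q))) => //.
- by apply: placed_valid; [exact: recolor_valid|rewrite places_extend].
- by move=> j; apply: recolor_uniq.
move=> j x. apply: etrans (esym (mem_recolor (arcs q) j x)).
apply/flattenP/idP.
  move=> [_ /mapP[a aj ->]]; rewrite /copied_legs /oriented => H.
  have : x \in [seq x <- lg (recolor c) (letter_of a).1 | extend q x == Some a].
    by move: H; case: ifP; rewrite ?mem_rev.
  rewrite mem_filter ffunE => /andP[/eqP + _]; case: (insub x) => [l|] //= [qa].
  by rewrite ffunE qa -mem_copies_on.
case E: (insub x) => [l|] //; rewrite ffunE => /eqP e.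
exists (copied_legs (X := recolor c) (extend q) (q l)).
  by apply/mapP; exists (q l) => //; rewrite mem_copies_on e.
suff : x \in [seq x <- lg (recolor c) (letter_of (q l)).1 | extend q x == Some (q l)].
  by rewrite /copied_legs /oriented; case: ifP; rewrite ?mem_rev.
rewrite mem_filter ffunE E eqxx mem_recolor E /= eq_sym.
by have /forallP := hq.
Qed.

End Extend.
End Graded.

Section PullCopies.
Local Open Scope ring_scope.
Variables (K : fieldType) (d m n : nat) (S S' : copies m n).

Lemma pull_bij (f : copy S -> copy S') (X : diagram m) : valid d X -> bijective f ->
  (forall c, letter_of (f c) = letter_of c) -> (forall j, copies_on S' j = map f (copies_on S j)) ->
  pull K d S X = pull K d S' X.
Proof.
move=> v bf ltf csf; have [g fK gK] := bf; have fI := bij_inj bf.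
pose h (p : {ffun half X -> option (copy S)}) : {ffun half X -> option (copy S')} :=
  [ffun x => omap f (p x)].
rewrite /pull [RHS](reindex h) /=; last first.
  exists (fun q : {ffun half X -> option (copy S')} => [ffun x => omap g (q x)]) => p _;
    apply/ffunP => x; rewrite !ffunE; case: (p x) => //= c; by rewrite ?fK ?gK.
have eP p : places (h p) = places p.
  by apply: eq_forallb => x; rewrite ffunE; case: (p x) => [c|] //=; rewrite ltf.
apply: eq_big => [p|p Pp]; first by rewrite eP.
congr (_ *: cls K d _).
  by apply: eq_bigr => x _; rewrite ffunE; case: (p x) => [c|] //=; rewrite ltf.
apply: diagram_eq => j; rewrite csf -map_comp; congr flatten; apply: eq_map => c /=.
rewrite /copied_legs /oriented ltf; case: ifP => _; [congr rev|]; apply: eq_filter => x;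
  rewrite ffunE; case: (p x) => [c'|] //=; by rewrite !(inj_eq Some_inj) (inj_eq fI).
Qed.

(** Only the lists of letters along the arcs matter. This allows the copies of an automorphism,
    indexed by positions in words, to be replaced by an explicit model such as [conj_copies]. *)
Lemma pull_eq_letters (X : diagram m) : valid d X ->
  (forall j, map (@letter_of _ _ S) (copies_on S j) = map (@letter_of _ _ S') (copies_on S' j)) ->
  pull K d S X = pull K d S' X.
Proof.
move=> v e.
have sz j : size (copies_on S j) = size (copies_on S' j) by rewrite -(size_map (@letter_of _ _ S)) e size_map.
(* f matches each copy with the one at the same position on the same arc. *)
have /boolp.choice[f hf] : forall c : copy S, exists c' : copy S',
    (arc c' = arc c) /\ index c' (copies_on S' (arc c)) = index c (copies_on S (arc c)).
  move=> c; have cin : c \in copies_on S (arc c) by rewrite mem_copies_on.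
  have := cin; rewrite -index_mem sz; case E: (copies_on S' (arc c)) => [//|c0 s].
  rewrite -{1}E => hi; exists (nth c0 (copies_on S' (arc c)) (index c (copies_on S (arc c)))).
  split; last by rewrite -E index_uniq ?copies_on_uniq.
  by apply/eqP; rewrite -mem_copies_on mem_nth.
have csf j : copies_on S' j = map f (copies_on S j).
  have [E|[c0 c0j]] : copies_on S j = [::] \/ exists c, c \in copies_on S j.
  - by case: (copies_on S j) => [|c s]; [left|right; exists c; rewrite mem_head].
  - by rewrite E; apply/size0nil; rewrite -sz E.
  apply: (@eq_from_nth _ (f c0)) => [|i hi]; first by rewrite size_map sz.
  have hi' : (i < size (copies_on S j))%N by rewrite sz.
  rewrite (nth_map c0) //; set c := nth c0 _ _.
  have cj : c \in copies_on S j by apply: mem_nth.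
  have [a1 a2] := hf c; have ac : arc c = j by apply/eqP; rewrite -mem_copies_on.
  rewrite ac in a1 a2; rewrite -[RHS](nth_index (f c0) (s := copies_on S' j)); last by rewrite mem_copies_on a1.
  by rewrite a2 index_uniq // copies_on_uniq.
have fI : injective f.
  move=> c c' ec; have [a1 a2] := hf c; have [b1 b2] := hf c'.
  have eac : arc c = arc c' by rewrite -a1 -b1 ec.
  rewrite -[LHS](nth_index c (s := copies_on S (arc c))) ?mem_copies_on //.
  by rewrite -a2 ec eac b2 nth_index ?mem_copies_on.
apply: (pull_bij (f := f)) => //.
  apply: inj_surj_bij fI _ => c'; have : c' \in copies_on S' (arc c') by rewrite mem_copies_on.
  by rewrite csf => /mapP[c _ ->]; exists c.
move=> c; have cin : c \in copies_on S (arc c) by rewrite mem_copies_on.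
have := e (arc c); rewrite csf -map_comp => /eq_in_map /(_ c cin) /= ->.
by [].
Qed.

End PullCopies.

(** * The effect of x_i |-> x_q x_i x_q^-1 *)

Section Conjugation.
Local Open Scope ring_scope.
Variables (K : fieldType) (d n : nat) (i q : 'I_n).
Hypothesis niq : i != q.

(* The copies for x_i |-> x_q x_i x_q^-1: [inl j] is arc j itself, [inr true]
   and [inr false] are the copies for x_q^-1 and x_q. *)
Definition conj_cs (j : 'I_n) : seq ('I_n + bool) :=
  if j == i then [:: inr true; inl i; inr false] else [:: inl j].

Definition conj_arc (c : 'I_n + bool) : 'I_n := if c is inl j then j else i.

Definition conj_letter (c : 'I_n + bool) : letter n :=
  match c with inl j => (j, false) | inr e => (q, e) end.

Lemma conj_csP j c : count_mem c (conj_cs j) = (conj_arc c == j).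
Proof.
rewrite /conj_cs; case: (eqVneq j i) => [->|ji]; case: c => [k|e] /=.
- by rewrite add0n !addn0; congr nat_of_bool; rewrite eq_sym.
- by rewrite [RHS](_ : _ = 1%N) ?eqxx //; case: e.
- by rewrite addn0; congr nat_of_bool; rewrite eq_sym.
- by rewrite eq_sym (negPf ji).
Qed.

Definition conj_copies : copies n n := Copies ('I_n + bool)%type conj_arc conj_cs conj_letter conj_csP.

Variables (X : diagram n) (a b : half X).
Let Xab := set_lg X i [:: a; b].
Let Xba := set_lg X i [:: b; a].
Let E := set_lg (set_lg X q [:: b]) i [:: a].
Hypotheses (v : valid d Xab) (Xq : lg X q = [::]).

Lemma valid_split : valid d E.
Proof.
apply: (valid_perm (X := Xab)) v => x; rewrite (bigD1 i) // (bigD1 q) 1?eq_sym //=.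
rewrite [in RHS](bigD1 i) // [in RHS](bigD1 q) 1?eq_sym //= eqxx [q == i]eq_sym (negPf niq) eqxx Xq /=.
rewrite !addn0 addnA; congr (_ + _)%N; apply: eq_bigr => j /andP[/negPf -> /negPf ->].
by [].
Qed.

Let neq : a != b := pair_neq (l1 := [::]) (l2 := [::]) v.
Let vE := valid_split.

Let b_lg j : (b \in lg E j) = (j == q).
Proof.
have bq : b \in lg E q by rewrite /= [q == i]eq_sym (negPf niq) eqxx mem_head.
apply/idP/eqP => [bj|->//]; exact: (lg_arc_uniq vE bj bq).
Qed.

Let lgq : lg E q = [:: b].
Proof. by rewrite /= [q == i]eq_sym (negPf niq) eqxx. Qed.

(** The only freedom is the copy o that receives b: just arc q has several copies, and b is the only
    leg on it. Every other leg stays on its own arc. *)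
Let placement_at (o : option ('I_n + bool)) : {ffun half X -> option (copy conj_copies)} :=
  [ffun x => if x == b then o else omap inl [pick j | x \in lg E j]].

Let others x : x != b -> forall j, x \in lg E j -> [pick j | x \in lg E j] = Some j.
Proof.
move=> xb j xj; case: pickP => [k xk|/(_ j)]; last by rewrite xj.
by rewrite (lg_arc_uniq vE xk xj).
Qed.

Let copies_of_b : seq (option (copy conj_copies)) :=
  [:: Some (inl q); Some (inr false); Some (inr true)].

Let places_at (p : {ffun half X -> option (copy conj_copies)}) : places (X := E) p -> p = placement_at (p b) /\ p b \in copies_of_b.
Proof.
move=> /forallP H; split; last first.
  have := H b; case: (p b) => [c|]; last by rewrite (mem_lg vE (i := q)) // b_lg.
  by rewrite b_lg; case: c => [k|[]] //= /eqP ->; rewrite !inE eqxx.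
apply/ffunP => x; rewrite ffunE; case: eqVneq => [->//|xb].
have := H x; case: (p x) => [[k|e]|].
- by move=> /(others xb) ->.
- by rewrite lgq inE (negPf xb).
- case: pickP => [j xj|//]; by rewrite (mem_lg vE xj).
Qed.

Let at_places o : o \in copies_of_b -> places (X := E) (placement_at o).
Proof.
move=> ho; apply/forallP => x; rewrite ffunE; case: eqVneq => [->|xb].
  by move: ho; rewrite !inE => /orP[/eqP ->|/orP[] /eqP ->]; rewrite b_lg.
case: pickP => [j xj //|H]; apply/negP => /(leg_arc vE)[j].
by rewrite H.
Qed.

Let pull_sum : pull K d conj_copies E =
  \sum_(o <- copies_of_b) weight K o *: cls K d (place (X := E) (placement_at o)).
Proof.
rewrite /pull (reindex_onto placement_at (fun p => p b)); last first.
  by move=> p /places_at[].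
rewrite big_uniq //=; apply: eq_big => [o|o /andP[/places_at[_ ho] _]].
  apply/andP/idP => [[/places_at[_]]|ho]; first by rewrite ffunE eqxx.
  by split; [exact: at_places|rewrite ffunE eqxx].
congr (_ *: _); rewrite /place_sign (bigD1 b) //= ffunE eqxx big1 ?mulr1 // => x /negPf xb.
by rewrite ffunE xb; case: pickP.
Qed.

Let filter_b c o : [seq x <- lg E q | placement_at o x == Some c] = if o == Some c then [:: b] else [::].
Proof. by rewrite lgq /= ffunE eqxx. Qed.

Let filter_other c o j : j != q ->
  [seq x <- lg E j | placement_at o x == Some c] = if c == inl j then lg E j else [::].
Proof.
move=> jq; have H x : x \in lg E j -> placement_at o x = Some (inl j).
  move=> xj; rewrite ffunE.
  have xb : x != b by apply: contraNneq jq => xb; rewrite -b_lg -xb.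
  by rewrite (negPf xb) (others xb xj).
rewrite -(filter_predT (lg E j)) -filter_predI; case: ifP => hc.
  by apply: eq_in_filter => x /H /= ->; rewrite (eqP hc) eqxx.
rewrite -(filter_pred0 (lg E j)); apply: eq_in_filter => x /H /= ->.
by rewrite (inj_eq Some_inj) eq_sym hc.
Qed.

Local Notation copied o c := (@copied_legs n n conj_copies E (placement_at o) c).

Let copied_q o : copied o (inl q) = if o == Some (inl q) then [:: b] else [::].
Proof. exact: (filter_b (inl q)). Qed.

Let copied_inl o j : j != q -> copied o (inl j) = lg E j.
Proof. by move=> jq; rewrite -[LHS]/(filter _ (lg E j)) filter_other // eqxx. Qed.

Let copied_inr o e : copied o (inr e) = if o == Some (inr e) then [:: b] else [::].
Proof.
have h : oriented (S := conj_copies) (inr e) (if o == Some (inr e) then [:: b] else [::]) =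
  if o == Some (inr e) then [:: b] else [::].
  by case: ifP => _; rewrite /oriented; case: ifP.
by rewrite -[RHS]h -filter_b.
Qed.

Let lg_ne o j : j != i -> lg (place (X := E) (placement_at o)) j = copied o (inl j).
Proof.
move=> /negPf ji; rewrite -[LHS]/(flatten (map (fun c => copied o c) (conj_cs j))) /conj_cs ji.
exact: cats0.
Qed.

Let lg_i o : lg (place (X := E) (placement_at o)) i =
  (if o == Some (inr true) then [:: b] else [::]) ++ [:: a] ++
  (if o == Some (inr false) then [:: b] else [::]).
Proof.
rewrite -[LHS]/(flatten (map (fun c => copied o c) (conj_cs i))) /conj_cs eqxx.
rewrite -[LHS]/(copied o (inr true) ++ copied o (inl i) ++ copied o (inr false) ++ [::]).
by rewrite cats0 !copied_inr copied_inl //= eqxx.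
Qed.

Let place_at o l : lg (place (X := E) (placement_at o)) i = l ->
  (o == Some (inl q)) = false ->
  cls K d (place (X := E) (placement_at o)) = cls K d (set_lg X i l).
Proof.
move=> hl ho; congr cls; apply: diagram_eq => j.
case: (eqVneq j i) => [->|ji]; first exact: hl.
apply: etrans (lg_ne o ji) _; case: (eqVneq j q) => [->|jq]; first by rewrite copied_q ho Xq.
by rewrite copied_inl //= (negPf ji) (negPf jq).
Qed.

(** Three copies can receive b. Staying on arc q gives E; the copy for x_q comes after a on arc i
    and gives [Xab]; the reversed copy for x_q^-1 comes before a and gives [Xba] with sign -1. *)
Lemma pull_conj : pull K d conj_copies E = cls K d E + (cls K d Xab - cls K d Xba).
Proof.
have cq : copied (Some (inl q)) (inl q) = lg E q by rewrite copied_q eqxx lgq.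
have e1 : cls K d (place (X := E) (placement_at (Some (inl q)))) = cls K d E.
  congr cls; apply: diagram_eq => j.
  case: (eqVneq j i) => [->|ji]; first by apply: etrans (lg_i _) _; rewrite /= ?eqxx.
  apply: etrans (lg_ne _ ji) _; case: (eqVneq j q) => [->|jq].
    by rewrite cq lgq /= eqxx.
  by rewrite copied_inl //= (negPf ji).
have e2 : cls K d (place (X := E) (placement_at (Some (inr false)))) = cls K d Xab.
  by apply: place_at => //; rewrite lg_i.
have e3 : cls K d (place (X := E) (placement_at (Some (inr true)))) = cls K d Xba.
  by apply: place_at => //; rewrite lg_i.
rewrite pull_sum /copies_of_b !big_cons big_nil e1 e2 e3.
have -> : weight K (Some (inl q) : option (copy conj_copies)) = 1 by [].
have -> : weight K (Some (inr false) : option (copy conj_copies)) = 1 by [].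
have -> : weight K (Some (inr true) : option (copy conj_copies)) = -1 by exact: expr1.
by rewrite !scale1r scaleN1r [X in _ + (_ + X)]addr0.
Qed.

End Conjugation.

(** * The matrices of the automorphisms in use *)

Section Abelianization.
Local Open Scope ring_scope.
Variables (K : fieldType) (n : nat).

Definition abelianization (g : free_aut n) : 'M[K]_n := linearization K (hom_copies g).

Lemma abelianizationE g j i :
  abelianization g j i = \sum_(a <- word (g (free_gen j)) | a.1 == i) (-1) ^+ a.2.
Proof.
rewrite /abelianization linearizationE [map _ _]lt_arc_copies; apply: perm_big.
by rewrite perm_rev.
Qed.

Lemma abelianization_transvection (g : free_aut n) i q : i != q -> (forall j,
  word (g (free_gen j)) = if j == i then [:: (i, false); (q, false)] else [:: (j, false)]) ->
  abelianization g = 1%:M + delta_mx i q.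
Proof.
move=> niq hg; apply/matrixP => j k; rewrite abelianizationE hg !mxE.
case: (eqVneq j i) => [->|ji]; rewrite !big_cons !big_nil /=.
  by rewrite [k == q]eq_sym; case: (i == k); case: (q == k); rewrite ?expr0 ?addr0 ?add0r.
by rewrite addr0; case: eqP => _; rewrite ?expr0 ?addr0.
Qed.

Lemma abelianization_conjugation (g : free_aut n) i q : i != q -> (forall j,
  word (g (free_gen j)) =
    if j == i then [:: (q, false); (i, false); (q, true)] else [:: (j, false)]) ->
  abelianization g = 1%:M.
Proof.
move=> niq hg; apply/matrixP => j k; rewrite abelianizationE hg !mxE.
case: (eqVneq j i) => [->|ji]; rewrite !big_cons !big_nil /=.
  rewrite !addr0 expr0 expr1; case: (q == k); case: (i == k); by rewrite ?subrr ?addr0.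
by case: eqP => _; rewrite ?expr0 ?addr0.
Qed.

End Abelianization.

(** * The action on the filtration and its graded pieces *)

Section Action.
Local Open Scope ring_scope.
Variables (K : fieldType) (d n : nat).
Local Notation Fil := (@jacobi_filtration K d n).
Local Notation cls := (cls K d).
Local Notation act := (@jacobi_act K d n).
Implicit Types (X : diagram n) (g : free_aut n).

Lemma actP g a u v : act (a *: u + v) g = a *: act u g + act v g.
Proof. exact: jacobi_map_linear. Qed.

Lemma actD g u v : act (u + v) g = act u g + act v g.
Proof. by rewrite -[u]scale1r actP !scale1r. Qed.

Lemma act0 g : act 0 g = 0.
Proof. by apply: (@addrI _ (act 0 g)); rewrite -actD !addr0. Qed.

Lemma actZ g a u : act (a *: u) g = a *: act u g.
Proof. by rewrite -[a *: u]addr0 actP act0 [LHS]addr0. Qed.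

Lemma act_sum g (I : finType) (F : I -> jacobi_space K d n) :
  act (\sum_i F i) g = \sum_i act (F i) g.
Proof. exact: (big_morph (fun u => act u g) (actD g) (act0 g)). Qed.

Lemma actN g u : act (- u) g = - act u g.
Proof.
by apply/eqP; rewrite -subr_eq0 opprK -actD addNr act0.
Qed.

Lemma actB g u v : act (u - v) g = act u g - act v g.
Proof. by rewrite actD actN. Qed.

Lemma act_cls g X : valid d X -> act (cls X) g = pull K d (hom_copies g) X.
Proof. exact: jacobi_map_cls. Qed.

Lemma filtration_act k u g : Fil k u -> Fil k (act u g).
Proof.
apply: (filtration_ind (P := fun u => Fil k (act u g))) => [|a v w hv hw|X v hk].
- by rewrite act0; apply: filtration0.
- by rewrite actP; apply/filtrationD/hw/filtrationZ.
rewrite act_cls //; apply: filtration_sum => p Pp; apply/filtrationZ/filtration_cls => //.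
exact: placed_valid.
Qed.

Definition diagram_tensor X (v : tensor K n (legs_of X)) : jacobi_space K d n :=
  \sum_b v b *: cls (recolor b).

Lemma diagram_tensorP X a v w : @diagram_tensor X (a *: v + w) = a *: diagram_tensor v + diagram_tensor w.
Proof.
rewrite /diagram_tensor scaler_sumr -big_split; apply: eq_bigr => b _.
by rewrite !ffunE scalerDl scalerA.
Qed.

Lemma diagram_tensor_delta X c : diagram_tensor (delta_tensor K c) = cls (@recolor n n X c).
Proof.
rewrite /diagram_tensor (bigD1 c) //= ffunE eqxx scale1r big1 ?addr0 // => b /negPf bc.
by rewrite ffunE bc scale0r.
Qed.

Lemma filtration_diagram_tensor k X v : valid d X -> (k + #|leg (X := X)| <= d.*2)%N -> Fil k (@diagram_tensor X v).
Proof.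
move=> vX hk; apply: filtration_sum => b _; apply/filtrationZ/filtration_cls => //; exact: recolor_valid.
Qed.

Lemma act_diagram_tensor k g X v : valid d X -> (k + #|leg (X := X)| = d.*2)%N ->
  Fil k.+1 (act (diagram_tensor v) g - @diagram_tensor X (tens (abelianization K g) v)).
Proof.
move=> vX hk.
have -> : diagram_tensor (tens (abelianization K g) v) =
    \sum_(c : {ffun legs_of X -> 'I_n}) v c *: \sum_(b : {ffun legs_of X -> 'I_n})
      (\prod_l abelianization K g (b l) (c l)) *: cls (recolor b).
  rewrite /diagram_tensor; under eq_bigr => b _ do rewrite ffunE scaler_suml.
  rewrite exchange_big; apply: eq_bigr => c _; rewrite scaler_sumr.
  by apply: eq_bigr => b _; rewrite scalerA mulrC.
rewrite /diagram_tensor act_sum -sumrB; apply: filtration_sum => c _.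
rewrite actZ -scalerBr; apply: filtrationZ; rewrite act_cls; last exact: recolor_valid.
exact: pull_recolor.
Qed.

(** An automorphism acting trivially on the abelianization acts trivially on tensor powers, hence on
    each graded piece. A diagram with more than k trivalent vertices is already in the next step. *)
Lemma act_unipotent k g w : abelianization K g = 1%:M -> Fil k w -> Fil k.+1 (act w g - w).
Proof.
move=> hg; apply: (filtration_ind (P := fun w => Fil k.+1 (act w g - w))) => [|a u v hu hv|X v].
- by rewrite act0 subrr; exact: filtration0.
- rewrite actP opprD addrACA -scalerBr; apply: filtrationD hv; exact: filtrationZ.
rewrite leq_eqVlt => /orP[/eqP hk|hk]; last first.
  have h : Fil k.+1 (cls X) by apply: filtration_cls.
  by apply: filtrationB; [exact: filtration_act|].
have [c hc] := filtration_recolor K hk v.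
have -> : act (cls X) g - cls X = act (cls X - cls (recolor c)) g +
    (act (cls (recolor c)) g - cls (recolor c)) - (cls X - cls (recolor c)).
  by rewrite actB subrKA opprB subrKA.
apply: (filtrationB _ hc); apply: filtrationD; first exact: filtration_act.
have := act_diagram_tensor g (delta_tensor K c) v hk.
by rewrite hg tens_scalar expr1n scale1r diagram_tensor_delta.
Qed.

Definition diagram_tensor_preimage X (Q : jacobi_space K d n -> Prop) (v : tensor K n (legs_of X)) : Prop :=
  Q (diagram_tensor v).

Section Preimage.
Variables (k : nat) (X : diagram n) (Q : jacobi_space K d n -> Prop).
Hypotheses (vX : valid d X) (hk : (k + #|leg (X := X)| = d.*2)%N).
Hypotheses (sQ : is_submodule act Q) (FQ : forall u, Fil k.+1 u -> Q u).

Lemma submoduleD u v : Q u -> Q v -> Q (u + v).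
Proof. by case: sQ => _ h _ hu hv; rewrite -[u]scale1r; apply: h. Qed.

Lemma submoduleN u : Q u -> Q (- u).
Proof. by case: sQ => h0 h _ hu; rewrite -scaleN1r -[_ *: _]addr0; apply: h. Qed.

Lemma submodule_subr u v : Q u -> Q (v - u) -> Q v.
Proof. by move=> hu huv; rewrite -(subrK u v); apply: submoduleD. Qed.

Local Notation U := (@diagram_tensor_preimage X Q).

Lemma preimage0 : U 0.
Proof.
rewrite /diagram_tensor_preimage /diagram_tensor big1 => [|b _]; first by case: sQ.
by rewrite ffunE scale0r.
Qed.

Lemma preimageP a v w : U v -> U w -> U (a *: v + w).
Proof. by rewrite /diagram_tensor_preimage diagram_tensorP => hv hw; case: sQ => _ h _; apply: h. Qed.

(** A transvection of the free group induces this matrix. The error in [act_diagram_tensor] lies in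
    the next filtration step, which Q contains. *)
Lemma preimage_stab i j : i != j -> stab U (1%:M + delta_mx i j).
Proof.
move=> nij v hv; have [g hg] := transvection_aut nij.
rewrite -(abelianization_transvection K nij hg) /diagram_tensor_preimage.
have h1 : Q (act (diagram_tensor v) g) by case: sQ => _ _; apply.
have h2 := FQ (act_diagram_tensor g v vX hk).
by apply: submodule_subr h1 _; rewrite -opprB; apply: submoduleN.
Qed.

End Preimage.
End Action.

(** * The radical *)

Section Unglue.
Variables (d n : nat).

(** If no leg were joined to a trivalent vertex, the half-edges reaching a leg would all be legs
    themselves; but every half-edge reaches a leg, and fewer than 2d legs leave some trivalent
    vertex. *)
Lemma exists_trivalent_leg (Y : diagram n) : valid d Y -> (#|leg (X := Y)| < d.*2)%N ->
  exists s : half Y, ~~ leg s /\ leg (mt s).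
Proof.
move=> v small.
have nI : injective (nx (d := Y)).
  by move=> x y h; rewrite -(valid_nx v x) h (valid_nx v).
have [x0 nx0] : exists x : half Y, ~~ leg x.
  apply/existsP; apply: contraTT small; rewrite negb_exists => /forallP h.
  have e : #|half Y| = #|leg (X := Y)|.
    by apply: eq_card => x; have := h x; rewrite negbK inE => lx; rewrite [RHS]lx.
  by have := valid_deg v; rewrite e; lia.
have H (x : half Y) : leg x \/ exists s : half Y, ~~ leg s /\ leg (mt s).
  move: x; apply: (valid_conn v (P := fun x => leg x \/ _)) => x; [by left| |].
    case=> [lx|]; [left|by right].
    by rewrite /leg -(inj_eq nI) [_ == _]lx.
  case=> [lx|]; [|by right].
  by case: (boolP (leg x)) => lx'; [left|right; exists x].
by case: (H x0) => // lx; rewrite lx in nx0.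
Qed.

(** The inverse of [glue]: s and its mate are deleted and the two other half-edges at the vertex of
    s become fixed points of [nx]. *)
Lemma unglue_iso (Y : diagram n) (s : half Y) i : valid d Y -> ~~ leg s -> lg Y i = [:: mt s] ->
  exists (Z : diagram n) (a b : half Z),
  [/\ iso (glue Z a b i [::] [::]) Y, a != b, nx a = a, nx b = b &
      forall j, lg Y j = [::] -> lg Z j = [::]].
Proof.
move=> v ns lgi.
have nI : injective (nx (d := Y)).
  by move=> x y h; rewrite -(valid_nx v x) h (valid_nx v).
have lms : nx (mt s) = mt s.
  by apply/eqP; apply: (mem_lg v (i := i)); rewrite lgi mem_head.
pose P := [pred x : half Y | (x != s) && (x != mt s)].
have n3 : nx (nx (nx s)) = s := valid_nx v s.
have nms x : (nx x == mt s) = (x == mt s) by rewrite -{1}lms (inj_eq nI).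
have n3' x : (nx x == s) = (x == nx (nx s)) by rewrite -{1}n3 (inj_eq nI).
have sms : s != mt s by rewrite eq_sym (valid_mt_neq v).
have Pb : P (nx s) by rewrite /= nms sms andbT.
have Pa : P (nx (nx s)).
  by rewrite /= !nms sms andbT; apply: contraNneq ns => e; rewrite /leg -{1}e n3.
pose T := {x | P x}.
pose a : T := Sub _ Pa; pose b : T := Sub _ Pb.
have neq : a != b by rewrite -val_eqE /= (inj_eq nI).
have Pn (x : T) : P (if (x == a) || (x == b) then val x else nx (val x)).
  case: ifP => [_|/norP[xa xb]]; first exact: (valP x).
  have /andP[x1 x2] := valP x.
  by rewrite /= nms x2 andbT n3' -[nx (nx s)]/(val a) val_eqE.
have Pm (x : T) : P (mt (val x)).
  have /andP[x1 x2] := valP x; apply/andP; split.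
    by apply: contra x2 => /eqP <-; rewrite (valid_mt v).
  by rewrite (can_eq (valid_mt v)).
have [nZ nZE] : exists f : T -> T, forall x,
    val (f x) = if (x == a) || (x == b) then val x else nx (val x).
  by exists (fun x => Sub _ (Pn x)) => x; rewrite SubK.
have [mZ mZE] : exists f : T -> T, forall x, val (f x) = mt (val x).
  by exists (fun x => Sub _ (Pm x)) => x; rewrite SubK.
(* [pmap insub] drops the deleted leg, so Z lists nothing on arc i. *)
pose Z := Diagram T nZ mZ (fun j => pmap insub (lg Y j)).
exists Z, a, b; split=> //; first last.
- by move=> j e; rewrite /= e.
- by apply: val_inj; rewrite nZE eqxx orbT.
- by apply: val_inj; rewrite nZE eqxx.
pose h (z : half (glue Z a b i [::] [::])) : half Y :=
  match z with None => mt s | Some None => s | Some (Some x) => val x end.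
exists h; split.
- apply: inj_surj_bij.
    case=> [[x|]|] [[y|]|] //= e; rewrite ?(val_inj e) //;
      do ?[by have := valP x; rewrite /= e eqxx ?andbF];
      do ?[by have := valP y; rewrite /= -e eqxx ?andbF];
      by case/eqP: sms; first [exact: e | exact: (esym e)].
  move=> y; case: (eqVneq y s) => [->|ys]; first by exists (Some None).
  case: (eqVneq y (mt s)) => [->|yms]; first by exists None.
  have Py : P y by rewrite /= ys.
  by exists (Some (Some (Sub y Py : T))); rewrite /= ?SubK.
- case=> [[x|]|] /=; last by rewrite lms.
    case: (eqVneq x b) => [->|xb] //=.
    case: (eqVneq x a) => [->|xa] /=; first by rewrite n3.
    by rewrite nZE (negPf xa) (negPf xb).
  by [].
- by case=> [[x|]|] /=; rewrite ?mZE ?(valid_mt v).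
move=> j; case: (eqVneq j i) => [->|ji]; first by rewrite lgi /= eqxx.
rewrite /= (negPf ji) -map_comp (eq_map (g := val)) //.
rewrite (pmap_filter (@insubK _ P _)); apply/esym/all_filterP/allP => x xj.
rewrite /= isSome_insub /=; apply/andP; split.
  by apply: contraNneq ns => <-; apply: (mem_lg v xj).
apply: contraNneq ji => xms; apply/eqP; apply: (lg_arc_uniq v xj).
by rewrite lgi xms mem_head.
Qed.

End Unglue.

(** * Generating a filtration step from the one above it *)

Section Generation.
Local Open Scope ring_scope.
Variables (K : fieldType) (d n : nat).
Local Notation Fil := (@jacobi_filtration K d n).
Local Notation cls := (cls K d).
Local Notation act := (@jacobi_act K d n).
Hypotheses (charK0 : [pchar K] =i pred0) (dn : (d.*2 <= n)%N).

Section Step.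
Variables (k : nat) (Q : jacobi_space K d n -> Prop).
Hypotheses (sQ : is_submodule act Q) (FQ : forall u, Fil k.+2 u -> Q u).
Hypothesis IQ : forall w g, abelianization K g = 1%:M -> Fil k w -> Q (act w g - w).

(** The diagram is unglued at a leg on its arc i, and b is moved to a free arc q. This yields a
    diagram with one trivalent vertex fewer, on which conjugation by x_q differs from the identity
    by the STU difference, that is by the original diagram. *)
Lemma multilinear_mem (X : diagram n) (c : {ffun legs_of X -> 'I_n}) : valid d X ->
  (k.+1 + #|leg (X := X)| = d.*2)%N -> injective c -> Q (cls (recolor c)).
Proof.
move=> vX hk cI; have vY := recolor_valid c vX.
have [s [ns lms]] : exists s : half (recolor c), ~~ leg s /\ leg (mt s).
  by apply: (exists_trivalent_leg vY); rewrite -hk addSn ltnS; apply: leq_addl.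
pose l0 : legs_of X := Sub (mt s) lms; pose i := c l0.
(* There are 2d - (k + 1) legs, strictly fewer than n. *)
have [q hq] : exists q, q \notin codom c.
  apply/existsP; apply: contraT; rewrite negb_exists => /forallP H.
  have : (#|'I_n| <= #|codom c|)%N.
    by apply: subset_leq_card; apply/fintype.subsetP => x _; have := H x; rewrite negbK.
  rewrite card_codom // legs_of_card card_ord leqNgt => /negP[].
  by apply: leq_trans dn; rewrite -hk addSn ltnS; apply: leq_addl.
have lgi : lg (recolor c) i = [:: mt s].
  rewrite /= (eq_filter (a2 := pred1 l0)) => [|l]; last exact: (inj_eq cI).
  by rewrite filter_pred1_uniq ?enum_uniq ?mem_enum //= ?SubK.
have [Z [a [b [iZ neq la lb hZ]]]] := unglue_iso vY ns lgi.
have lgq : lg Z q = [::].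
  apply: hZ; rewrite /= (eq_filter (a2 := pred0)) ?filter_pred0 // => l /=.
  by apply/negP => /eqP e; case/negP: hq; rewrite -e codom_f.
have niq : i != q by apply: contraNneq hq => <-; apply: codom_f.
have vG := iso_valid (iso_sym iZ) vY.
have vab : valid d (set_lg Z i [:: a; b]) by apply/(valid_glueE d i [::] [::] neq la lb).
have vE := valid_split niq vab lgq.
have [g hg] := conjugation_aut niq.
have := IQ (abelianization_conjugation K niq hg) (w := cls (set_lg (set_lg Z q [:: b]) i [:: a])).
rewrite act_cls // (pull_eq_letters K (S' := conj_copies i q) vE); last first.
  move=> j; rewrite [LHS]lt_arc_copies /image_word hg /= /conj_cs.
  by case: eqP.
rewrite pull_conj // [X in Q X](_ : _ = cls (set_lg Z i [:: a; b]) - cls (set_lg Z i [:: b; a])).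
  rewrite -(@cls_glue K d n Z a b i [::] [::] vab) (cls_iso K vG iZ); apply.
  apply: filtration_cls => //; rewrite -[#|leg (X := set_lg _ _ _)|]/(#|leg (X := Z)|).
  rewrite -(glue_card_leg i [::] [::] neq la lb) (iso_leg iZ).
  by rewrite -[#|leg (X := recolor _)|]/(#|leg (X := X)|) addnS -addSn hk.
by rewrite addrC addKr.
Qed.

(** One diagram with distinct arcs per underlying graph suffices: by [stable_full] its orbit spans
    all distributions of the legs modulo the next step. *)
Lemma filtration_generated u : Fil k.+1 u -> Q u.
Proof.
apply: (filtration_ind (P := Q)) => [|a v w hv hw|X vX].
- by case: sQ.
- by case: sQ => _ h _; apply: h.
rewrite leq_eqVlt => /orP[/eqP hk|hk]; last by apply: FQ; apply: filtration_cls.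
have [c hc] := filtration_recolor K hk vX.
apply: (submodule_subr sQ (u := cls (recolor c))); last exact: FQ.
have Ln : (#|{: legs_of X}| <= n)%N.
  by rewrite legs_of_card (leq_trans _ dn) // -hk leq_addl.
have [c0 c0I] : exists c0 : {ffun legs_of X -> 'I_n}, injective c0.
  pose f (l : legs_of X) : 'I_n := widen_ord Ln (enum_rank l).
  exists [ffun l => f l] => l l'; rewrite !ffunE => /(congr1 val) /= e.
  by apply/enum_rank_inj/val_inj.
have Qc0 : diagram_tensor_preimage Q (delta_tensor K c0).
  by rewrite /diagram_tensor_preimage diagram_tensor_delta; apply: multilinear_mem.
have := stable_full charK0 (preimage0 X sQ) (preimageP (X := X) sQ)
  (preimage_stab vX hk sQ FQ) c0I Qc0 (delta_tensor K c).
by rewrite /diagram_tensor_preimage diagram_tensor_delta.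
Qed.

End Step.

Lemma filtration_submodule k : is_submodule act (Fil k).
Proof.
split=> [|a u v hu hv|u g]; [exact: filtration0|by apply/filtrationD/hv/filtrationZ|exact: filtration_act].
Qed.

Definition sum_set (N P : jacobi_space K d n -> Prop) u := exists2 w, N w & P (u - w).

Lemma sum_submodule N P : is_submodule act N -> is_submodule act P ->
  is_submodule act (sum_set N P).
Proof.
move=> sN sP; split.
- by exists 0; [case: sN|rewrite subrr; case: sP].
- move=> a u v [w Nw Pw] [w' Nw' Pw']; exists (a *: w + w').
    by case: sN => _ h _; apply: h.
  by rewrite opprD addrACA -scalerBr; case: sP => _ h _; apply: h.
- move=> u g [w Nw Pw]; exists (act w g); first by case: sN => _ _; apply.
  by rewrite -actB; case: sP => _ _; apply.
Qed.

Lemma sum_subl N P u : is_submodule act P -> N u -> sum_set N P u.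
Proof. by move=> sP Nu; exists u => //; rewrite subrr; case: sP. Qed.

Lemma sum_subr N P u : is_submodule act N -> P u -> sum_set N P u.
Proof. by move=> sN Pu; exists 0; rewrite ?subr0 //; case: sN. Qed.

(** An analogue of Nakayama's lemma: F_k lies in N + F_(k+1+r) for every r, by induction, and the
    last summand is eventually zero. *)
Lemma nakayama k N : is_submodule act N ->
  (forall u, Fil k u -> sum_set N (Fil k.+1) u) -> forall u, Fil k u -> N u.
Proof.
move=> sN H.
have filtration_addn j r u : Fil (j + r) u -> Fil j u.
  by elim: r => [|r IH]; rewrite ?addn0 ?addnS // => /filtration_mono.
have G r u : Fil k u -> sum_set N (Fil (k.+1 + r)) u.
  elim: r u => [|r IH] u ku; first by rewrite addn0; apply: H.
  have [w Nw hw] := IH u ku.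
  have sQ := sum_submodule sN (filtration_submodule (k + r).+2).
  have [w' Nw' hw'] : sum_set N (Fil (k + r).+2) (u - w).
    (* A given w0 in F_(k+r) is w1 in N plus a rest in F_(k+r+1). The automorphism moves w1 within
       N, and moves the rest by an element of F_(k+r+2). *)
    apply: (filtration_generated (k := (k + r)%N) sQ) => [v|w0 g hg w0k|]; last by rewrite -addSn.
      exact: sum_subr.
    have [w1 Nw1 hw1] := IH w0 (filtration_addn _ _ _ w0k).
    have -> : act w0 g - w0 = (act w1 g - w1) + (act (w0 - w1) g - (w0 - w1)).
      by rewrite actB opprB addrACA subrKC addKr.
    apply: (submoduleD sQ).
      apply: sum_subl; first exact: filtration_submodule.
      by apply: (submoduleD sN); [case: sN => _ _; apply|apply: (submoduleN sN)].
    by apply: sum_subr => //; apply: act_unipotent hg _; rewrite -addSn.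
  exists (w + w'); first exact: (submoduleD sN).
  by rewrite opprD addrA addSn addnS.
(* With r = 2d the index exceeds 2d, the largest possible number of trivalent vertices. *)
move=> u ku; have [w Nw hw] := G d.*2 u ku.
have /eqP : u - w = 0 by apply: filtration_bot hw; rewrite addSn ltnS leq_addl.
by rewrite subr_eq0 => /eqP ->.
Qed.

End Generation.

(** * Maximal submodules of the filtration steps *)

Section Radical.
Local Open Scope ring_scope.
Variables (K : fieldType) (d n : nat).
Local Notation Fil := (@jacobi_filtration K d n).
Local Notation cls := (cls K d).
Local Notation act := (@jacobi_act K d n).
Hypotheses (charK0 : [pchar K] =i pred0) (dn : (d.*2 <= n)%N).

(** C is the image of a stable complement of the preimage of Q, enlarged by F_(k+1). It complements
    Q only modulo F_(k+1) and within the part coming from the single graph X. *)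
Lemma diagram_tensor_complement k (X : diagram n) Q : valid d X -> (k + #|leg (X := X)| = d.*2)%N ->
  is_submodule act Q -> (forall u, Fil k.+1 u -> Q u) ->
  exists C : jacobi_space K d n -> Prop,
  [/\ is_submodule act C, forall u, C u -> Fil k u,
      forall u, C u -> Q u -> Fil k.+1 u &
      forall v : tensor K n (legs_of X), exists2 u, Q u & C (diagram_tensor d v - u)].
Proof.
move=> vX hk sQ FQ.
have Ln : (#|{: legs_of X}| <= n)%N.
  by rewrite legs_of_card (leq_trans _ dn) // -hk leq_addl.
have [Ct [[Ct0 CtP] Cts CtU Ctall]] := stable_complement charK0 Ln (preimage0 X sQ)
  (preimageP (X := X) sQ) (preimage_stab vX hk sQ FQ).
have diagram_tensor0 : diagram_tensor d (0 : tensor K n (legs_of X)) = 0 :> jacobi_space K d n.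
  by rewrite /diagram_tensor big1 // => b _; rewrite ffunE scale0r.
exists (fun u => exists2 c, Ct c & Fil k.+1 (u - diagram_tensor d c)); split.
- split=> [|a u v [c hc cu] [e he ev]|u g [c hc cu]].
  + by exists 0 => //; rewrite diagram_tensor0 subrr; exact: filtration0.
  + exists (a *: c + e); first exact: CtP.
    by rewrite diagram_tensorP opprD addrACA -scalerBr; apply: filtrationD ev; apply: filtrationZ.
  + exists (tens (abelianization K g) c); first exact: Cts.
    rewrite -(subrKA (act (diagram_tensor d c) g)) -actB; apply: filtrationD; first exact: filtration_act.
    exact: act_diagram_tensor.
- move=> u [c _ cu]; rewrite -(subrK (diagram_tensor d c) u); apply: filtrationD; first exact: filtration_mono.
  by apply: filtration_diagram_tensor; rewrite ?hk.
- move=> u [c hc cu] Qu; have c0 : c = 0.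
    apply: CtU hc; rewrite /diagram_tensor_preimage -[diagram_tensor d c](subKr u).
    by apply: (submoduleD sQ Qu); apply: (submoduleN sQ); apply: FQ.
  by move: cu; rewrite c0 diagram_tensor0 subr0.
- move=> v; have [u Uu Cu] := Ctall v; exists (diagram_tensor d u) => //; exists (v - u) => //.
  have -> : diagram_tensor d (v - u) = diagram_tensor d v - diagram_tensor d u.
    by rewrite -scaleN1r addrC diagram_tensorP scaleN1r addrC.
  by rewrite subrr; exact: filtration0.
Qed.

Lemma avoiding_submodule k u : ~ Fil k.+1 u -> exists N : jacobi_space K d n -> Prop,
  [/\ is_submodule act N, forall w, Fil k.+1 w -> N w, forall w, N w -> Fil k w, ~ N u &
      forall M : jacobi_space K d n -> Prop, is_submodule act M -> (forall w, N w -> M w) ->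
        (forall w, M w -> Fil k w) -> ~ M u -> forall w, M w -> N w].
Proof.
move=> nFu.
(* Zorn's lemma is applied to all chains, including the empty one. Joining F_(k+1) makes the empty
   union admissible, as [ext] of the empty set is F_(k+1). *)
pose ext (A : jacobi_space K d n -> Prop) w := A w \/ Fil k.+1 w.
pose good (A : classical_sets.set (jacobi_space K d n)) :=
  [/\ is_submodule act (ext A), forall w, ext A w -> Fil k w & ~ ext A u].
have sF := filtration_submodule K d n k.+1.
have [A [[sA FA nAu] maxA]] : exists A, good A /\ forall B, classical_sets.proper A B -> ~ good B.
  apply: classical_sets.Zorn_bigcup => F Fgood Ftot; split.
  - split=> [|a v w|v g].
    + by right; case: sF.
    + case=> [[A FA Av]|Fv]; case=> [[B FB Bw]|Fw].
      * case: (Ftot _ _ FA FB) => AB.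
          have [[_ h _] _ _] := Fgood _ FB.
          by case: (h a v w (or_introl (AB _ Av)) (or_introl Bw)); [left; exists B|right].
        have [[_ h _] _ _] := Fgood _ FA.
        by case: (h a v w (or_introl Av) (or_introl (AB _ Bw))); [left; exists A|right].
      * have [[_ h _] _ _] := Fgood _ FA.
        by case: (h a v w (or_introl Av) (or_intror Fw)); [left; exists A|right].
      * have [[_ h _] _ _] := Fgood _ FB.
        by case: (h a v w (or_intror Fv) (or_introl Bw)); [left; exists B|right].
      * by right; case: sF => _ h _; apply: h.
    + case=> [[A FA Av]|Fv]; last by right; case: sF => _ _; apply.
      have [[_ _ h] _ _] := Fgood _ FA.
      by case: (h v g (or_introl Av)); [left; exists A|right].
  - move=> w [[A FA Aw]|]; last exact: filtration_mono.
    by have [_ h _] := Fgood _ FA; apply: h; left.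
  - by case=> [[A FA Au]|//]; have [_ _ []] := Fgood _ FA; left.
exists (ext A); split=> // [w Fw|M sM NM MF nMu w Mw]; first by right.
have eM : ext M = M.
  apply: boolp.funext => z; apply: boolp.propext; split=> [[]//|Mz]; last by left.
  by move=> Fz; apply: NM; right.
apply: boolp.contrapT => nNw; apply: (maxA M); last by rewrite /good eM.
split=> [z Az|MA]; first by apply: NM; left.
by apply: nNw; left; apply: MA.
Qed.

Lemma radical_filtrationE k : radical act (Fil k) = Fil k.+1.
Proof.
apply: boolp.funext => u; apply: boolp.propext; split=> [[ku hu]|ku]; last first.
  split=> [|N [sN NF nNF maxN]]; first exact: filtration_mono.
  have sF := filtration_submodule K d n k.+1; have sS := sum_submodule sN sF.
  (* By maximality N + F_(k+1) is either N, which then contains F_(k+1), or F_k, in which case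
     [nakayama] forces N = F_k. *)
  case: (maxN _ sS) => [w Nw|w [w1 Nw1 Fw]|<-|e].
  - exact: sum_subl.
  - rewrite -(subrK w1 w); apply: filtrationD; first exact: filtration_mono.
    exact: NF.
  - exact: sum_subr.
  case: nNF; apply: boolp.funext => w; apply: boolp.propext; split; first exact: NF.
  apply: (nakayama charK0 dn sN) => {w} w; by rewrite -{1}e.
apply: boolp.contrapT => nku.
have [N [sN FN NF nNu maxN]] := avoiding_submodule nku.
(* It remains to see that N is a maximal submodule of F_k, since u would then belong to it. *)
apply: (nNu); apply: hu; split=> // [e|Q sQ NQ QF].
  by apply: nNu; rewrite e.
have [[w [Qw nNw]]|nw] := boolp.EM (exists w, Q w /\ ~ N w); last first.
  left; apply: boolp.funext => w; apply: boolp.propext; split; last exact: NQ.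
  by move=> Qw; apply: boolp.contrapT => nNw; apply: nw; exists w.
right; apply: boolp.funext => v; apply: boolp.propext; split; first exact: QF.
(* N is maximal among submodules avoiding u, so a strictly larger Q contains u; what follows shows
   that such a Q is all of F_k. *)
have Qu : Q u by apply: boolp.contrapT => nQu; apply: nNw; apply: maxN nQu _ Qw.
have FQ z : Fil k.+1 z -> Q z by move=> /FN/NQ.
apply: (filtration_ind (P := Q)) => [|a z z' hz hz'|X vX]; first by case: sQ.
  by case: sQ => _ h _; apply: h.
rewrite leq_eqVlt => /orP[/eqP hk|hk]; last by apply: FQ; apply: filtration_cls.
have [c hc] := filtration_recolor K hk vX.
apply: (submodule_subr sQ (u := cls (recolor c))); last exact: FQ.
have [C [sC CF CQ Call]] := diagram_tensor_complement vX hk sQ FQ.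
have sM := sum_submodule sN sC.
(* If u = w1 + c with w1 in N and c in C, then c = u - w1 also lies in Q, hence in F_(k+1) and in N,
   and so does u. Thus N + C avoids u and equals N, which puts C inside Q. *)
have nMu : ~ sum_set N C u.
  case=> w1 Nw1 Cw; apply: nNu; rewrite -(subrK w1 u); apply: (submoduleD sN) => //.
  by apply/FN/(CQ _ Cw)/(submoduleD sQ Qu)/(submoduleN sQ)/NQ.
have CN z : C z -> N z.
  move=> Cz; apply: (maxN _ sM _ _ nMu); last exact: sum_subr.
    by move=> z' Nz'; apply: sum_subl.
  move=> z' [w1 Nw1 Cw]; rewrite -(subrK w1 z'); apply: filtrationD; last exact: NF.
  exact: CF.
rewrite -diagram_tensor_delta; have [z Qz Cz] := Call (delta_tensor K c).
by apply: (submodule_subr sQ Qz); apply/NQ/CN.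
Qed.

End Radical.

Theorem theorem1p5 (K : fieldType) (d n : nat)
    (charK0 : [pchar K]%R =i pred0) (dn : d.*2 <= n) :
  (forall k : nat,
     radical_filtration (@jacobi_act K d n) k = jacobi_filtration k) /\
  (forall k : nat,
     radical (@jacobi_act K d n) (jacobi_filtration k) = jacobi_filtration k.+1).
Proof.
have h k := radical_filtrationE charK0 dn k; split=> // k.
elim: k => [|k IH]; last by rewrite /radical_filtration iterS -/(radical_filtration _ k) IH.
apply: boolp.funext => u; apply: boolp.propext; split=> // _.
exact: filtration_top.
Qed.
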